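(* Let $\nu,\kappa>0$ be constants with $\kappa\ge\nu$, put $K=\kappa/\nu+1$, and let $\gamma\in[2,\infty)$ satisfy $\gamma=2$ or $\gamma\ge 9/4$. Let $T>0$ and let $u:\mathbb{T}^3\times[0,T]\to\mathbb{R}^3$ and $\theta:\mathbb{T}^3\times[0,T]\to\mathbb{R}$ be classical solutions on $\mathbb{T}^3\times[0,T]$ of the system (summation over the repeated index $i$, for $j=1,2,3$) $$\partial_tu_j+u_i\partial_iu_j+\frac1\gamma u_j\partial_iu_i-\nu\,\partial_i(\theta\,\partial_iu_j)=0,$$ $$\partial_t(\theta^2)+\partial_i(u_i\theta^2)-\kappa\,\partial_i\big(\theta\,\partial_i(\theta^2)\big)=\nu\,\theta|\nabla u|^2,$$ with initial data $u(\cdot,0)=u_0\in H^1(\mathbb{T}^3)$ and $\theta(\cdot,0)=\theta_0\in L^2(\mathbb{T}^3)$ with $\theta_0\ge1$ on $\mathbb{T}^3$. Then there exist constants $C=C(\nu,\gamma,K,\|u_0\|_{L^\gamma},\|\theta_0\|_{L^2})>0$ and $M=M(K,\gamma)>0$ (depending only on the indicated quantities) such that $$\int_{\mathbb{T}^3}\theta(x,t)^{-1/K}|\nabla u(x,t)|^2\,dx\le\int_{\mathbb{T}^3}\theta_0(x)^{-1/K}|\nabla u_0(x)|^2\,dx+C\left(t^M+1\right)$$ holds for all $t\in[0,T]$. Moreover, the quantities $$\int_{\mathbb{T}^3}\theta^{(K-1)/K}|\nabla^2u|^2\,dx,\qquad \int_{\mathbb{T}^3}\theta^{-(K+1)/K}|\nabla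 u|^4\,dx,\qquad \int_{\mathbb{T}^3}\theta^{-(K+1)/K}|\nabla u|^2|\nabla\theta|^2\,dx$$ are integrable in time on $[0,T]$.
   Context: $\mathbb{T}^3$ is the three-dimensional torus. The function $\theta^2$ represents the temperature, $\theta$ being its positive square root. The initial data are assumed sufficiently regular. $|\nabla u|^2=\sum_{i,j}(\partial_iu_j)^2$ and $|\nabla^2u|^2=\sum_{i,j,k}(\partial_i\partial_ku_j)^2$. *)

(* Defs.v *)
From HB Require Import structures.
From mathcomp Require Import all_boot all_order all_algebra.
From mathcomp Require Import all_classical all_reals all_analysis.

Set Implicit Arguments.
Unset Strict Implicit.
Unset Printing Implicit Defensive.
Import Order.TTheory GRing.Theory Num.Theory.
Import numFieldNormedType.Exports.

Local Open Scope classical_set_scope.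
Local Open Scope ring_scope.

(* T^3 = R^3 / Z^3: functions on the torus are functions on R^3 that are
   1-periodic in each coordinate, and integration over T^3 is Lebesgue
   integration over the unit cube, hence the measure [torus] below.
   Points are in [R * R * R] rather than ['rV[R]_3] because only the former
   carries both the normed-space structure and the product Lebesgue measure. *)
Definition e_ (R : realType) (i : 'I_3) : R * R * R :=
  ((i == 0%N :> nat)%:R, (i == 1%N :> nat)%:R, (i == 2%N :> nat)%:R).

Definition cube (R : realType) :
    set (measurableTypeR R * measurableTypeR R * measurableTypeR R) :=
  `[0, 1]%classic `*` `[0, 1]%classic `*` `[0, 1]%classic.

Lemma measurable_cube (R : realType) : measurable (@cube R).
Proof. by do 2?apply: measurableX; exact: measurable_itv. Qed.

Definition torus (R : realType) :
    {measure set (measurableTypeR R * measurableTypeR R * measurableTypeR R)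
       -> \bar R} :=
  mrestr ((lebesgue_measure \x lebesgue_measure) \x lebesgue_measure)%E
         (@measurable_cube R).

Definition periodic3 (R : realType) (V : Type) (f : R * R * R -> V) : Prop :=
  forall x i, f (x + e_ R i) = f x.

Definition partial (R : realType) (i : 'I_3) (f : R * R * R -> R)
  (x : R * R * R) : R := 'D_(e_ R i) f x.

(* The derivative of f at t in [0, T], one-sided at the end points. *)
Definition dquot (R : realType) (f : R -> R) (t s : R) : R :=
  (f s - f t) / (s - t).

Definition derivable_in (R : realType) (T : R) (f : R -> R) (t : R) : Prop :=
  cvg (dquot f t @ within `[0, T] t^').

Definition dtime (R : realType) (T : R) (f : R -> R) (t : R) : R :=
  lim (dquot f t @ within `[0, T] t^').

(* Joint continuity on T^3 x [0, T]. *)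
Definition cont_on (R : realType) (T : R) (f : R * R * R -> R -> R) : Prop :=
  {within [set: R * R * R] `*` `[0, T],
    continuous (fun p : (R * R * R) * R => f p.1 p.2)}.

(* Classical regularity for a second-order parabolic equation: f, its time
   derivative and its space derivatives up to order two exist everywhere on
   T^3 x [0, T] and are continuous there. *)
Definition C2x1t (R : realType) (T : R) (f : R * R * R -> R -> R) : Prop :=
  [/\ forall t, t \in `[0, T] -> periodic3 (f^~ t),
      cont_on T f,
      (forall x t, t \in `[0, T] -> derivable_in T (f x) t) /\
      cont_on T (fun x t => dtime T (f x) t),
      forall i, (forall x t, t \in `[0, T] -> derivable (f^~ t) x (e_ R i)) /\
        cont_on T (fun x t => partial i (f^~ t) x)
    & forall i k, (forall x t, t \in `[0, T] ->
          derivable (partial i (f^~ t)) x (e_ R k)) /\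
        cont_on T (fun x t => partial k (partial i (f^~ t)) x)].

Definition vcomp (R : realType) (v : R * R * R -> 'rV[R]_3) (j : 'I_3) :
  R * R * R -> R := fun x => v x 0 j.

(* The norm of the normed space ['rV[R]_3] is the sup norm. *)
Definition enorm (R : realType) (a : 'rV[R]_3) : R :=
  Num.sqrt (\sum_(j < 3) a 0 j ^+ 2).

Definition grad_sq (R : realType) (f : R * R * R -> R) (x : R * R * R) : R :=
  \sum_(i < 3) partial i f x ^+ 2.

Definition vgrad_sq (R : realType) (v : R * R * R -> 'rV[R]_3)
    (x : R * R * R) : R :=
  \sum_(i < 3) \sum_(j < 3) partial i (vcomp v j) x ^+ 2.

Definition vhess_sq (R : realType) (v : R * R * R -> 'rV[R]_3)
    (x : R * R * R) : R :=
  \sum_(i < 3) \sum_(j < 3) \sum_(k < 3)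
    partial i (partial k (vcomp v j)) x ^+ 2.

Definition Lp_norm (R : realType) (p : R) (f : R * R * R -> R) : R :=
  fine ('N[torus R]_(p%:E)[EFin \o f])%E.

Definition in_L2 (R : realType) (f : R * R * R -> R) : Prop :=
  f \in Lfun (torus R) 2%:E.

Definition smooth (R : realType) (f : R * R * R -> R) : Prop :=
  forall s : seq 'I_3, let g := foldr (@partial R) f s in
    continuous g /\ forall x i, derivable g x (e_ R i).

(* H^1(T^3), with g the weak gradient of f. *)
Definition in_H1 (R : realType) (f : R * R * R -> R) : Prop :=
  in_L2 f /\
  exists g : 'I_3 -> R * R * R -> R, forall i, in_L2 (g i) /\
    forall phi : R * R * R -> R, periodic3 phi -> smooth phi ->
      \int[torus R]_x (f x * partial i phi x) =
      - \int[torus R]_x (g i x * phi x).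

Definition momentum_eq (R : realType) (nu gamma T : R)
    (u : R * R * R -> R -> 'rV[R]_3) (theta : R * R * R -> R -> R) : Prop :=
  forall x t, t \in `[0, T] -> forall j : 'I_3,
    dtime T (fun s => u x s 0 j) t
    + \sum_(i < 3) u x t 0 i * partial i (vcomp (u^~ t) j) x
    + gamma^-1 * u x t 0 j * \sum_(i < 3) partial i (vcomp (u^~ t) i) x
    - nu * \sum_(i < 3)
        partial i (fun y => theta y t * partial i (vcomp (u^~ t) j) y) x
    = 0.

Definition temperature_eq (R : realType) (nu kappa T : R)
    (u : R * R * R -> R -> 'rV[R]_3) (theta : R * R * R -> R -> R) : Prop :=
  forall x t, t \in `[0, T] ->
    dtime T (fun s => theta x s ^+ 2) t
    + \sum_(i < 3) partial i (fun y => u y t 0 i * theta y t ^+ 2) x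
    - kappa * \sum_(i < 3)
        partial i (fun y => theta y t
          * partial i (fun z => theta z t ^+ 2) y) x
    = nu * theta x t * vgrad_sq (u^~ t) x.

(* theta > 0 because theta is the positive square root of the temperature. *)
Definition classical_solution (R : realType) (nu kappa gamma T : R)
    (u : R * R * R -> R -> 'rV[R]_3) (theta : R * R * R -> R -> R) : Prop :=
  [/\ forall j : 'I_3, C2x1t T (fun x t => u x t 0 j),
      C2x1t T theta,
      forall x t, t \in `[0, T] -> 0 < theta x t,
      momentum_eq nu gamma T u theta
    & temperature_eq nu kappa T u theta].

(* Main.v *)
(* Write a = 1/K, G = |grad u|^2 and D = int theta^(-a) G.  In the time
   derivative of D the second derivatives of u combine, after integration by
   parts, to a negative square, and the mixed terms cancel because
   a kappa = nu (1 - a).  This leaves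
   D' <= - c int theta^(-a-1) G^2 + C int theta^(3-a) + C int theta^(-a-1) |u|^4.
   The maximum principle gives 1/theta <= C (1 + t), the momentum equation tested
   with |u|^(gamma-2) u gives a bound of int |u|^gamma, and this, with an
   interpolation inequality when 9/4 <= gamma < 4, bounds the growth of
   int (theta^2 + |u|^2) and leaves the dissipation - nu int theta G to spare.
   The last two terms of D' are then interpolated between this energy and,
   respectively, int theta^(1-a) |grad theta|^2, which appears in the derivative
   of int theta^(2-a), and the negative term of D'.  All the interpolation
   inequalities come from the Gagliardo inequality
   (int f^3)^2 <= prod_i int (f^2 + |2 f d_i f|), so that a combination of D,
   - int theta^(2-a) and the energy grows at most polynomially.
   Since the solutions are classical, the integrals of the last assertion are
   continuous in time. *)
From HB Require Import structures.
Require Import Defs.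
From mathcomp Require Import all_boot all_order all_algebra.
From mathcomp Require Import all_classical all_reals all_analysis.
From mathcomp Require Import measurable_realfun ring lra.

Import Order.TTheory GRing.Theory Num.Theory.
Import numFieldNormedType.Exports.
Local Open Scope classical_set_scope.
Local Open Scope ring_scope.
Set Implicit Arguments.
Unset Strict Implicit.
Unset Printing Implicit Defensive.

(** * The torus as a probability space *)

(** Three obstacles shape the proof. A classical solution has neither third space derivatives nor
    derivatives mixing space and time, so D cannot be differentiated under the integral: its
    increments are integrated by parts until only u and theta are differenced in time, and int d_k f
    d_i g = int d_i f d_k g is proved for C^1 functions by translating one factor. Powers of |u| are
    not smooth where u vanishes, so s = |u|^2 + delta replaces |u|^2; delta depends on T and on the
    solution, the bounds do not. Finally, all estimates must be polynomial in t with constants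
    independent of T, hence the explicit powers of 1 + t. The threshold 9/4 is where int s^(3 -
    gamma/2), left over by Young's inequality, falls below int s^(5 gamma/6), the power that
    Gagliardo's inequality controls linearly by int s^(gamma/2 - 1) |grad u|^2. The degree M = 33 is
    one more than 32 = 2 + 24 + 6, the powers of 1 + t collected in D' from theta^(-a-1), from the
    twelfth power of the energy bound and from the inverse cube of an absorption parameter. *)

Section restricted_measure.
Context d (T : measurableType d) (R : realType).
Variables (m mu : {measure set T -> \bar R}) (D : set T).
Hypothesis mD : measurable D.
Hypothesis mE : forall A, measurable A -> m A = mu (A `&` D).

Lemma ge0_integral_restr (f : T -> \bar R) :
  measurable_fun setT f -> (forall x, 0 <= f x)%E ->
  (\int[m]_x f x = \int[mu]_(x in D) f x)%E.
Proof.
move=> mf f0; rewrite (@ge0_negligible_integral _ _ _ m _ (~` D)) //.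
- rewrite setDE setCK setTI; apply: eq_measure_integral => A mA AD.
  by rewrite mE// setIidl.
- exact: measurableC.
- by rewrite mE ?setICl ?measure0//; exact: measurableC.
Qed.

Lemma integral_restr (f : T -> \bar R) : measurable_fun setT f ->
  (\int[m]_x f x = \int[mu]_(x in D) f x)%E.
Proof.
move=> mf; rewrite [LHS]integralE [RHS]integralE.
by rewrite !ge0_integral_restr//;
  [exact: measurable_funeneg|exact: measurable_funepos].
Qed.

Lemma integrable_restr_bounded (f : T -> R) (M : R) :
  (mu D < +oo)%E -> measurable_fun setT f ->
  (forall x, D x -> `|f x| <= M) -> m.-integrable setT (EFin \o f).
Proof.
move=> muD mf fM; apply/integrableP; split; first exact/measurable_EFinP.
rewrite ge0_integral_restr//; last first.
  by apply: measurableT_comp => //; exact/measurable_EFinP.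
have : mu.-integrable D (EFin \o f).
  apply: measurable_bounded_integrable => //.
    exact: measurable_funTS.
  exists M; split; first exact: num_real.
  by move=> r Mr x Dx /=; rewrite (le_trans (fM _ Dx))// ltW.
by move=> /integrableP[].
Qed.

(* The domains on which [f] and [g] are compared are only [D], because
   continuous functions need not be bounded off the unit cube. *)
Lemma restr_mean (C : set (T -> R)) (J : (T -> R) -> R) :
  mu D = 1%E ->
  (forall f, C f -> measurable_fun setT f /\ exists M, forall x, D x -> `|f x| <= M) ->
  (forall f, J f = Rintegral m setT f) ->
  [/\ forall c, J (fun=> c) = c,
    forall f g, C f -> C g -> J (fun x => f x + g x) = J f + J g,
    forall c f, C f -> J (fun x => c * f x) = c * J f &
    forall f g, C f -> C g -> (forall x, D x -> f x <= g x) -> J f <= J g].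
Proof.
move=> D1 HC JE.
have iC f : C f -> m.-integrable setT (EFin \o f).
  move=> /HC[mf [M fM]]; apply: (integrable_restr_bounded (M := M)) => //.
  by rewrite D1 ltry.
have iCD f : C f -> mu.-integrable D (EFin \o f).
  move=> /HC[mf [M fM]]; apply: measurable_bounded_integrable => //.
  - by rewrite D1 ltry.
  - exact: measurable_funTS.
  - exists M; split; first exact: num_real.
    by move=> r Mr x Dx /=; rewrite (le_trans (fM _ Dx))// ltW.
split=> [c|f g Cf Cg|c f Cf|f g Cf Cg fg]; rewrite !JE.
- by rewrite Rintegral_cst//= mE// setTI D1 mulr1.
- by rewrite RintegralD//; exact: iC.
- by rewrite RintegralZl//; exact: iC.
- have E h : C h -> Rintegral m setT h = \int[mu]_(x in D) h x.
    move=> /HC[mh _]; rewrite /Rintegral integral_restr//.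
    exact/measurable_EFinP.
  by rewrite !E//; apply: le_Rintegral => //; exact: iCD.
Qed.

End restricted_measure.

Section unit_interval.
Variable R : realType.

Lemma lebesgue_unit_itv : (@lebesgue_measure R `[0%R, 1%R] = 1)%E.
Proof. by rewrite lebesgue_measure_itv /= lte_fin ltr01 oppr0 adde0. Qed.

Lemma measurable_unit_itv : measurable (`[0%R, 1%R]%classic : set (measurableTypeR R)).
Proof. exact: measurable_itv. Qed.

Let mT := measurableTypeR R.

Let leb01 : set mT -> \bar R := mrestr (@lebesgue_measure R) measurable_unit_itv.

HB.instance Definition _ := Measure.on leb01.

Let leb01_setT : leb01 setT = 1%E.
Proof. by rewrite /leb01 /mrestr setTI lebesgue_unit_itv. Qed.

HB.instance Definition _ := Measure_isProbability.Build _ _ _ leb01 leb01_setT.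

Definition unit_leb : probability mT R := leb01.

Definition unit_leb2 : probability (mT * mT)%type R := (unit_leb \x unit_leb)%E.

Lemma measurable_unit_square :
  measurable (`[0%R, 1%R] `*` `[0%R, 1%R] : set (mT * mT)).
Proof. exact: measurableX. Qed.

Let leb2 : {measure set (mT * mT) -> \bar R} :=
  (@lebesgue_measure R \x @lebesgue_measure R)%E.

Lemma unit_leb2E (B : set (mT * mT)) : measurable B ->
  unit_leb2 B = mrestr leb2 measurable_unit_square B.
Proof.
move=> mB; apply: product_measure_unique => // U V mU mV.
change (leb2 (U `*` V `&` `[0%R, 1%R] `*` `[0%R, 1%R]) = unit_leb U * unit_leb V)%E.
have -> : U `*` V `&` `[0, 1] `*` `[0, 1] =
  (U `&` `[0, 1]) `*` (V `&` `[0, 1]) :> set (R * R).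
  by apply/seteqP; split=> [] [x y] /=; tauto.
by apply: product_measure1E; exact: measurableI.
Qed.

Lemma unit_lebE (A : set mT) :
  unit_leb A = mrestr (@lebesgue_measure R) measurable_unit_itv A.
Proof. by []. Qed.

(** Restricting the product measure and multiplying the restricted measures agree on rectangles,
    hence everywhere. The second form, a product of probability measures, is the one to which
    Fubini's theorem is applied. *)
Lemma torusE (A : set (mT * mT * mT)) : measurable A ->
  torus R A = (unit_leb2 \x unit_leb)%E A.
Proof.
move=> mA; symmetry.
refine (@product_measure_unique _ _ _ _ _ unit_leb2 unit_leb
  (torus R) _ A mA) => B C mB mC.
change ((leb2 \x (@lebesgue_measure R))%E (B `*` C `&` @cube R) =
  unit_leb2 B * unit_leb C)%E.
have -> : B `*` C `&` @cube R =
  (B `&` `[0, 1] `*` `[0, 1]) `*` (C `&` `[0, 1]) :> set (R * R * R).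
  by apply/seteqP; split=> [] [[x y] z]; rewrite /cube /=; tauto.
rewrite unit_leb2E//.
apply: (@product_measure1E _ _ _ _ _ leb2); last exact: measurableI.
by apply: measurableI => //; exact: measurable_unit_square.
Qed.

End unit_interval.

(** Rational intervals in the last coordinate suffice if each is paired with the interior of the set
    of points over which the whole strip lies in [U]. As [T] is arbitrary, measurability of open
    sets of R^3 follows one factor at a time. *)
Lemma open_prodR_bigcup (T : topologicalType) (R : realType) (U : set (T * R)) :
  open U -> U = \bigcup_(p : rat) \bigcup_(q : rat)
    ([set x | forall y, ratr p < y < ratr q -> U (x, y)]° `*`
     `]ratr p, ratr q[).
Proof.
move=> oU; apply/seteqP; split=> [[x y] Uxy|[x y] [p _ [q _ []]] /=]; last first.
  by move=> /nbhs_singleton /= + ypq; apply; move: ypq; rewrite in_itv.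
have [[A B] /= [Ax /nbhs_ballP[e /= e0 yB]] AB] : nbhs (x, y) U by exact: oU.
have [p /andP[p1 p2]] : exists p : rat, y - e < ratr p < y.
  by have [|p] := @rat_in_itvoo R (y - e) y; [lra|rewrite in_itv; exists p].
have [q /andP[q1 q2]] : exists q : rat, y < ratr q < y + e.
  by have [|q] := @rat_in_itvoo R y (y + e); [lra|rewrite in_itv; exists q].
exists p => //; exists q => //; split => /=; last by rewrite in_itv/= p2 q1.
apply: filterS Ax => a Aa z /andP[z1 z2]; apply: AB; split => //=.
by apply: yB; rewrite /ball/= ltr_norml; lra.
Qed.

Section continuous_measurable_prod.
Variable R : realType.

Lemma open_measurable2 (U : set (R * R)) : open U ->
  measurable (U : set (measurableTypeR R * measurableTypeR R)).
Proof.
move=> oU; rewrite (open_prodR_bigcup oU).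
apply: bigcupT_measurable_rat => p; apply: bigcupT_measurable_rat => q.
apply: measurableX; last exact: measurable_itv.
exact: open_measurable (open_interior _).
Qed.

Lemma open_measurable3 (U : set (R * R * R)) : open U ->
  measurable (U : set (measurableTypeR R * measurableTypeR R * measurableTypeR R)).
Proof.
move=> oU; rewrite (open_prodR_bigcup oU).
apply: bigcupT_measurable_rat => p; apply: bigcupT_measurable_rat => q.
apply: measurableX; last exact: measurable_itv.
exact: open_measurable2 (open_interior _).
Qed.

Lemma continuous_measurable2 (f : R * R -> R) : continuous f ->
  measurable_fun [set: measurableTypeR R * measurableTypeR R] f.
Proof.
move=> cf; apply: (measurability _ (RGenOpens.measurableE R)).
move=> _ [_ [a [b ->] <-]]; rewrite setTI; apply: open_measurable2.
by apply: open_comp => // x _; exact: cf.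
Qed.

Lemma continuous_measurable3 (f : R * R * R -> R) : continuous f ->
  measurable_fun [set: measurableTypeR R * measurableTypeR R * measurableTypeR R] f.
Proof.
move=> cf; apply: (measurability _ (RGenOpens.measurableE R)).
move=> _ [_ [a [b ->] <-]]; rewrite setTI; apply: open_measurable3.
by apply: open_comp => // x _; exact: cf.
Qed.

End continuous_measurable_prod.

(** * Continuity and abstract means *)

Section continuity.
Variables (R : realType) (T : topologicalType).
Implicit Types f g : T -> R.

Lemma cont_cst (c : R) : continuous (fun _ : T => c).
Proof. by move=> x; exact: cvg_cst. Qed.

Lemma contD f g : continuous f -> continuous g -> continuous (fun x => f x + g x).
Proof. by move=> cf cg x; apply: cvgD; [exact: cf|exact: cg]. Qed.

Lemma contN f : continuous f -> continuous (fun x => - f x).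
Proof. by move=> cf x; apply: cvgN; exact: cf. Qed.

Lemma contB f g : continuous f -> continuous g -> continuous (fun x => f x - g x).
Proof. by move=> cf cg; apply: contD => //; exact: contN. Qed.

Lemma contM f g : continuous f -> continuous g -> continuous (fun x => f x * g x).
Proof. by move=> cf cg x; apply: cvgM; [exact: cf|exact: cg]. Qed.

Lemma contX f n : continuous f -> continuous (fun x => f x ^+ n).
Proof.
move=> cf; elim: n => [|n IH]; first exact: cont_cst.
by under eq_fun do rewrite exprS; exact: contM.
Qed.

Lemma cont_sum (I : Type) (r : seq I) (P : pred I) (F : I -> T -> R) :
  (forall i, continuous (F i)) -> continuous (fun x => \sum_(i <- r | P i) F i x).
Proof.
move=> cF; elim: r => [|i s IH].
  by under eq_fun do rewrite big_nil; exact: cont_cst.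
under eq_fun do rewrite big_cons; case: (P i); last exact: IH.
exact: contD.
Qed.

Lemma cont_norm f : continuous f -> continuous (fun x => `|f x|).
Proof. by move=> cf x; apply: cvg_norm; exact: cf. Qed.

Lemma cont_powR f (p : R) : continuous f -> (forall x, 0 < f x) ->
  continuous (fun x => f x `^ p).
Proof.
move=> cf f0.
have -> : (fun x => f x `^ p) = (fun x => expR (p * ln (f x))).
  by apply/funext => y; rewrite /powR gt_eqF.
move=> x; apply: (@cvg_comp _ _ _ (fun x => p * ln (f x)) expR _ (nbhs (p * ln (f x)))).
  apply: cvgM; first exact: cvg_cst.
  apply: (@cvg_comp _ _ _ f (@ln R) _ (nbhs (f x))); first exact: cf.
  exact: continuous_ln.
exact: continuous_expR.
Qed.

End continuity.

Lemma cont_comp (T S U : topologicalType) (f : T -> S) (g : S -> U) :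
  continuous f -> continuous g -> continuous (fun x => g (f x)).
Proof. by move=> cf cg x; apply: (@continuous_comp _ _ _ f g); [exact: cf|exact: cg]. Qed.

Lemma cont_pair (T S U : topologicalType) (f : T -> S) (g : T -> U) :
  continuous f -> continuous g -> continuous (fun x => (f x, g x)).
Proof. by move=> cf cg x; apply: cvg_pair; [exact: cf|exact: cg]. Qed.

Lemma cont_id (T : topologicalType) : continuous (fun x : T => x).
Proof. by move=> x; exact: cvg_id. Qed.

Lemma cont_fst (T S : topologicalType) : continuous (fun x : T * S => x.1).
Proof. by move=> x; exact: cvg_fst. Qed.

Lemma cont_snd (T S : topologicalType) : continuous (fun x : T * S => x.2).
Proof. by move=> x; exact: cvg_snd. Qed.

Lemma cont_const (T S : topologicalType) (c : S) : continuous (fun _ : T => c).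
Proof. by move=> x; exact: cvg_cst. Qed.

Lemma cont_secl (T S U : topologicalType) (f : T * S -> U) s :
  continuous f -> continuous (fun x => f (x, s)).
Proof.
move=> cf; apply: (@cont_comp _ _ _ (fun x => (x, s)) f) => //.
by apply: cont_pair; [exact: cont_id|exact: cont_const].
Qed.

Lemma cont_secr (T S U : topologicalType) (f : T * S -> U) x :
  continuous f -> continuous (fun s => f (x, s)).
Proof.
move=> cf; apply: (@cont_comp _ _ _ (fun s => (x, s)) f) => //.
by apply: cont_pair; [exact: cont_const|exact: cont_id].
Qed.

(** The tube lemma: continuity at [(x, s0)] gives the estimate on a box around that point, and
    compactness of [K] makes the neighbourhood of [s0] independent of [x]. Both [(y, s)] and
    [(y, s0)] are compared with [(x, s0)], hence the halves of [e]. *)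
Lemma compact_tube (R : realType) (T S : topologicalType) (K : set T)
    (f : T * S -> R) (s0 : S) (e : R) :
  compact K -> continuous f -> 0 < e ->
  \forall s \near s0, forall x, K x -> `|f (x, s) - f (x, s0)| < e.
Proof.
move=> /compact_near_coveringP cK cf e0.
apply: (cK _ (nbhs s0) (fun s x => `|f (x, s) - f (x, s0)| < e)) => x Kx.
have e20 : 0 < e / 2 by rewrite divr_gt0.
have /cvgrPdist_lt /(_ _ e20) [[A B] /= [Ax Bs] AB] := cf (x, s0).
exists (A, B) => //= -[y s] /= [Ay Bs'].
have h1 : `|f (x, s0) - f (y, s)| < e / 2 by exact: (AB (y, s)).
have h2 : `|f (x, s0) - f (y, s0)| < e / 2.
  by apply: (AB (y, s0)); split => //=; exact: nbhs_singleton.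
by move: h1 h2; rewrite !ltr_norml; lra.
Qed.

(** Treats [I1] and [I3] together as normalised positive functionals on continuous functions.
    Monotonicity is asked for inequalities on [K] only, because extrema exist only there. *)
Record is_mean (R : realType) (T : topologicalType) (K : set T)
    (J : (T -> R) -> R) : Prop := IsMean {
  mean_compact : compact K ;
  mean_cst : forall c, J (fun=> c) = c ;
  meanD : forall f g : T -> R, continuous f -> continuous g ->
    J (fun x => f x + g x) = J f + J g ;
  meanZ : forall c (f : T -> R), continuous f -> J (fun x => c * f x) = c * J f ;
  le_mean : forall f g : T -> R, continuous f -> continuous g ->
    (forall x, K x -> f x <= g x) -> J f <= J g }.

Section mean_theory.
Variables (R : realType) (T : topologicalType) (K : set T) (J : (T -> R) -> R).
Hypothesis mJ : is_mean K J.
Implicit Types f g : T -> R.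

Lemma meanN f : continuous f -> J (fun x => - f x) = - J f.
Proof.
move=> cf; rewrite -mulN1r -(meanZ mJ)//; congr J.
by apply/funext => x; rewrite mulN1r.
Qed.

Lemma meanB f g : continuous f -> continuous g ->
  J (fun x => f x - g x) = J f - J g.
Proof.
by move=> cf cg; rewrite (meanD mJ) ?meanN//; exact: contN.
Qed.

Lemma mean_sum (I : Type) (r : seq I) (P : pred I) (F : I -> T -> R) :
  (forall i, continuous (F i)) ->
  J (fun x => \sum_(i <- r | P i) F i x) = \sum_(i <- r | P i) J (F i).
Proof.
move=> cF.
elim: r => [|i s IH].
  by rewrite big_nil; under eq_fun do rewrite big_nil; exact: (mean_cst mJ).
rewrite big_cons -IH.
under eq_fun do rewrite big_cons.
by case: (P i) => //; rewrite (meanD mJ)//; exact: cont_sum.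
Qed.

Lemma mean_ge0 f : continuous f -> (forall x, K x -> 0 <= f x) -> 0 <= J f.
Proof.
move=> cf f0; rewrite -[leLHS](mean_cst mJ); apply: (le_mean mJ) => //.
exact: cont_cst.
Qed.

Lemma mean_norm_le f M : continuous f -> (forall x, K x -> `|f x| <= M) ->
  `|J f| <= M.
Proof.
have cc := @cont_cst R T.
move=> cf fM; rewrite ler_norml; apply/andP; split.
  rewrite -[leLHS](mean_cst mJ); apply: (le_mean mJ) => // x /fM.
  by rewrite ler_norml => /andP[].
rewrite -[leRHS](mean_cst mJ); apply: (le_mean mJ) => // x /fM.
by rewrite ler_norml => /andP[].
Qed.

Lemma eq_mean f g : continuous f -> continuous g ->
  (forall x, K x -> f x = g x) -> J f = J g.
Proof.
move=> cf cg fg; apply/eqP; rewrite eq_le; apply/andP.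
by split; apply: (le_mean mJ) => // x /fg ->.
Qed.

Lemma continuous_mean (S : topologicalType) (f : T * S -> R) : continuous f ->
  continuous (fun s => J (fun x => f (x, s))).
Proof.
move=> cf s0; apply/cvgrPdist_le => e e0.
have cs s := @cont_secl _ _ _ f s cf.
apply: filterS (compact_tube s0 (mean_compact mJ) cf e0) => s Hs.
rewrite distrC -meanB//; apply: mean_norm_le => [|x Kx]; last exact/ltW/Hs.
exact: contB.
Qed.

(* The factor [a] absorbs difference quotients in which only one factor of a
   product is differentiable in time. *)
Lemma is_derive_mean (f g a : T * R -> R) (u v t : R) :
  continuous f -> continuous g -> continuous a -> u < t < v ->
  (forall x s, u < s < v -> is_derive s 1 (fun r => f (x, r)) (g (x, s))) ->
  is_derive t 1 (fun s => J (fun x => (f (x, s) - f (x, t)) * a (x, s)))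
    (J (fun x => g (x, t) * a (x, t))).
Proof.
move=> cf cg ca utv df.
have cs := @cont_secl T R R.
(* Two time arguments: the mean value theorem evaluates [g] at an intermediate time depending on
   [x], while [a] stays at time [h + t]. Uniformity over [K] near [(t, t)] handles both at once. *)
pose w (p : T * (R * R)) := g (p.1, p.2.1) * a (p.1, p.2.2).
have cw : continuous w.
  apply: contM.
    apply: (@cont_comp _ _ _ _ g _ cg); apply: cont_pair; first exact: cont_fst.
    by apply: (@cont_comp _ _ _ snd fst); [exact: cont_snd|exact: cont_fst].
  apply: (@cont_comp _ _ _ _ a _ ca); apply: cont_pair; first exact: cont_fst.
  by apply: (@cont_comp _ _ _ snd snd); exact: cont_snd.
pose F s := J (fun x => (f (x, s) - f (x, t)) * a (x, s)).
suff : h^-1 *: (F (h + t) - F t) @[h --> 0^'] --> J (fun x => g (x, t) * a (x, t)).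
  have E : (fun h => h^-1 *: (F (h + t) - F t)) =
           (fun h => h^-1 *: ((F \o shift t) (h *: 1) - F t)).
    by apply/funext => h /=; rewrite [h *: 1]mulr1.
  rewrite E => H; apply: DeriveDef; last exact: cvg_lim H.
  by apply/cvg_ex; eexists; exact: H.
apply/cvgrPdist_le => e e0.
have /nbhs_ballP[d /= d0 Hd] := compact_tube (t, t) (mean_compact mJ) cw e0.
near=> h.
have h0 : h != 0 by near: h; exact: nbhs_dnbhs_neq.
have hd : `|h| < d by near: h; apply: dnbhs0_lt.
have hu : `|h| < t - u by near: h; apply: dnbhs0_lt; rewrite subr_gt0; case/andP: utv.
have hv : `|h| < v - t by near: h; apply: dnbhs0_lt; rewrite subr_gt0; case/andP: utv.
have F0 : F t = 0.
  rewrite /F -[RHS](mean_cst mJ); congr J.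
  by apply/funext => x; rewrite subrr mul0r.
rewrite F0 subr0 /F -[_ *: _]/(_ * _) -(meanZ mJ); last first.
  by apply: contM; [apply: contB|]; exact: cs.
have c1 : continuous (fun x => g (x, t) * a (x, t)) by apply: contM; exact: cs.
have c2 : continuous (fun x => h^-1 * ((f (x, h + t) - f (x, t)) * a (x, h + t))).
  apply: contM; first exact: cont_cst.
  by apply: contM; [apply: contB|]; exact: cs.
rewrite -meanB//; apply: mean_norm_le => [|x Kx]; first exact: contB.
have dfs s : u < s < v -> derivable (fun r => f (x, r)) s 1 by move=> /(df x) [].
have [z zd ->] : exists2 z, `|z - t| < d & f (x, h + t) - f (x, t) = g (x, z) * h.
  have cont b c : {within `[b, c], continuous (fun r => f (x, r))}.
    by apply: continuous_subspaceT; exact: cont_secr.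
  move: hu hv hd; case: (ltgtP 0 h) h0 => // hs _.
    rewrite gtr0_norm// => hu hv hd.
    have [||z] := @MVT _ (fun r => f (x, r)) (fun s => g (x, s)) t (h + t) _ _ (cont _ _).
    - lra.
    - by move=> s; rewrite in_itv/= => /andP[? ?]; apply: df; lra.
    - rewrite in_itv/= => /andP[? ?] ->; exists z; last by rewrite addrK.
      by rewrite ltr_norml; lra.
  rewrite ltr0_norm// => hu hv hd.
  have [||z] := @MVT _ (fun r => f (x, r)) (fun s => g (x, s)) (h + t) t _ _ (cont _ _).
  - lra.
  - by move=> s; rewrite in_itv/= => /andP[? ?]; apply: df; lra.
  - rewrite in_itv/= => /andP[? ?] E; exists z; first by rewrite ltr_norml; lra.
    by rewrite -opprB E -mulrN opprB addrK.
have -> : h^-1 * (g (x, z) * h * a (x, h + t)) = w (x, (z, h + t)).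
  by rewrite /w /=; field.
have := Hd (z, h + t); rewrite /w /=.
move=> /(_ _ x Kx) /=; rewrite distrC => H; apply/ltW/H.
by split => /=; rewrite /ball/= distrC// addrK.
Unshelve. all: by end_near. Qed.

End mean_theory.

Section torus_mean.
Variable R : realType.

Definition I1 (f : R -> R) : R := \int[unit_leb R]_x f x.
Definition I2 (f : R * R -> R) : R := \int[unit_leb2 R]_x f x.
Definition I3 (f : R * R * R -> R) : R := \int[torus R]_x f x.

Lemma cont_bounded_compact (T : topologicalType) (K : set T) (f : T -> R) :
  compact K -> continuous f -> exists M, forall x, K x -> `|f x| <= M.
Proof.
move=> cK cf; have [K0|/set0P K0] := eqVneq K set0.
  by exists 0 => // x; rewrite K0.
have [|c _ cM] := @compact_EVT_max _ _ (fun x => `|f x|) _ K0 cK.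
  by apply: continuous_subspaceT; exact: cont_norm.
by exists `|f c| => // x Kx; apply: cM; rewrite inE.
Qed.

Lemma compact_unit : compact (`[0, 1]%classic : set R).
Proof. exact: segment_compact. Qed.

Lemma compact_square : compact (`[0, 1] `*` `[0, 1] : set (R * R)).
Proof. by apply: compact_setX; exact: segment_compact. Qed.

Lemma compact_cube : compact (@cube R : set (R * R * R)).
Proof. by apply: compact_setX; [exact: compact_square|exact: segment_compact]. Qed.

Let mT := measurableTypeR R.

Let square1 : ((lebesgue_measure \x lebesgue_measure)%E
  (`[0%R, 1%R] `*` `[0%R, 1%R] : set (mT * mT)) = 1)%E.
Proof.
rewrite product_measure1E; try exact: measurable_unit_itv.
by rewrite -[RHS]mule1; congr (_ * _)%E; exact: lebesgue_unit_itv.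
Qed.

Let cube1 : (((lebesgue_measure \x lebesgue_measure) \x lebesgue_measure)%E
  (@cube R : set (mT * mT * mT)) = 1)%E.
Proof.
rewrite /cube product_measure1E; try exact: measurable_unit_itv.
  rewrite -[RHS]mule1; congr (_ * _)%E; first exact: square1.
  exact: lebesgue_unit_itv.
exact: measurable_unit_square.
Qed.

Lemma integrable_I1 (f : R -> R) : continuous f ->
  (unit_leb R).-integrable setT (EFin \o f).
Proof.
move=> cf; have [M fM] := cont_bounded_compact compact_unit cf.
apply: (@integrable_restr_bounded _ _ R (unit_leb R) (@lebesgue_measure R) _
  (@measurable_unit_itv R) (fun A _ => @unit_lebE R A) f M) => //.
  by have /= -> := @lebesgue_unit_itv R; rewrite ltry.
exact: (@continuous_measurable_fun R f cf).
Qed.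

Lemma integrable_I2 (f : R * R -> R) : continuous f ->
  (unit_leb2 R).-integrable setT (EFin \o f).
Proof.
move=> cf; have [M fM] := cont_bounded_compact compact_square cf.
apply: (@integrable_restr_bounded _ _ R (unit_leb2 R)
  (@lebesgue_measure R \x @lebesgue_measure R)%E _
  (@measurable_unit_square R) (@unit_leb2E R) f M) => //.
  by have /= -> := square1; rewrite ltry.
exact: (@continuous_measurable2 R f cf).
Qed.

Lemma integrable_I3 (f : R * R * R -> R) : continuous f ->
  (torus R).-integrable setT (EFin \o f).
Proof.
move=> cf; have [M fM] := cont_bounded_compact compact_cube cf.
apply: (@integrable_restr_bounded _ _ R (torus R)
  (((@lebesgue_measure R) \x (@lebesgue_measure R)) \x (@lebesgue_measure R))%E _
  (@measurable_cube R) (fun _ _ => erefl) f M) => //.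
  by have /= -> := cube1; rewrite ltry.
exact: (@continuous_measurable3 R f cf).
Qed.

Lemma I1_mean : is_mean (`[0, 1]%classic : set R) I1.
Proof.
have [||//|] := @restr_mean _ _ R (unit_leb R) (@lebesgue_measure R) _ (@measurable_unit_itv R)
  (fun A _ => @unit_lebE R A) [set f : R -> R | continuous f] I1.
- exact: lebesgue_unit_itv.
- move=> f /= cf; split; first exact: (@continuous_measurable_fun R f cf).
  exact: (cont_bounded_compact compact_unit).
- by move=> *; split => //; exact: compact_unit.
Qed.

Lemma I3_mean : is_mean (@cube R : set (R * R * R)) I3.
Proof.
have [||//|] := @restr_mean _ _ R (torus R)
  (((@lebesgue_measure R) \x (@lebesgue_measure R)) \x (@lebesgue_measure R))%E _
  (@measurable_cube R)
  (fun _ _ => erefl) [set f : R * R * R -> R | continuous f] I3.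
- exact: cube1.
- move=> f /= cf; split; first exact: (@continuous_measurable3 R f cf).
  exact: (cont_bounded_compact compact_cube).
- by move=> *; split => //; exact: compact_cube.
Qed.

End torus_mean.

Ltac cont_tac := first [assumption | lazymatch goal with
  | |- forall x, @continuous_at _ _ x ?f => lazymatch f with
    | fun _ => ?c => exact (@cont_const _ _ c)
    | fun x => x => exact (@cont_id _)
    | fun x => (@?a x, @?b x) => apply: cont_pair; cont_tac
    | fun x => fst (@?g x) => refine (@cont_comp _ _ _ g fst _ (@cont_fst _ _)); cont_tac
    | fun x => snd (@?g x) => refine (@cont_comp _ _ _ g snd _ (@cont_snd _ _)); cont_tac
    | fun x => ?h (@?g x) => refine (@cont_comp _ _ _ g h _ _); [cont_tac|assumption]
    | _ => first [exact (@cont_fst _ _) | exact (@cont_snd _ _)]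
    end
  end].

(** * Iterated integrals of continuous functions *)

Section fubini.
Variable R : realType.
Notation I1 := (@I1 R).
Notation I2 := (@I2 R).
Notation I3 := (@I3 R).

Lemma cont_I1 (S : topologicalType) (f : S -> R -> R) :
  continuous (fun p : S * R => f p.1 p.2) -> continuous (fun s => I1 (f s)).
Proof.
move=> cf; apply: (continuous_mean (I1_mean R) (f := fun p : R * S => f p.2 p.1)).
by apply: (@cont_comp _ _ _ (fun p : R * S => (p.2, p.1)) (fun p : S * R => f p.1 p.2));
  cont_tac.
Qed.

Lemma EFin_I1 (f : R -> R) : continuous f ->
  (\int[unit_leb R]_x (f x)%:E)%E = (I1 f)%:E.
Proof. by move=> cf; rewrite fineK//; exact: (integrable_fin_num measurableT (integrable_I1 cf)). Qed.

Lemma EFin_I2 (f : R * R -> R) : continuous f ->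
  (\int[unit_leb2 R]_x (f x)%:E)%E = (I2 f)%:E.
Proof. by move=> cf; rewrite fineK//; exact: (integrable_fin_num measurableT (integrable_I2 cf)). Qed.

Lemma EFin_I3 (f : R * R * R -> R) : continuous f ->
  (\int[torus R]_x (f x)%:E)%E = (I3 f)%:E.
Proof. by move=> cf; rewrite fineK//; exact: (integrable_fin_num measurableT (integrable_I3 cf)). Qed.

Lemma I2_yx (f : R * R -> R) : continuous f ->
  I2 f = I1 (fun x => I1 (fun y => f (x, y))).
Proof.
move=> cf; apply: EFin_inj; rewrite -EFin_I2// -EFin_I1; last first.
  by apply: cont_I1 => /=; cont_tac.
rewrite -(integral12_prod_meas1 (integrable_I2 cf)).
by apply: eq_integral => x _; rewrite -EFin_I1//; cont_tac.
Qed.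

Lemma I2_xy (f : R * R -> R) : continuous f ->
  I2 f = I1 (fun y => I1 (fun x => f (x, y))).
Proof.
move=> cf; apply: EFin_inj; rewrite -EFin_I2// -EFin_I1; last first.
  by apply: cont_I1 => /=; cont_tac.
rewrite -(integral21_prod_meas1 (integrable_I2 cf)).
by apply: eq_integral => x _; rewrite -EFin_I1//; cont_tac.
Qed.

Let torus_prod (f : R * R * R -> R) : continuous f ->
  (\int[torus R]_x (f x)%:E)%E = (\int[unit_leb2 R \x unit_leb R]_x (f x)%:E)%E.
Proof. by move=> cf; apply: eq_measure_integral => A mA _; exact: torusE. Qed.

Let integrable_prod (f : R * R * R -> R) : continuous f ->
  (unit_leb2 R \x unit_leb R)%E.-integrable setT (EFin \o f).
Proof.
move=> cf; apply/integrableP; split.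
  by apply/measurable_EFinP; exact: (@continuous_measurable3 R f cf).
have <- : (\int[torus R]_x (`|f x|)%:E = \int[unit_leb2 R \x unit_leb R]_x (`|f x|)%:E)%E.
  by apply: torus_prod; exact: cont_norm.
by rewrite EFin_I3 ?ltry//; exact: cont_norm.
Qed.

Lemma I3_z (f : R * R * R -> R) : continuous f ->
  I3 f = I2 (fun p => I1 (fun z => f (p, z))).
Proof.
move=> cf; apply: EFin_inj; rewrite -EFin_I3// -EFin_I2; last first.
  by apply: cont_I1 => /=; cont_tac.
rewrite torus_prod// -(integral12_prod_meas1 (integrable_prod cf)).
by apply: eq_integral => x _; rewrite -EFin_I1//; cont_tac.
Qed.

Lemma I3_xyz (f : R * R * R -> R) : continuous f ->
  I3 f = I1 (fun x => I1 (fun y => I1 (fun z => f (x, y, z)))).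
Proof.
move=> cf; rewrite I3_z// I2_yx//.
by apply: cont_I1 => /=; cont_tac.
Qed.

Lemma I1_swap (f : R -> R -> R) : continuous (fun p : R * R => f p.1 p.2) ->
  I1 (fun x => I1 (fun y => f x y)) = I1 (fun y => I1 (fun x => f x y)).
Proof.
by move=> cf; rewrite -(I2_yx cf) (I2_xy cf).
Qed.

Definition upd (i : 'I_3) (x : R * R * R) (s : R) : R * R * R :=
  if (i == 0%N :> nat) then (s, x.1.2, x.2)
  else if (i == 1%N :> nat) then (x.1.1, s, x.2) else (x.1.1, x.1.2, s).

Lemma cont_upd i : continuous (fun p : (R * R * R) * R => upd i p.1 p.2).
Proof.
rewrite /upd; case: (nat_of_ord i == 0%N); first by cont_tac.
by case: (nat_of_ord i == 1%N); cont_tac.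
Qed.

Lemma I1_cst c : I1 (fun=> c) = c. Proof. exact: (mean_cst (I1_mean R)). Qed.

(** After averaging along direction [i] the integrand no longer depends on that coordinate, so the
    outer integration over it is that of a constant. This reduces identities on the torus to
    statements about functions on lines. *)
Lemma I3_upd (f : R * R * R -> R) i : continuous f ->
  I3 (fun x => I1 (fun s => f (upd i x s))) = I3 f.
Proof.
move=> cf; have cfu : continuous (fun x => I1 (fun s => f (upd i x s))).
  apply: cont_I1 => /=.
  exact: (@cont_comp _ _ _ (fun p : (R * R * R) * R => upd i p.1 p.2) f (@cont_upd i) cf).
rewrite (I3_xyz cfu) (I3_xyz cf); move: cfu; rewrite /upd.
case: (nat_of_ord i == 0%N) => /=; [|case: (nat_of_ord i == 1%N) => /=] => cfu.
- rewrite I1_cst [RHS]I1_swap; last by apply: cont_I1 => /=; cont_tac.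
  by congr I1; apply/funext => y; rewrite [RHS]I1_swap//; cont_tac.
- congr I1; apply/funext => x; rewrite I1_cst [RHS]I1_swap//; cont_tac.
- by congr I1; apply/funext => x; congr I1; apply/funext => y; rewrite I1_cst.
Qed.

End fubini.

(** * One-dimensional calculus *)

Section derive_rules.
Variables (R : realType) (V : normedModType R).
Implicit Types (f g : V -> R) (x v : V).

Lemma is_derive_lineP f x v (df : R) :
  is_derive x v f df <-> is_derive (0 : R) 1 (fun h : R => f (h *: v + x)) df.
Proof.
have E : (fun h => h^-1 *: ((f \o shift x) (h *: v) - f x)) =
  (fun h => h^-1 *: (((fun h => f (h *: v + x)) \o shift (0 : R)) (h *: (1 : R)) -
    f (0 *: v + x))).
  by apply/funext => h /=; rewrite scale0r add0r addr0 [h *: 1]mulr1.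
have E1 : derivable f x v = derivable (fun h : R => f (h *: v + x)) (0 : R) 1 :=
  congr1 (fun F => cvg (F @ 0^')) E.
have E2 : 'D_v f x = 'D_1 (fun h : R => f (h *: v + x)) (0 : R) :=
  congr1 (fun F => lim (F @ 0^')) E.
split=> -[d e]; split.
- exact: (eq_ind _ id d _ E1).
- exact: etrans (esym E2) e.
- exact: (eq_ind _ id d _ (esym E1)).
- exact: etrans E2 e.
Qed.

Lemma dervD f g x v (df dg : R) : is_derive x v f df -> is_derive x v g dg ->
  is_derive x v (fun y => f y + g y) (df + dg).
Proof. exact: is_deriveD. Qed.

Lemma dervN f x v (df : R) : is_derive x v f df ->
  is_derive x v (fun y => - f y) (- df).
Proof. exact: is_deriveN. Qed.

Lemma dervB f g x v (df dg : R) : is_derive x v f df -> is_derive x v g dg ->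
  is_derive x v (fun y => f y - g y) (df - dg).
Proof. exact: is_deriveB. Qed.

Lemma derv_cst x v (c : R) : is_derive x v (fun=> c) 0.
Proof. exact: is_derive_cst. Qed.

Lemma dervM f g x v (df dg : R) : is_derive x v f df -> is_derive x v g dg ->
  is_derive x v (fun y => f y * g y) (df * g x + f x * dg).
Proof.
move=> df' dg'; rewrite addrC (mulrC df).
exact: (@is_deriveM _ _ f g x v df dg).
Qed.

Lemma dervZ f x v (c df : R) : is_derive x v f df ->
  is_derive x v (fun y => c * f y) (c * df).
Proof. by move=> d; have := dervM (derv_cst x v c) d; rewrite mul0r add0r. Qed.

Lemma dervX f x v n (df : R) : is_derive x v f df ->
  is_derive x v (fun y => f y ^+ n) (n%:R * f x ^+ n.-1 * df).
Proof.
move=> d; elim: n => [|n IH].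
  by rewrite !mul0r; exact: derv_cst.
rewrite (_ : (fun y => _) = (fun y => f y * f y ^+ n)); last first.
  by apply/funext => y; rewrite exprS.
rewrite (_ : n.+1%:R * _ * _ = df * f x ^+ n + f x * (n%:R * f x ^+ n.-1 * df)).
  exact: dervM.
case: n {IH} => [|n]; first by rewrite expr0; ring.
by rewrite /= exprS -[n.+2]addn1 natrD; ring.
Qed.

Lemma derv_sum n (F : 'I_n -> V -> R) x v (dF : 'I_n -> R) :
  (forall i, is_derive x v (F i) (dF i)) ->
  is_derive x v (fun y => \sum_(i < n) F i y) (\sum_(i < n) dF i).
Proof.
move=> d; have := is_derive_sum d.
by rewrite (_ : \sum_(i < n) F i = (fun y => \sum_(i < n) F i y))// funeqE => y; rewrite fct_sumE.
Qed.

Lemma derv_comp f (g : R -> R) x v (df dg : R) : is_derive (f x) 1 g dg ->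
  is_derive x v f df -> is_derive x v (fun y => g (f y)) (dg * df).
Proof.
move=> dg' /is_derive_lineP df'; apply/is_derive_lineP.
have dg2 : is_derive (f (0 *: v + x)) 1 g dg by rewrite scale0r add0r.
exact: (@is_derive1_comp _ g (fun h => f (h *: v + x)) 0 _ _ dg2 df').
Qed.

Lemma derv_powR f x v (p df : R) : 0 < f x -> is_derive x v f df ->
  is_derive x v (fun y => f y `^ p) (p * f x `^ (p - 1) * df).
Proof.
by move=> fx0; exact: (@derv_comp f (fun y => y `^ p) _ _ _ _ (is_derive1_powR p fx0)).
Qed.

Lemma derv_eq f g x v (df dg : R) : is_derive x v f df ->
  (forall y, f y = g y) -> df = dg -> is_derive x v g dg.
Proof. by move=> d /funext <- <-. Qed.

Lemma derv_val f x v (df : R) : is_derive x v f df -> 'D_v f x = df.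
Proof. by case. Qed.

End derive_rules.

Section calculus1.
Variable R : realType.
Notation I1 := (@I1 R).

Lemma antiderivative (f : R -> R) (a : R) : continuous f ->
  exists F : R -> R, forall x : R, a < x -> is_derive x 1 F (f x).
Proof.
move=> cf; pose F x := \int[lebesgue_measure]_(t in `[a, x]) f t.
exists F => x ax.
have [||//|//|dF F'] := @continuous_FTC1_closed _ f a x (x + 1); last first.
- by rewrite derive1E in F'; exact: (DeriveDef dF F').
- exact: cf.
- apply: continuous_compact_integrable; first exact: segment_compact.
  exact: continuous_subspaceT.
- by rewrite ltrDl.
Qed.

Lemma I1_FTC (F f : R -> R) : continuous f ->
  (forall x : R, 0 <= x <= 1 -> is_derive x 1 F (f x)) -> I1 f = F 1 - F 0.
Proof.
move=> cf dF.
have mf := @continuous_measurable_fun R f cf.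
rewrite /I1 /Rintegral (@integral_restr _ _ R (unit_leb R) (@lebesgue_measure R) _
  (@measurable_unit_itv R) (fun A _ => @unit_lebE R A)); last exact/measurable_EFinP.
rewrite (@continuous_FTC2 _ f F 0 1)//; first exact: continuous_subspaceT.
  have cF x : 0 <= x <= 1 -> {for x, continuous F}.
    by move=> x01; apply/differentiable_continuous/derivable1_diffP; case: (dF x x01).
  split.
  - move=> x; rewrite in_itv/= => /andP[? ?].
    have x01 : 0 <= x <= 1 by lra.
    by case: (dF x x01).
  - by apply: cvg_at_right_filter; apply: cF; lra.
  - by apply: cvg_at_left_filter; apply: cF; lra.
move=> x; rewrite in_itv/= => /andP[? ?]; rewrite derive1E.
have x01 : 0 <= x <= 1 by lra.
by case: (dF x x01).
Qed.

Lemma MVT_le (f f' : R -> R) (a b M : R) : a <= b ->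
  (forall x : R, a <= x <= b -> is_derive x 1 f (f' x)) ->
  (forall x, a <= x <= b -> f' x <= M) -> f b - f a <= M * (b - a).
Proof.
move=> ab df fM.
have [||c] := @MVT_segment _ f f' a b ab.
- by move=> x; rewrite in_itv/= => ?; apply: df; lra.
- move=> x; rewrite /= => xab; apply: derivable_within_continuous => y.
  by rewrite in_itv /= => ?; have [] := df y.
- rewrite in_itv/= => cab ->; apply: ler_wpM2r; [lra|exact: fM].
Qed.

Lemma derive_ge0_le (f f' : R -> R) (a b : R) : a <= b ->
  (forall x : R, a <= x <= b -> is_derive x 1 f (f' x)) ->
  (forall x, a <= x <= b -> 0 <= f' x) -> f a <= f b.
Proof.
move=> ab df f0; have := @MVT_le (fun x => - f x) (fun x => - f' x) a b 0 ab.
rewrite mul0r opprK addrC subr_le0; apply=> x xab; last by rewrite oppr_le0 f0.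
by apply: is_deriveN; exact: df.
Qed.

(** With an antiderivative [F], the function [F (1 + k) - F k] has derivative zero by periodicity.
    [F] is differentiable only to the right of its base point, which is therefore put to the left of
    [- |h|]. *)
Lemma I1_shift (f : R -> R) (h : R) : continuous f -> (forall x, f (x + 1) = f x) ->
  I1 (fun x => f (x + h)) = I1 f.
Proof.
move=> cf pf; have [F dF] := @antiderivative f (- `|h| - 1) cf.
have h1 : - `|h| <= h <= `|h| by rewrite lerNl ler_norm -normrN ler_norm.
have h0 := normr_ge0 h.
have shift k x : - `|h| - 1 < x + k -> is_derive x 1 (fun y => F (y + k)) (f (x + k)).
  move=> xk; have := dF _ xk => d.
  rewrite -[f (x + k)]mulr1.
  have d1 : is_derive x (1:R) (fun y : R => y + k) 1.
    by rewrite -[X in is_derive _ _ _ X]addr0; apply: is_deriveD.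
  exact: (@derv_comp R R (fun y => y + k) F x 1 _ _ d d1).
have -> : I1 (fun x => f (x + h)) = F (1 + h) - F (0 + h).
  apply: (@I1_FTC (fun x => F (x + h)) (fun x => f (x + h))).
    apply: (@cont_comp _ _ _ (fun x => x + h) f) => //.
    by apply: contD; [exact: cont_id|exact: cont_cst].
  by move=> x x01; apply: shift; lra.
have -> : I1 f = F 1 - F 0 by apply: I1_FTC => // x ?; apply: dF; lra.
pose D k := F (1 + k) - F k.
have dD k : - `|h| <= k -> is_derive k 1 D 0.
  move=> hk; rewrite -[0](subrr (f k)).
  apply: is_deriveB; last by apply: dF; lra.
  by rewrite -pf; under eq_fun do rewrite addrC; apply: shift; lra.
have E a b : - `|h| <= a -> a <= b -> D b = D a.
  move=> ha hb; have dD' x : a <= x <= b -> is_derive x 1 D 0 by move=> ?; apply: dD; lra.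
  apply/eqP; rewrite eq_le -subr_le0 -[leRHS](mul0r (b - a)).
  by rewrite (@MVT_le D (fun=> 0))//= (@derive_ge0_le D (fun=> 0)).
rewrite add0r -[LHS]/(D h) -[F 1 - F 0]/(F 1 - F 0).
have <- : D 0 = F 1 - F 0 by rewrite /D addr0.
by rewrite (E (- `|h|)) 1?[RHS](E (- `|h|))//; lra.
Qed.

(* Some value is at most the mean, and the oscillation is at most the total variation. *)
Lemma le_I1_variation (f f' : R -> R) (x : R) : continuous f' ->
  (forall x : R, is_derive x 1 f (f' x)) -> 0 <= x <= 1 ->
  f x <= I1 (fun s => f s + `|f' s|).
Proof.
move=> cf' df x01.
have cf : continuous f.
  by move=> y; apply/differentiable_continuous/derivable1_diffP; case: (df y).
have ca := cont_norm cf'.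
rewrite (meanD (I1_mean R))//.
have [y y01 fy] : exists2 y, 0 <= y <= 1 & f y <= I1 f.
  have [|c c01 cmin] := @EVT_min R f 0 1 ler01; first exact: continuous_subspaceT.
  exists c; first by move: c01; rewrite in_itv.
  rewrite -[leLHS](mean_cst (I1_mean R)); apply: (le_mean (I1_mean R)) => //.
    exact: cont_cst.
have [G dG] := @antiderivative (fun s => `|f' s|) (-1) ca.
have -> : I1 (fun s => `|f' s|) = G 1 - G 0.
  by apply: I1_FTC => // z ?; apply: dG; lra.
(* [G] is the variation of [f]: both [G + f] and [G - f] are nondecreasing, so increments of [f] are
   bounded by those of [G]. *)
have mono (e : R) a b : `|e| = 1 -> -1 < a -> a <= b -> G a + e * f a <= G b + e * f b.
  move=> e1 a1 ab.
  apply: (@derive_ge0_le (fun z => G z + e * f z) (fun z => `|f' z| + e * f' z)) => //.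
    move=> z zab; have dGz : is_derive z 1 G `|f' z| by apply: dG; lra.
    exact: dervD dGz (@dervZ R R f z 1 e _ (df z)).
  move=> z _; have E : `|e * f' z| = `|f' z| by rewrite normrM e1 mul1r.
  by have := ler_norm (- (e * f' z)); rewrite normrN E; lra.
have osc a b : -1 < a -> a <= b -> G a + f a <= G b + f b /\ G a - f a <= G b - f b.
  move=> a1 ab; have := mono 1 a b (normr1 _) a1 ab.
  by have := mono (-1) a b (normrN1 _) a1 ab; rewrite !mulN1r !mul1r.
have [xy|/ltW yx] := leP x y.
  have [||? ?] := osc x y; [lra|lra|].
  have [||? ?] := osc 0 x; [lra|lra|].
  by have [||? ?] := osc y 1; lra.
have [||? ?] := osc y x; [lra|lra|].
have [||? ?] := osc 0 y; [lra|lra|].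
by have [||? ?] := osc x 1; lra.
Qed.

End calculus1.

(** * Hoelder inequalities and integration by parts on the torus *)

Section mean_cauchy_schwarz.
Variables (R : realType) (T : topologicalType) (K : set T) (J : (T -> R) -> R).
Hypothesis mJ : is_mean K J.

Lemma mean_CS2 (f g : T -> R) : continuous f -> continuous g ->
  J (fun x => f x * g x) ^+ 2 <= J (fun x => f x ^+ 2) * J (fun x => g x ^+ 2).
Proof.
move=> cf cg; set a := J (fun x => f x ^+ 2); set b := J (fun x => g x ^+ 2).
set c := J _.
have quad t : 0 <= a - 2 * t * c + t ^+ 2 * b.
  have -> : a - 2 * t * c + t ^+ 2 * b = J (fun x => (f x - t * g x) ^+ 2).
    rewrite /a /b /c -!(meanZ mJ); [|exact: contX|exact: contM].
    rewrite -(meanB mJ); [|exact: contX|by apply: contM; [exact: cont_cst|exact: contM]].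
    rewrite -(meanD mJ); last 2 first.
    - by apply: contB; [exact: contX|apply: contM; [exact: cont_cst|exact: contM]].
    - by apply: contM; [exact: cont_cst|exact: contX].
    by congr J; apply/funext => x; ring.
  apply: (mean_ge0 mJ) => [|x _]; last exact: sqr_ge0.
  by apply: contX; apply: contB => //; apply: contM => //; exact: cont_cst.
have a0 : 0 <= a by apply: (mean_ge0 mJ) => [|x _]; [exact: contX|exact: sqr_ge0].
have b0 : 0 <= b by apply: (mean_ge0 mJ) => [|x _]; [exact: contX|exact: sqr_ge0].
move: b0; rewrite le_eqVlt => /predU1P[b0|b0].
  rewrite -b0 mulr0; have [->|c0] := eqVneq c 0; first by rewrite expr0n.
  (* For [b = 0] the quadratic is affine in [t]; at this [t] it equals - a - 2, which is
     negative. *)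
  have := quad ((a + 1) / c); rewrite -b0 mulr0 addr0.
  have -> : 2 * ((a + 1) / c) * c = 2 * (a + 1) by field.
  lra.
have := quad (c / b).
have -> : a - 2 * (c / b) * c + (c / b) ^+ 2 * b = (a * b - c ^+ 2) / b.
  by field; rewrite gt_eqF.
by rewrite pmulr_lge0 ?invr_gt0// subr_ge0.
Qed.

Lemma mean_CS (f g : T -> R) : continuous f -> continuous g ->
  J (fun x => f x * g x) <=
  Num.sqrt (J (fun x => f x ^+ 2)) * Num.sqrt (J (fun x => g x ^+ 2)).
Proof.
move=> cf cg; rewrite -sqrtrM; last first.
  by apply: (mean_ge0 mJ) => [|x _]; [exact: contX|exact: sqr_ge0].
apply: (le_trans (ler_norm _)); rewrite -sqrtr_sqr ler_sqrt ?mean_CS2//.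
by apply: mulr_ge0; apply: (mean_ge0 mJ) => [|x _]; try exact: contX; exact: sqr_ge0.
Qed.

(* Weighted AM-GM applied to [f / A] and [g / B]. *)
Lemma mean_hoelder (f g : T -> R) (A B p : R) : continuous f -> continuous g ->
  continuous (fun x => f x `^ p * g x `^ (1 - p)) ->
  (forall x, 0 <= f x) -> (forall x, 0 <= g x) -> 0 < p < 1 ->
  0 < A -> 0 < B -> J f <= A -> J g <= B ->
  J (fun x => f x `^ p * g x `^ (1 - p)) <= A `^ p * B `^ (1 - p).
Proof.
move=> cf cg cfg f0 g0 /andP[p0 p1] A0 B0 fA gB.
set Q := A `^ p * B `^ (1 - p).
have Q0 : 0 < Q by rewrite mulr_gt0 ?powR_gt0.
have key x : f x `^ p * g x `^ (1 - p) <=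
    Q * p / A * f x + Q * (1 - p) / B * g x.
  have q0 : 0 < 1 - p by rewrite subr_gt0.
  have := @conjugate_powR R ((f x / A) `^ p) ((g x / B) `^ (1 - p)) p^-1 (1 - p)^-1.
  rewrite !powR_ge0 !invrK !invr_gt0 p0 q0 -!powRrM !mulfV ?gt_eqF//.
  rewrite !powRr1; try by rewrite divr_ge0// ltW.
  move=> /(_ isT isT isT isT).
  have -> : p + (1 - p) = 1 by ring.
  move=> /(_ erefl); rewrite !powRM ?invr_ge0 ?(ltW A0) ?(ltW B0)//.
  move=> H; have := ler_wpM2l (ltW Q0) H.
  have E (y z : R) : 0 < y -> y `^ z * y^-1 `^ z = 1.
    by move=> y0; rewrite -powRM ?invr_ge0 ?(ltW y0)// mulfV ?gt_eqF// powR1.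
  have -> : Q * (f x `^ p * A^-1 `^ p * (g x `^ (1 - p) * B^-1 `^ (1 - p))) =
     f x `^ p * g x `^ (1 - p) * (A `^ p * A^-1 `^ p) * (B `^ (1 - p) * B^-1 `^ (1 - p)).
    by rewrite /Q; ring.
  by rewrite !E// !mulr1 => /le_trans; apply; rewrite le_eqVlt; apply/orP; left; apply/eqP; ring.
apply: (@le_trans _ _ (J (fun x => Q * p / A * f x + Q * (1 - p) / B * g x))).
  apply: (le_mean mJ) => //.
  by apply: contD; apply: contM => //; exact: cont_cst.
rewrite (meanD mJ); try by apply: contM => //; exact: cont_cst.
rewrite !(meanZ mJ)//.
rewrite [leRHS](_ : Q = Q * p / A * A + Q * (1 - p) / B * B); last first.
  by field; rewrite !gt_eqF.
have q0 : 0 <= 1 - p by rewrite subr_ge0 ltW.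
apply: lerD; apply: ler_wpM2l => //; apply: divr_ge0; rewrite ?(ltW A0) ?(ltW B0)//.
  by apply: mulr_ge0; exact: ltW.
by apply: mulr_ge0 => //; exact: ltW.
Qed.

End mean_cauchy_schwarz.

(** * Periodic C^1 functions: integration by parts and translations *)

Section torus_calculus.
Variable R : realType.
Notation V := (R * R * R)%type.
Notation I1 := (@I1 R).
Notation I3 := (@I3 R).
Implicit Types f g a b : V -> R.

Definition C1p f : Prop := [/\ periodic3 f, continuous f,
  forall x i, derivable f x (e_ R i) & forall i, continuous (partial i f)].

Lemma is_derive_partial f x i : derivable f x (e_ R i) ->
  is_derive x (e_ R i) f (partial i f x).
Proof. exact: derivableP. Qed.

Lemma partialE f x i (df : R) : is_derive x (e_ R i) f df -> partial i f x = df.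
Proof. exact: derv_val. Qed.

Lemma shiftE i h (x : V) : h *: e_ R i + x =
  (h * (i == 0%N :> nat)%:R + x.1.1, h * (i == 1%N :> nat)%:R + x.1.2,
   h * (i == 2%N :> nat)%:R + x.2).
Proof. by case: x => [[x y] z]. Qed.

Lemma upd_shift i h s (x : V) : upd i x (h + s) = h *: e_ R i + upd i x s.
Proof.
rewrite shiftE /upd; case: i => [[|[|[|i]]] ?] //=;
  by rewrite ?mulr0 ?mulr1 ?add0r.
Qed.

Lemma upd_shift2 i h s (x : V) : h *: e_ R i + upd i x s = upd i x (s + h).
Proof. by rewrite -upd_shift addrC. Qed.

Definition tsl (i : 'I_3) (h : R) (x : V) : V := h *: e_ R i + x.

Lemma cont_shift i : continuous (fun p : V * R => tsl i p.2 p.1).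
Proof.
rewrite (_ : (fun p => _) = fun p : V * R =>
  (p.2 * (i == 0%N :> nat)%:R + p.1.1.1, p.2 * (i == 1%N :> nat)%:R + p.1.1.2,
   p.2 * (i == 2%N :> nat)%:R + p.1.2)); last first.
  by apply/funext => p; rewrite /tsl shiftE.
have H (c : R) (pr : V * R -> R) : continuous pr -> continuous (fun p : V * R => p.2 * c + pr p).
  move=> cp; apply: contD => //; apply: contM; [exact: cont_snd|exact: cont_cst].
by apply: cont_pair; [apply: cont_pair|]; apply: H; cont_tac.
Qed.

Lemma cont_shift1 i h : continuous (tsl i h).
Proof. exact: (@cont_secl _ _ _ (fun p : V * R => tsl i p.2 p.1) h (@cont_shift i)). Qed.

Lemma is_derive_upd f i x (s : R) : (forall x, derivable f x (e_ R i)) ->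
  is_derive s 1 (fun r => f (upd i x r)) (partial i f (upd i x s)).
Proof.
move=> df; apply/is_derive_lineP.
have /is_derive_lineP := is_derive_partial (df (upd i x s)).
rewrite (_ : (fun h => f (h *: e_ R i + _)) = (fun h => f (upd i x (h *: (1 : R) + s))))//.
by apply/funext => h; rewrite -upd_shift [h *: 1]mulr1.
Qed.

Lemma derivable_shift f i k h x : derivable f (tsl k h x) (e_ R i) ->
  is_derive x (e_ R i) (fun y => f (tsl k h y)) (partial i f (tsl k h x)).
Proof.
move=> /is_derive_partial /is_derive_lineP d; apply/is_derive_lineP.
by rewrite /tsl; under eq_fun do rewrite addrCA.
Qed.

Lemma cont_I1_upd g i : continuous g -> continuous (fun x => I1 (fun s => g (upd i x s))).
Proof.
move=> cg; apply: cont_I1 => /=.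
exact: (@cont_comp _ _ _ (fun p : V * R => upd i p.1 p.2) g (@cont_upd _ i) cg).
Qed.

Lemma I3_partial f i : C1p f -> I3 (partial i f) = 0.
Proof.
move=> [pf cf df cdf]; rewrite -(I3_upd i)//.
rewrite (_ : (fun x => _) = fun=> 0); first exact: (mean_cst (I3_mean R)).
apply/funext => x; transitivity (f (upd i x 1) - f (upd i x 0)).
  apply: (@I1_FTC _ (fun s => f (upd i x s))).
    apply: (@cont_comp _ _ _ (fun s => upd i x s) (partial i f)) => //.
    exact: (@cont_secr _ _ _ (fun p : V * R => upd i p.1 p.2) x (@cont_upd _ i)).
  by move=> s _; exact: is_derive_upd.
by rewrite -[in upd i x 1](addr0 1) upd_shift scale1r [e_ R i + _]addrC pf subrr.
Qed.

Lemma I3_shift f i h : periodic3 f -> continuous f ->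
  I3 (fun x => f (tsl i h x)) = I3 f.
Proof.
move=> pf cf; have cs : continuous (fun x => f (tsl i h x)).
  by apply: (@cont_comp _ _ _ _ f (@cont_shift1 i h)).
rewrite -(I3_upd i cf) -(I3_upd i cs); congr I3; apply/funext => x.
rewrite /tsl; under [in LHS]eq_fun do rewrite upd_shift2.
apply: (@I1_shift _ (fun s => f (upd i x s))).
  apply: (@cont_comp _ _ _ (fun s => upd i x s) f) => //.
  exact: (@cont_secr _ _ _ (fun p : V * R => upd i p.1 p.2) x (@cont_upd _ i)).
by move=> s; rewrite addrC upd_shift scale1r [e_ R i + _]addrC pf.
Qed.

Lemma C1pD f g : C1p f -> C1p g -> C1p (fun x => f x + g x).
Proof.
move=> [pf cf df cdf] [pg cg dg cdg]; have H x i := dervD (is_derive_partial (df x i)) (is_derive_partial (dg x i)).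
split.
- by move=> x i; rewrite pf pg.
- exact: contD.
- by move=> x i; have [] := H x i.
- move=> i; rewrite (_ : partial _ _ = fun x => partial i f x + partial i g x).
    exact: contD.
  by apply/funext => x; rewrite (partialE (H x i)).
Qed.

Lemma C1pM f g : C1p f -> C1p g -> C1p (fun x => f x * g x).
Proof.
move=> [pf cf df cdf] [pg cg dg cdg]; have H x i := dervM (is_derive_partial (df x i)) (is_derive_partial (dg x i)).
split.
- by move=> x i; rewrite pf pg.
- exact: contM.
- by move=> x i; have [] := H x i.
- move=> i; rewrite (_ : partial _ _ = fun x => partial i f x * g x + f x * partial i g x).
    by apply: contD; exact: contM.
  by apply/funext => x; rewrite (partialE (H x i)).
Qed.

Lemma C1p_cst (c : R) : C1p (fun=> c).
Proof.
have H x i := derv_cst x (e_ R i) c.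
split=> //.
- exact: cont_cst.
- move=> i; rewrite (_ : partial _ _ = fun x => 0); first exact: cont_cst.
  by apply/funext => x; rewrite (partialE (H x i)).
Qed.

Lemma C1pB f g : C1p f -> C1p g -> C1p (fun x => f x - g x).
Proof.
move=> Cf Cg; rewrite (_ : (fun x => _) = fun x => f x + (-1) * g x).
  exact (C1pD Cf (C1pM (C1p_cst (-1)) Cg)).
by apply/funext => x; rewrite mulN1r.
Qed.

Lemma C1p_sum n (F : 'I_n -> V -> R) : (forall i, C1p (F i)) ->
  C1p (fun x => \sum_(i < n) F i x).
Proof.
elim: n F => [|n IH] F H.
  by under eq_fun do rewrite big_ord0; exact: C1p_cst.
under eq_fun do rewrite big_ord_recl; apply: C1pD => //.
exact: (IH (fun i => F (lift ord0 i))).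
Qed.

Lemma C1p_powR f p : C1p f -> (forall x, 0 < f x) -> C1p (fun x => f x `^ p).
Proof.
move=> [pf cf df cdf] f0; have H x i := derv_powR p (f0 x) (is_derive_partial (df x i)).
split.
- by move=> x i; rewrite pf.
- exact: cont_powR.
- by move=> x i; have [] := H x i.
- move=> i; rewrite (_ : partial _ _ = fun x => p * f x `^ (p - 1) * partial i f x).
    by apply: contM => //; apply: contM; [exact: cont_cst|exact: cont_powR].
  by apply/funext => x; rewrite (partialE (H x i)).
Qed.

Lemma partialM f g i x : C1p f -> C1p g ->
  partial i (fun x => f x * g x) x = partial i f x * g x + f x * partial i g x.
Proof.
by move=> [_ _ df _] [_ _ dg _]; rewrite (partialE (dervM (is_derive_partial (df x i)) (is_derive_partial (dg x i)))).
Qed.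

Lemma I3_parts f g i : C1p f -> C1p g ->
  I3 (fun x => f x * partial i g x) = - I3 (fun x => partial i f x * g x).
Proof.
move=> Cf Cg; have := I3_partial i (C1pM Cf Cg).
have [_ cf _ cdf] := Cf; have [_ cg _ cdg] := Cg.
rewrite (_ : partial i _ = fun x => partial i f x * g x + f x * partial i g x); last first.
  by apply/funext => x; exact: partialM.
rewrite (meanD (I3_mean R)); [|exact: contM|exact: contM].
by move/eqP; rewrite addrC addr_eq0 => /eqP.
Qed.

Lemma C1p_shift f k h : C1p f -> C1p (fun x => f (tsl k h x)) /\
  forall i, partial i (fun x => f (tsl k h x)) = fun x => partial i f (tsl k h x).
Proof.
move=> [pf cf df cdf].
have E i : partial i (fun x => f (tsl k h x)) = fun x => partial i f (tsl k h x).
  by apply/funext => x; rewrite (partialE (derivable_shift (df _ i))).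
split=> //; split.
- by move=> x i; rewrite /tsl addrA pf.
- exact: (@cont_comp _ _ _ _ f (@cont_shift1 k h)).
- by move=> x i; have [] := derivable_shift (df (tsl k h x) i).
- by move=> i; rewrite E; exact: (@cont_comp _ _ _ _ _ (@cont_shift1 k h)).
Qed.

Lemma periodic_partial f k : periodic3 f -> periodic3 (partial k f).
Proof.
move=> pf x j; rewrite /partial /derive.
rewrite (_ : (fun h => _) = (fun h => h^-1 *: ((f \o shift x) (h *: e_ R k) - f x)))//.
by apply/funext => h /=; rewrite addrA !pf.
Qed.

(** Two integrations by parts would need second derivatives of [a] or [b]. Instead the derivative in
    direction [i] is a difference quotient: [A s] pairs the increment of [b] with [partial k a],
    [B s] the opposite increment of [a] with [partial k b]. Integration by parts in direction [k]
    and translation invariance give [A s = - B s], and this is differentiated at 0. *)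
Lemma I3_partial_swap a b i k : C1p a -> C1p b ->
  I3 (fun x => partial k a x * partial i b x) =
  I3 (fun x => partial i a x * partial k b x).
Proof.
move=> Ca Cb; have [pa ca da cda] := Ca; have [pb cb db cdb] := Cb.
pose A s := I3 (fun x => (b (tsl i s x) - b (tsl i 0 x)) * partial k a x).
pose B s := I3 (fun x => (a (tsl i (- s) x) - a (tsl i (- 0) x)) * partial k b x).
have tsl0 x : tsl i 0 x = x by rewrite /tsl scale0r add0r.
have ct f j s : continuous f -> continuous (fun x => f (tsl j s x)).
  by move=> cf; apply: (@cont_comp _ _ _ _ f (@cont_shift1 j s)).
have AB s : A s = - B s.
  have [Cbs Eb] := C1p_shift i s Cb; have [Cas Ea] := C1p_shift i (- s) Ca.
  have -> : A s = I3 (fun x => partial k a x * b (tsl i s x)) - I3 (fun x => partial k a x * b x).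
    rewrite -(meanB (I3_mean R)); [|by apply: contM => //; exact: ct|exact: contM].
    by congr I3; apply/funext => x; rewrite tsl0; ring.
  have -> : B s = I3 (fun x => a (tsl i (- s) x) * partial k b x) - I3 (fun x => a x * partial k b x).
    rewrite -(meanB (I3_mean R)); [|by apply: contM => //; exact: ct|exact: contM].
    by congr I3; apply/funext => x; rewrite oppr0 tsl0; ring.
  have -> : I3 (fun x => a (tsl i (- s) x) * partial k b x) =
            I3 (fun x => a x * partial k b (tsl i s x)).
    rewrite -[RHS](I3_shift i (- s)).
    - congr I3; apply/funext => x; congr (_ * partial k b _).
      by rewrite /tsl addrA -scalerDl addrN scale0r add0r.
    - by move=> x j; rewrite pa /tsl addrA periodic_partial.
    - by apply: contM => //; exact: ct.
  have E1 := I3_parts k Ca Cbs; rewrite (Eb k) in E1.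
  by rewrite E1 (I3_parts k Ca Cb); ring.
have cts (f : V -> R) (e : R) : continuous f -> continuous (fun p : V * R => f (tsl i (e * p.2) p.1)).
  move=> cf; apply: (@cont_comp _ _ _ (fun p : V * R => tsl i (e * p.2) p.1) f) => //.
  apply: (@cont_comp _ _ _ (fun p : V * R => (p.1, e * p.2)) (fun p : V * R => tsl i p.2 p.1)).
    by apply: cont_pair; [exact: cont_fst|apply: contM; [exact: cont_cst|exact: cont_snd]].
  exact: cont_shift.
have dts (f : V -> R) (e : R) (x : V) (s : R) : (forall x, derivable f x (e_ R i)) ->
    is_derive s 1 (fun r : R => f (tsl i (e * r) x)) (e * partial i f (tsl i (e * s) x)).
  move=> df; rewrite mulrC.
  have H : is_derive (e * s) 1 (fun r : R => f (tsl i r x)) (partial i f (tsl i (e * s) x)).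
    apply/is_derive_lineP.
    have /is_derive_lineP := is_derive_partial (df (tsl i (e * s) x)).
    rewrite (_ : (fun h => f (h *: e_ R i + _)) = (fun h => f (tsl i (h *: (1 : R) + e * s) x)))//.
    by apply/funext => h; rewrite /tsl addrA -scalerDl [h *: 1]mulr1.
  have H2 : is_derive s 1 (fun r : R => e * r) e.
    by rewrite -[X in is_derive _ _ _ X]mulr1; apply: dervZ; exact: is_derive_id.
  exact: (@derv_comp R R (fun r => e * r) (fun r => f (tsl i r x)) s 1 _ _ H H2).
have cfst (f : V -> R) : continuous f -> continuous (fun p : V * R => f p.1).
  by move=> cf; apply: (@cont_comp _ _ _ _ f (@cont_fst _ _)).
have m11 : ((-1 : R) < 0 :> R) && (0 < 1 :> R) by rewrite ltrN10 ltr01.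
have dI (f g : V -> R) (e : R) : C1p f -> continuous g -> is_derive (0 : R) 1
    (fun s => I3 (fun x => (f (tsl i (e * s) x) - f (tsl i (e * 0) x)) * g x))
    (I3 (fun x => e * partial i f x * g x)).
  move=> [_ cf df cdf] cg.
  have := @is_derive_mean _ _ _ _ (I3_mean R) (fun p => f (tsl i (e * p.2) p.1))
    (fun p => e * partial i f (tsl i (e * p.2) p.1)) (fun p => g p.1) (-1) 1 0
    (cts _ _ cf) (contM (@cont_cst _ _ e) (cts _ _ (cdf i))) (cfst _ cg) m11.
  move=> /(_ (fun x s _ => dts f e x s (fun x => df x i))) H.
  apply: (@derv_eq _ _ _ _ _ _ _ _ H); first by move=> s; reflexivity.
  by congr I3; apply/funext => x; rewrite mulr0 tsl0.
have dA : is_derive (0 : R) 1 A (I3 (fun x => partial k a x * partial i b x)).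
  apply: (derv_eq (dI b (partial k a) 1 Cb (cda k))) => [s|].
    by rewrite /A mulr0 mul1r.
  by congr I3; apply/funext => x; rewrite mul1r mulrC.
have dB : is_derive (0 : R) 1 B (- I3 (fun x => partial i a x * partial k b x)).
  rewrite -(meanN (I3_mean R)); last exact: contM.
  apply: (derv_eq (dI a (partial k b) (-1) Ca (cdb k))) => [s|].
    by rewrite /B oppr0 mulr0 mulN1r.
  by congr I3; apply/funext => x; ring.
have := derv_val dA; rewrite (_ : A = fun s => - B s); last by apply/funext.
by rewrite (derv_val (dervN dB)) opprK => <-.
Qed.

End torus_calculus.

(** * The Gagliardo inequality *)

Local Opaque I1 I3.

Section gagliardo.
Variable R : realType.
Notation V := (R * R * R)%type.
Notation I1 := (@I1 R).
Notation I3 := (@I3 R).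

Lemma cont_sqrt (T : topologicalType) (f : T -> R) : continuous f ->
  continuous (fun x => Num.sqrt (f x)).
Proof. by move=> cf; apply: (@cont_comp _ _ _ f (@Num.sqrt R)) => //; exact: sqrt_continuous. Qed.

Lemma I1_CS_sqrt (f g : R -> R) : continuous f -> continuous g ->
  (forall x, 0 <= f x) -> (forall x, 0 <= g x) ->
  I1 (fun x => Num.sqrt (f x) * Num.sqrt (g x)) <= Num.sqrt (I1 f) * Num.sqrt (I1 g).
Proof.
move=> cf cg f0 g0.
apply: (le_trans (mean_CS (I1_mean R) (cont_sqrt cf) (cont_sqrt cg))).
by rewrite le_eqVlt; apply/orP; left; apply/eqP; congr (Num.sqrt _ * Num.sqrt _);
  congr I1; apply/funext => x; rewrite sqr_sqrtr.
Qed.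

(* Three successive uses of the Cauchy-Schwarz inequality. *)
Lemma loomis_whitney (g : V -> R) (A B C : R * R -> R) :
  continuous g -> continuous A -> continuous B -> continuous C ->
  (forall p, 0 <= A p) -> (forall p, 0 <= B p) -> (forall p, 0 <= C p) ->
  (forall x y z, 0 <= x <= 1 -> 0 <= y <= 1 -> 0 <= z <= 1 ->
    g (x, y, z) <= Num.sqrt (C (x, y)) * (Num.sqrt (B (x, z)) * Num.sqrt (A (y, z)))) ->
  I3 g <= Num.sqrt (I1 (fun y => I1 (fun z => A (y, z)))) *
    (Num.sqrt (I1 (fun x => I1 (fun y => C (x, y)))) *
     Num.sqrt (I1 (fun x => I1 (fun z => B (x, z))))).
Proof.
move=> cg cA cB cC A0 B0 C0 gABC; rewrite I3_xyz//.
pose a y := I1 (fun z => A (y, z)); pose b x := I1 (fun z => B (x, z)).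
pose c x := I1 (fun y => C (x, y)).
have slice (h : R * R -> R) x : continuous h -> continuous (fun y => h (x, y)).
  exact: cont_secr.
have I1_ge0 (h : R * R -> R) x : continuous h -> (forall p, 0 <= h p) ->
    0 <= I1 (fun y => h (x, y)).
  by move=> ch h0; apply: (mean_ge0 (I1_mean R)) => //; exact: slice.
have ca : continuous a by apply: cont_I1 => /=; cont_tac.
have cb : continuous b by apply: cont_I1 => /=; cont_tac.
have cc : continuous c by apply: cont_I1 => /=; cont_tac.
have cgz : continuous (fun p : R * R => I1 (fun z => g (p.1, p.2, z))).
  by apply: cont_I1 => /=; cont_tac.
have le1 x y : 0 <= x <= 1 -> 0 <= y <= 1 -> I1 (fun z => g (x, y, z)) <=
    Num.sqrt (b x) * (Num.sqrt (C (x, y)) * Num.sqrt (a y)).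
  move=> x01 y01.
  have c1 : continuous (fun z => Num.sqrt (B (x, z)) * Num.sqrt (A (y, z))).
    by apply: contM; apply: cont_sqrt; exact: slice.
  apply: (@le_trans _ _ (I1 (fun z => Num.sqrt (C (x, y)) *
      (Num.sqrt (B (x, z)) * Num.sqrt (A (y, z)))))).
    apply: (le_mean (I1_mean R)).
    - by cont_tac.
    - by apply: contM => //; exact: cont_cst.
    - by move=> z /=; rewrite in_itv/=; exact: gABC.
  rewrite (meanZ (I1_mean R))// mulrCA ler_wpM2l ?sqrtr_ge0//.
  by apply: I1_CS_sqrt => //; exact: slice.
have le2 x : 0 <= x <= 1 -> I1 (fun y => I1 (fun z => g (x, y, z))) <=
    Num.sqrt (I1 a) * (Num.sqrt (c x) * Num.sqrt (b x)).
  move=> x01.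
  have c1 : continuous (fun y => Num.sqrt (C (x, y)) * Num.sqrt (a y)).
    by apply: contM; apply: cont_sqrt => //; exact: slice.
  apply: (@le_trans _ _ (I1 (fun y => Num.sqrt (b x) *
      (Num.sqrt (C (x, y)) * Num.sqrt (a y))))).
    apply: (le_mean (I1_mean R)).
    - exact: (slice (fun p => I1 (fun z => g (p.1, p.2, z)))).
    - by apply: contM => //; exact: cont_cst.
    - by move=> y /=; rewrite in_itv/=; exact: le1.
  rewrite (meanZ (I1_mean R))// [leRHS]mulrA [leRHS]mulrC ler_wpM2l ?sqrtr_ge0//.
  rewrite [leRHS]mulrC; apply: I1_CS_sqrt => //; first exact: slice.
  by move=> y; exact: I1_ge0.
have c3 : continuous (fun x => Num.sqrt (c x) * Num.sqrt (b x)).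
  by apply: contM; exact: cont_sqrt.
apply: (@le_trans _ _ (I1 (fun x => Num.sqrt (I1 a) * (Num.sqrt (c x) * Num.sqrt (b x))))).
  apply: (le_mean (I1_mean R)).
  - by apply: cont_I1 => /=; exact: cgz.
  - by apply: contM => //; exact: cont_cst.
  - by move=> x /=; rewrite in_itv/=; exact: le2.
rewrite (meanZ (I1_mean R))// ler_wpM2l ?sqrtr_ge0//.
by apply: I1_CS_sqrt => // x; exact: I1_ge0.
Qed.

Let sqr_le_prod3 (W : 'I_3 -> R) (X : R) : 0 <= X -> (forall i, 0 <= W i) ->
  X <= Num.sqrt (W (@Ordinal 3 0 isT)) *
    (Num.sqrt (W (@Ordinal 3 2 isT)) * Num.sqrt (W (@Ordinal 3 1 isT))) ->
  X ^+ 2 <= \prod_(i < 3) W i.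
Proof.
move=> X0 W0 XW; rewrite !big_ord_recl big_ord0 mulr1.
have -> : ord0 = @Ordinal 3 0 isT by exact: val_inj.
have -> : lift (@Ordinal 3 0 isT) ord0 = @Ordinal 3 1 isT by exact: val_inj.
have -> : lift (@Ordinal 3 0 isT) (lift ord0 ord0) = @Ordinal 3 2 isT by exact: val_inj.
set w0 := W _; set w1 := W _; set w2 := W _.
have -> : w0 * (w1 * w2) = (Num.sqrt w0 * (Num.sqrt w2 * Num.sqrt w1)) ^+ 2.
  by rewrite !exprMn !sqr_sqrtr ?W0// [w2 * _]mulrC.
by rewrite ler_sqr ?nnegrE// !mulr_ge0 ?sqrtr_ge0.
Qed.

(** On each coordinate line, f^2 is at most the line integral [phi i] of [w i], by
    [le_I1_variation]. Hence f is bounded by the square root of each of three functions, each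
    independent of one coordinate, and f^3 by their product, to which [loomis_whitney] applies. *)
Lemma gagliardo_cube (f : V -> R) : C1p f -> (forall x, 0 <= f x) ->
  I3 (fun x => f x ^+ 3) ^+ 2 <=
  \prod_(i < 3) I3 (fun x => f x ^+ 2 + `|2 * f x * partial i f x|).
Proof.
move=> [pf cf df cdf] f0.
pose w i x := f x ^+ 2 + `|2 * f x * partial i f x|.
have cw i : continuous (w i).
  apply: contD; first exact: contX.
  by apply: cont_norm; apply: contM => //; apply: contM => //; exact: cont_cst.
have w0 i x : 0 <= w i x by rewrite addr_ge0 ?sqr_ge0.
pose phi i x := I1 (fun s => w i (upd i x s)).
have cphi i : continuous (phi i) by exact: cont_I1_upd.
have cupd i (x : V) : continuous (upd i x : R -> V).
  by have H := @cont_secr _ _ _ (fun p : V * R => upd i p.1 p.2) x (@cont_upd _ i); exact: H.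
have phi0 i x : 0 <= phi i x.
  apply: (mean_ge0 (I1_mean R)) => // .
  exact: (@cont_comp _ _ _ (upd i x) (w i)).
have fphi i x s : 0 <= s <= 1 -> f (upd i x s) <= Num.sqrt (phi i x).
  move=> s01; rewrite -[leLHS]ger0_norm// -sqrtr_sqr ler_sqrt//.
  have := @le_I1_variation R (fun s => f (upd i x s) ^+ 2)
    (fun s => 2 * f (upd i x s) * partial i f (upd i x s)) s; apply => //.
    apply: (@cont_comp _ _ _ (upd i x) (fun y => 2 * f y * partial i f y)) => //.
    by apply: contM => //; apply: contM => //; exact: cont_cst.
  by move=> r; have := dervX 2 (is_derive_upd x r (fun x => df x i)); rewrite expr1.
pose i0 : 'I_3 := @Ordinal 3 0 isT; pose i1 : 'I_3 := @Ordinal 3 1 isT.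
pose i2 : 'I_3 := @Ordinal 3 2 isT.
have lw := @loomis_whitney (fun x => f x ^+ 3) (fun p => phi i0 (0 : R, p.1, p.2))
  (fun p => phi i1 (p.1, 0 : R, p.2)) (fun p => phi i2 (p.1, p.2, 0 : R)) (@contX _ _ f 3 cf).
have c0 : continuous (fun p : R * R => phi i0 (0 : R, p.1, p.2)).
  by apply: (@cont_comp _ _ _ (fun p : R * R => (0 : R, p.1, p.2)) (phi i0)) => //; cont_tac.
have c1 : continuous (fun p : R * R => phi i1 (p.1, 0 : R, p.2)).
  by apply: (@cont_comp _ _ _ (fun p : R * R => (p.1, 0 : R, p.2)) (phi i1)) => //; cont_tac.
have c2 : continuous (fun p : R * R => phi i2 (p.1, p.2, 0 : R)).
  by apply: (@cont_comp _ _ _ (fun p : R * R => (p.1, p.2, 0 : R)) (phi i2)) => //; cont_tac.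
move: lw => /(_ c0 c1 c2 (fun _ => phi0 _ _) (fun _ => phi0 _ _) (fun _ => phi0 _ _)) lw.
have E0 : I1 (fun y => I1 (fun z => phi i0 (0, y, z))) = I3 (w i0).
  rewrite -(I3_upd i0 (cw i0)) (I3_xyz (cphi i0)).
  exact: (esym (@I1_cst R (I1 (fun y => I1 (fun z => phi i0 (0 : R, y, z)))))).
have E1 : I1 (fun x => I1 (fun z => phi i1 (x, 0, z))) = I3 (w i1).
  rewrite -(I3_upd i1 (cw i1)) (I3_xyz (cphi i1)); congr I1; apply/funext => x.
  exact: (esym (@I1_cst R (I1 (fun z => phi i1 (x, 0 : R, z))))).
have E2 : I1 (fun x => I1 (fun y => phi i2 (x, y, 0))) = I3 (w i2).
  rewrite -(I3_upd i2 (cw i2)) (I3_xyz (cphi i2)); congr I1; apply/funext => x.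
  by congr I1; apply/funext => y; exact: (esym (@I1_cst R (phi i2 (x, y, 0 : R)))).
have hyp x y z : 0 <= x <= 1 -> 0 <= y <= 1 -> 0 <= z <= 1 -> f (x, y, z) ^+ 3 <=
    Num.sqrt (phi i2 (x, y, 0 : R)) * (Num.sqrt (phi i1 (x, 0 : R, z)) *
      Num.sqrt (phi i0 (0 : R, y, z))).
  move=> x01 y01 z01; rewrite exprS expr2 ler_pM ?mulr_ge0//.
    exact: (fphi i2 (x, y, 0 : R) z z01).
  by apply: ler_pM => //; [exact: (fphi i1 (x, 0 : R, z) y)|exact: (fphi i0 (0 : R, y, z) x)].
have {}lw : I3 (fun x => f x ^+ 3) <=
    Num.sqrt (I3 (w i0)) * (Num.sqrt (I3 (w i2)) * Num.sqrt (I3 (w i1))).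
  apply: (le_trans (lw hyp)); rewrite le_eqVlt; apply/orP; left; apply/eqP.
  congr (Num.sqrt _ * (Num.sqrt _ * Num.sqrt _)); [exact: E0|exact: E2|exact: E1].
have Iw0 i : 0 <= I3 (w i) by apply: (mean_ge0 (I3_mean R)).
have If0 : 0 <= I3 (fun x => f x ^+ 3).
  by apply: (mean_ge0 (I3_mean R)) => [|x _]; [exact: contX|rewrite exprn_ge0].
exact: (@sqr_le_prod3 (fun i => I3 (w i))).
Qed.

End gagliardo.

(** * Mixed derivatives and the time variable *)

Section mixed_partials.
Variable R : realType.
Notation V := (R * R * R)%type.

Lemma is_derive_tsl (f : V -> R) i (x : V) (s : R) : (forall x, derivable f x (e_ R i)) ->
  is_derive s 1 (fun r : R => f (tsl i r x)) (partial i f (tsl i s x)).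
Proof.
move=> df; apply/is_derive_lineP.
have /is_derive_lineP := is_derive_partial (df (tsl i s x)).
rewrite (_ : (fun h => f (h *: e_ R i + _)) = (fun h => f (tsl i (h *: (1 : R) + s) x)))//.
by apply/funext => h; rewrite /tsl addrA -scalerDl [h *: 1]mulr1.
Qed.

Lemma tslC i k (a b : R) (x : V) : tsl i a (tsl k b x) = tsl k b (tsl i a x).
Proof. by rewrite /tsl addrCA. Qed.

Lemma tsl0 i (x : V) : tsl i 0 x = x.
Proof. by rewrite /tsl scale0r add0r. Qed.

Lemma MVT_eq (f f' : R -> R) (h : R) : 0 <= h ->
  (forall x : R, is_derive x 1 f (f' x)) ->
  exists2 c, 0 <= c <= h & f h - f 0 = f' c * h.
Proof.
move=> h0 df; have [|c] := @MVT_segment _ f f' 0 h h0.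
- move=> x; rewrite /= => xab; apply: derivable_within_continuous => y _.
  by have [] := df y.
- by rewrite in_itv/= subr0 => c0h ->; exists c.
Qed.

Lemma second_difference (f : V -> R) i k (x : V) (h : R) : 0 <= h ->
  (forall x, derivable f x (e_ R i)) ->
  (forall x, derivable (partial i f) x (e_ R k)) ->
  exists a b, [/\ 0 <= a <= h, 0 <= b <= h &
    f (tsl i h (tsl k h x)) - f (tsl i h x) - f (tsl k h x) + f x =
    partial k (partial i f) (tsl k b (tsl i a x)) * h * h].
Proof.
move=> h0 df ddf.
pose phi r := f (tsl i r (tsl k h x)) - f (tsl i r x).
have dphi (r : R) : is_derive r 1 phi
    (partial i f (tsl i r (tsl k h x)) - partial i f (tsl i r x)).
  by apply: dervB; exact: is_derive_tsl.
have [a a0h Ea] := MVT_eq h0 dphi.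
have [b b0h Eb] := MVT_eq h0 (fun r : R => is_derive_tsl (tsl i a x) r ddf).
exists a, b; split => //.
rewrite -Eb tsl0 -[X in _ = (_ - X) * h]/(partial i f (tsl i a x)).
move: Ea; rewrite /phi (tslC i k a) !tsl0 => <-; ring.
Qed.

(** Schwarz's theorem: the second difference of [f] with step [h] is h^2 times either mixed
    derivative, taken at two points that tend to [x] with [h]. *)
Lemma partialC (f : V -> R) i k (x : V) :
  (forall j x, derivable f x (e_ R j)) ->
  (forall j l x, derivable (partial j f) x (e_ R l)) ->
  (forall j l, continuous (partial l (partial j f))) ->
  partial k (partial i f) x = partial i (partial k f) x.
Proof.
move=> df ddf cddf; set g1 := partial k _; set g2 := partial i (partial k f).
have loc (g : V -> R) j l (e : R) : continuous g -> 0 < e -> exists2 d, 0 < d &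
    forall a b : R, 0 <= a <= d -> 0 <= b <= d -> `|g (tsl j a (tsl l b x)) - g x| <= e.
  move=> cg e0; pose G (p : R * R) := g (tsl j p.1 (tsl l p.2 x)).
  have cG : continuous G.
    apply: (@cont_comp _ _ _ (fun p : R * R => tsl j p.1 (tsl l p.2 x)) g) => //.
    apply: (@cont_comp _ _ _ (fun p : R * R => (tsl l p.2 x, p.1))
      (fun q : V * R => tsl j q.2 q.1)); last exact: cont_shift.
    apply: cont_pair; last exact: cont_fst.
    apply: (@cont_comp _ _ _ (fun p : R * R => (x, p.2))
      (fun q : V * R => tsl l q.2 q.1)); last exact: cont_shift.
    by apply: cont_pair; [exact: cont_const|exact: cont_snd].
  have /cvgrPdist_le /(_ _ e0) /nbhs_ballP[d /= d0 Hd] := cG (0, 0).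
  exists (d / 2); first exact: divr_gt0.
  move=> a b ad bd; have := Hd (a, b); rewrite /G /= !tsl0 distrC; apply.
  by split; rewrite /ball/= sub0r normrN ger0_norm; lra.
apply/eqP; rewrite -subr_eq0 -normr_eq0 eq_le normr_ge0 andbT.
apply/ler_addgt0Pl => e e0; rewrite addr0.
have e20 : 0 < e / 2 by rewrite divr_gt0.
have [d1 d10 H1] := loc g1 k i _ (cddf i k) e20.
have [d2 d20 H2] := loc g2 i k _ (cddf k i) e20.
pose h := Num.min d1 d2.
have h0 : 0 < h by rewrite lt_min d10 d20.
have hd1 : h <= d1 by rewrite ge_min lexx.
have hd2 : h <= d2 by rewrite ge_min lexx orbT.
have [a [b [a0 b0 E1]]] := second_difference x (ltW h0) (df i) (ddf i k).
have [a' [b' [a'0 b'0 E2]]] := second_difference x (ltW h0) (df k) (ddf k i).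
have E : g1 (tsl k b (tsl i a x)) = g2 (tsl i b' (tsl k a' x)).
  apply: (mulIf (lt0r_neq0 h0)); apply: (mulIf (lt0r_neq0 h0)).
  apply: etrans (esym E1) _; apply: etrans E2; rewrite (tslC i k).
  by move: (f _) (f _) (f _) (f x) => p q r s; clear; ring.
have le_d c d : 0 <= c <= h -> h <= d -> 0 <= c <= d.
  by move=> /andP[-> ch] hd; rewrite (le_trans ch hd).
have := H1 b a (le_d _ _ b0 hd1) (le_d _ _ a0 hd1).
have := H2 b' a' (le_d _ _ b'0 hd2) (le_d _ _ a'0 hd2).
rewrite E; move: (g2 _) (g2 x) (g1 x) => p q r; clear.
by rewrite !ler_norml; lra.
Qed.

End mixed_partials.

(** * One-sided time derivatives and extension beyond the time interval *)

Section time_derivative.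
Variable R : realType.

Lemma within_nbhs_interior (T t : R) : 0 < t < T -> within `[0, T] t^' = t^'.
Proof.
move=> tT; apply/seteqP; split=> A; rewrite /within /=; last first.
  by move=> FA; apply: filterS FA => x Ax _.
move=> FA; have F0T : t^' (`[0, T]%classic : set R).
  apply: nbhs_dnbhs; apply/nbhs_ballP; exists (Num.min t (T - t)) => /=.
    by rewrite lt_min subr_gt0; lra.
  by move=> s; rewrite /ball/= lt_min !ltr_norml in_itv /=; lra.
by apply: filterS2 FA F0T => x; apply.
Qed.

Lemma dquot_shift (f : R -> R) (t l : R) :
  (dquot f t @ t^' --> l) <->
  ((fun h : R => h^-1 *: ((f \o shift t) (h *: (1 : R)) - f t)) @ 0^' --> l).
Proof.
have E h : h^-1 *: ((f \o shift t) (h *: (1 : R)) - f t) = dquot f t (h + t).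
  by rewrite /dquot /= [h *: 1]mulr1 addrK mulrC.
split=> /cvgrPdist_lt H; apply/cvgrPdist_lt => e /H.
  move=> /nbhs_ballP[d /= d0 Hd]; apply/nbhs_ballP; exists d => //= h hd h0.
  rewrite E; apply: Hd; first by move: hd; rewrite /ball/= sub0r opprD addrCA subrr addr0.
  by move: h0; apply: contraNN => /eqP ht; apply/eqP; apply: (addIr t); rewrite ht add0r.
move=> /nbhs_ballP[d /= d0 Hd]; apply/nbhs_ballP; exists d => //= s sd st.
rewrite -[s](subrK t) -E; apply: Hd.
  by move: sd; rewrite /ball/= sub0r opprB.
by rewrite subr_eq0.
Qed.

Lemma is_derive_dtime (T : R) (f : R -> R) (t : R) : 0 < t < T ->
  derivable_in T f t -> is_derive t 1 f (dtime T f t).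
Proof.
move=> tT; rewrite /derivable_in /dtime (within_nbhs_interior tT) => df.
have H : dquot f t @ t^' --> lim (dquot f t @ t^') by exact: df.
move/dquot_shift : H => H; apply: DeriveDef; last exact: cvg_lim H.
by apply/cvg_ex; eexists; exact: H.
Qed.

Lemma dtimeE (T : R) (f : R -> R) (t df : R) : 0 < t < T ->
  is_derive t 1 f df -> dtime T f t = df.
Proof.
move=> tT [d <-]; rewrite /dtime within_nbhs_interior//; apply: cvg_lim => //.
exact/dquot_shift.
Qed.

Definition clamp (T t : R) : R := Num.max 0 (Num.min t T).

Lemma clamp_in (T t : R) : 0 <= T -> clamp T t \in `[0, T].
Proof.
by move=> T0; rewrite in_itv/= /clamp le_max lexx/= ge_max T0 ge_min lexx orbT.
Qed.

Lemma clampE (T t : R) : 0 <= t <= T -> clamp T t = t.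
Proof. by move=> /andP[t0 tT]; rewrite /clamp min_l// max_r. Qed.

Lemma cont_clamp (T : R) : continuous (clamp T).
Proof.
have -> : clamp T = fun t => ((t + T - `|t - T|) / 2 + `|(t + T - `|t - T|) / 2|) / 2.
  apply/funext => t; rewrite /clamp.
  have -> : Num.min t T = (t + T - `|t - T|) / 2.
    by case: (leP t T) => tT; [rewrite ler0_norm|rewrite gtr0_norm]; lra.
  set s := _ / 2; case: (leP 0 s) => s0; [rewrite ger0_norm//|rewrite ltr0_norm//]; lra.
have H : continuous (fun t => (t + T - `|t - T|) / 2).
  apply: contM; last exact: cont_cst.
  apply: contB; first by apply: contD; [exact: cont_id|exact: cont_cst].
  by apply: cont_norm; apply: contB; [exact: cont_id|exact: cont_cst].
by apply: contM; [apply: contD => //; exact: cont_norm|exact: cont_cst].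
Qed.

(** [clamp T] is continuous with values in the time interval, so composing with it turns continuity
    within the closed cylinder into plain continuity, the form required by [is_mean]. *)
Lemma cont_on_clamp (T : R) (f : R * R * R -> R -> R) : 0 <= T -> cont_on T f ->
  continuous (fun p : (R * R * R) * R => f p.1 (clamp T p.2)).
Proof.
move=> T0 cf p; have mp : (setT `*` `[0, T]) (p.1, clamp T p.2).
  by split => //=; exact: (clamp_in p.2 T0).
have := cf (p.1, clamp T p.2); rewrite /continuous_at /= /nbhs /= -nbhs_subspace_in// => H.
apply: (@cvg_comp _ _ _ (fun q : (R * R * R) * R => (q.1, clamp T q.2))
  (fun q : (R * R * R) * R => f q.1 q.2) _
  (within (setT `*` `[0, T]) (nbhs (p.1, clamp T p.2))) _ _ H).
have : continuous (fun q : (R * R * R) * R => (q.1, clamp T q.2)).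
  apply: cont_pair; first exact: cont_fst.
  by apply: (@cont_comp _ _ _ snd (clamp T)); [exact: cont_snd|exact: cont_clamp].
move=> /(_ p) C A HA.
have K : nbhs p (fun q => (setT `*` `[0, T]) (q.1, clamp T q.2) -> A (q.1, clamp T q.2)).
  exact: (C _ HA).
change (nbhs p (fun q => A (q.1, clamp T q.2))).
apply: filterS K => q; apply; split=> //=; exact: (clamp_in q.2 T0).
Qed.

End time_derivative.

(** * Classical solutions *)

Section solution.
Variable R : realType.
Notation V := (R * R * R)%type.

Definition C2p (f : V -> R) : Prop := C1p f /\ forall i, C1p (partial i f).

Definition jcont (f : V -> R -> R) : Prop :=
  continuous (fun p : V * R => f p.1 p.2).

Record jC2 (f : V -> R -> R) : Prop := JC2 {
  jC2_C2p : forall t, C2p (f^~ t) ;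
  jC2_cont : jcont f ;
  jC2_dcont : forall i, jcont (fun x t => partial i (f^~ t) x) ;
  jC2_ddcont : forall i k, jcont (fun x t => partial k (partial i (f^~ t)) x) }.

(* The equations in nondivergence form on the open time interval.  The
   functions are extended to all times by clamping [t] to [[0, T]]. *)
Record solution (nu kappa gamma T : R) (u : 'I_3 -> V -> R -> R)
    (th : V -> R -> R) (tu : 'I_3 -> V -> R -> R) (tth : V -> R -> R) : Prop :=
  Solution {
  sol_u : forall j, jC2 (u j) ;
  sol_th : jC2 th ;
  sol_tu_cont : forall j, jcont (tu j) ;
  sol_tth_cont : jcont tth ;
  sol_dtu : forall j x (t : R), 0 < t < T -> is_derive t 1 (u j x) (tu j x t) ;
  sol_dtth : forall x (t : R), 0 < t < T -> is_derive t 1 (th x) (tth x t) ;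
  sol_gt0 : forall x t, 0 < th x t ;
  sol_momentum : forall j x t, 0 < t < T ->
    tu j x t = - \sum_(i < 3) u i x t * partial i (u j ^~ t) x
      - gamma^-1 * u j x t * \sum_(i < 3) partial i (u i ^~ t) x
      + nu * \sum_(i < 3) partial i (fun y => th y t * partial i (u j ^~ t) y) x ;
  sol_temperature : forall x t, 0 < t < T ->
    tth x t = kappa * (th x t * \sum_(i < 3) partial i (partial i (th ^~ t)) x
        + 2 * \sum_(i < 3) partial i (th ^~ t) x ^+ 2)
      + nu / 2 * \sum_(i < 3) \sum_(j < 3) partial i (u j ^~ t) x ^+ 2
      - \sum_(i < 3) u i x t * partial i (th ^~ t) x
      - th x t / 2 * \sum_(i < 3) partial i (u i ^~ t) x }.

Lemma C2x1t_jC2 (T : R) (f : V -> R -> R) : 0 <= T -> C2x1t T f ->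
  jC2 (fun x t => f x (clamp T t)).
Proof.
move=> T0 [pf cf _ df ddf].
have j1 := cont_on_clamp T0 cf.
have j2 i := cont_on_clamp T0 (df i).2.
have j3 i k := cont_on_clamp T0 (ddf i k).2.
have inT t := clamp_in t T0.
have sec (g : V -> R -> R) t : continuous (fun p : V * R => g p.1 (clamp T p.2)) ->
    continuous (g^~ (clamp T t)).
  exact: (@cont_secl _ _ _ (fun p : V * R => g p.1 (clamp T p.2)) t).
split=> // t; split=> [|i]; split=> //.
- exact: pf.
- exact: sec.
- by move=> x i; apply: (df i).1.
- by move=> i; apply: (sec (fun x t => partial i (f^~ t) x)).
- exact: periodic_partial (pf _ (inT t)).
- by apply: (sec (fun x t => partial i (f^~ t) x)).
- by move=> x k; apply: (ddf i k).1.
- by move=> k; apply: (sec (fun x t => partial k (partial i (f^~ t)) x)).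
Qed.

Let momentum_alg (d a b c : R) : d + a + b - c = 0 -> d = - a - b + c.
Proof. by lra. Qed.

(** Division by [2 * th] turns the equation for theta^2 into one for theta. Here [a i], [b i],
    [c i], [e i] stand for d_i u_i, u_i, d_i theta and d_i d_i theta. *)
Let temperature_alg (d th nu kappa G : R) (a b c e : 'I_3 -> R) : 0 < th ->
  2 * th * d + \sum_(i < 3) (a i * th ^+ 2 + b i * (2 * th * c i))
    - kappa * \sum_(i < 3) (c i * (2 * th * c i) + th * (2 * (c i * c i + th * e i)))
    = nu * th * G ->
  d = kappa * (th * \sum_(i < 3) e i + 2 * \sum_(i < 3) c i ^+ 2) + nu / 2 * G
    - \sum_(i < 3) b i * c i - th / 2 * \sum_(i < 3) a i.
Proof.
move=> th0.
have -> : \sum_(i < 3) (a i * th ^+ 2 + b i * (2 * th * c i)) =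
    2 * th * (th / 2 * \sum_(i < 3) a i + \sum_(i < 3) b i * c i).
  by rewrite !mulr_sumr -big_split mulr_sumr; apply: eq_bigr => i _ /=; field.
have -> : \sum_(i < 3) (c i * (2 * th * c i) + th * (2 * (c i * c i + th * e i))) =
    2 * th * (th * \sum_(i < 3) e i + 2 * \sum_(i < 3) c i ^+ 2).
  by rewrite !mulr_sumr -big_split mulr_sumr; apply: eq_bigr => i _ /=; ring.
move=> E; apply: (mulfI (lt0r_neq0 (mulr_gt0 (ltr0Sn R 1) th0))).
move: E; move: (\sum_(i < 3) a i) (\sum_(i < 3) b i * c i) (\sum_(i < 3) e i)
  (\sum_(i < 3) c i ^+ 2) => s1 s2 s3 s4 E.
have -> : 2 * th * d = nu * th * G - 2 * th * (th / 2 * s1 + s2)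
   + kappa * (2 * th * (th * s3 + 2 * s4)) by lra.
by field.
Qed.

Lemma classical_solution_clamp (nu kappa gamma T : R)
    (u : V -> R -> 'rV[R]_3) (theta : V -> R -> R) :
  0 < T -> classical_solution nu kappa gamma T u theta ->
  solution nu kappa gamma T (fun j x t => u x (clamp T t) 0 j)
    (fun x t => theta x (clamp T t))
    (fun j x t => dtime T (fun s => u x s 0 j) (clamp T t))
    (fun x t => dtime T (theta x) (clamp T t)).
Proof.
move=> T0 [cu cth th0 mom temp]; have T0' := ltW T0.
have inT t := clamp_in t T0'.
have deriv (f : V -> R -> R) x t : C2x1t T f -> 0 < t < T ->
    is_derive t 1 (fun s => f x (clamp T s)) (dtime T (f x) (clamp T t)).
  move=> [_ _ [df _] _ _] tT; have tc : clamp T t = t by apply: clampE; lra.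
  have d := is_derive_dtime tT (df x t _); rewrite tc.
  have {}d : is_derive t 1 (f x) (dtime T (f x) t).
    by apply: d; rewrite in_itv/=; lra.
  apply: near_eq_is_derive d; apply/nbhs_ballP; exists (Num.min t (T - t)) => /=.
    by rewrite lt_min subr_gt0; lra.
  move=> s; rewrite /ball/= lt_min !ltr_norml => st; rewrite clampE//; lra.
have C2th := C2x1t_jC2 T0' cth.
have C2u j := C2x1t_jC2 T0' (cu j).
split=> //.
- by move=> j; have [_ _ [_ c] _ _] := cu j; apply: (cont_on_clamp T0' c).
- by have [_ _ [_ c] _ _] := cth; apply: (cont_on_clamp T0' c).
- by move=> j x t tT; exact: (deriv _ x t (cu j) tT).
- by move=> x t tT; exact: (deriv _ x t cth tT).
- by move=> x t; exact: (th0 x _ (inT t)).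
- move=> j x t tT.
  have E : dtime T (fun s => u x s 0 j) (clamp T t)
    + \sum_(i < 3) u x (clamp T t) 0 i * partial i (fun y => u y (clamp T t) 0 j) x
    + gamma^-1 * u x (clamp T t) 0 j *
      \sum_(i < 3) partial i (fun y => u y (clamp T t) 0 i) x
    - nu * \sum_(i < 3) partial i (fun y => theta y (clamp T t) *
        partial i (fun y => u y (clamp T t) 0 j) y) x = 0.
    exact: (mom x (clamp T t) (inT t) j).
  exact: (momentum_alg E).
- move=> x t tT; have := temp x (clamp T t) (inT t).
  have tc : clamp T t = t by apply: clampE; lra.
  have tin : t \in `[0, T] by rewrite in_itv/=; lra.
  have [[_ _ dth _] Cdth] := jC2_C2p C2th t.
  have [_ _ [dtth _] _ _] := cth.
  have dsq : is_derive t 1 (fun s => theta x s ^+ 2) (2 * theta x t * dtime T (theta x) t).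
    by have := dervX 2 (is_derive_dtime tT (dtth x t tin)); rewrite expr1.
  have du i : derivable (fun y => u y (clamp T t) 0 i) x (e_ R i).
    by have [[_ _ dui _] _] := jC2_C2p (C2u i) t; exact: dui.
  have dthi i y := is_derive_partial (dth y i).
  have dthii i y : is_derive y (e_ R i) (partial i (fun y => theta y (clamp T t)))
      (partial i (partial i (fun y => theta y (clamp T t))) y).
    by have [_ _ d _] := Cdth i; exact: is_derive_partial.
  have sq i y : is_derive y (e_ R i) (fun z => theta z (clamp T t) ^+ 2)
      (2 * theta y (clamp T t) * partial i (fun z => theta z (clamp T t)) y).
    by have := dervX 2 (dthi i y); rewrite expr1.
  have sqE i : partial i (fun z => theta z (clamp T t) ^+ 2) =
      fun y => 2 * theta y (clamp T t) * partial i (fun z => theta z (clamp T t)) y.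
    by apply/funext => y; rewrite (partialE (sq i y)).
  have E1 i : partial i (fun y => u y (clamp T t) 0 i * theta y (clamp T t) ^+ 2) x =
      partial i (fun y => u y (clamp T t) 0 i) x * theta x (clamp T t) ^+ 2
      + u x (clamp T t) 0 i * (2 * theta x (clamp T t) * partial i (fun z => theta z (clamp T t)) x).
    exact: (partialE (dervM (is_derive_partial (du i)) (sq i x))).
  have E2 i : partial i (fun y => theta y (clamp T t) *
        partial i (fun z => theta z (clamp T t) ^+ 2) y) x =
      partial i (fun z => theta z (clamp T t)) x *
        (2 * theta x (clamp T t) * partial i (fun z => theta z (clamp T t)) x)
      + theta x (clamp T t) * (2 * (partial i (fun z => theta z (clamp T t)) x *
          partial i (fun z => theta z (clamp T t)) x
          + theta x (clamp T t) * partial i (partial i (fun z => theta z (clamp T t))) x)).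
    have H : is_derive x (e_ R i) (fun y => 2 * theta y (clamp T t) *
       partial i (fun z => theta z (clamp T t)) y)
      (2 * (partial i (fun z => theta z (clamp T t)) x *
          partial i (fun z => theta z (clamp T t)) x
          + theta x (clamp T t) * partial i (partial i (fun z => theta z (clamp T t))) x)).
      apply: (derv_eq (dervZ 2 (dervM (dthi i x) (dthii i x)))) => // y.
      by rewrite mulrA.
    by rewrite sqE; exact: (partialE (dervM (dthi i x) H)).
  rewrite (eq_bigr _ (fun i _ => E1 i)) (eq_bigr _ (fun i _ => E2 i)).
  rewrite [in dtime _ _ _]tc (dtimeE tT dsq) -[in 2 * theta x t * _]tc.
  exact: temperature_alg (th0 _ _ (inT t)).
Qed.

End solution.

Arguments jC2_cont {R f} _ _ : rename.
Arguments jC2_dcont {R f} _ i _ : rename.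
Arguments jC2_ddcont {R f} _ i k _ : rename.
Arguments sol_tu_cont {R nu kappa gamma T u th tu tth} _ j _ : rename.
Arguments sol_tth_cont {R nu kappa gamma T u th tu tth} _ _ : rename.

(** * The maximum principle for the temperature *)

Local Opaque partial.

Section maximum_principle.
Variable R : realType.
Notation V := (R * R * R)%type.

Lemma periodic_int (f : V -> R) (z : int) i x : periodic3 f ->
  f (z%:~R *: e_ R i + x) = f x.
Proof.
move=> pf; have H n y : f (n%:R *: e_ R i + y) = f y.
  elim: n y => [|n IH] y; first by rewrite scale0r add0r.
  by rewrite -[n.+1]addn1 natrD scalerDl scale1r -addrA IH addrC pf.
case: z => n; first exact: H.
rewrite NegzE -[LHS](H n.+1) addrA -scalerDl.
by rewrite (_ : n.+1%:R + _ = 0) ?scale0r ?add0r// mulrNz subrr.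
Qed.

Lemma periodic_cube (x : V) : exists2 y : V, @cube R y &
  forall f : V -> R, periodic3 f -> f x = f y.
Proof.
pose n (r : R) : int := - Num.floor r.
pose i0 : 'I_3 := @Ordinal 3 0 isT; pose i1 : 'I_3 := @Ordinal 3 1 isT.
pose i2 : 'I_3 := @Ordinal 3 2 isT.
exists ((n x.1.1)%:~R *: e_ R i0 + ((n x.1.2)%:~R *: e_ R i1 + ((n x.2)%:~R *: e_ R i2 + x))).
  have H r : 0 <= (n r)%:~R + r <= 1.
    have /andP[] := floor_itv r; rewrite /n mulrNz intrD; lra.
  rewrite !shiftE /cube /= !in_itv /= !mulr0 !mulr1 !add0r.
  by rewrite !H.
by move=> f pf; rewrite !periodic_int.
Qed.

Lemma continuous_pos_near (g : R -> R) (t : R) : continuous g -> 0 < g t ->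
  exists2 d, 0 < d & forall x, t - d <= x <= t + d -> 0 < g x.
Proof.
move=> cg g0; have /cvgrPdist_lt /(_ _ g0) /nbhs_ballP[d /= d0 Hd] := cg t.
exists (d / 2); first exact: divr_gt0.
move=> x xd; have : `|t - x| < d by rewrite ltr_norml; lra.
by move=> /(Hd x); rewrite /= ltr_norml; lra.
Qed.

Lemma second_derivative_min (f f' f'' : R -> R) :
  (forall x : R, is_derive x 1 f (f' x)) -> (forall x : R, is_derive x 1 f' (f'' x)) ->
  continuous f'' -> (forall h, f 0 <= f h) -> f' 0 = 0 /\ 0 <= f'' 0.
Proof.
move=> df ddf cf'' fmin.
have cont (g g' : R -> R) a b : (forall x : R, is_derive x 1 g (g' x)) ->
    {within `[a, b], continuous g}.
  move=> dg; apply: continuous_subspaceT => y.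
  by apply/differentiable_continuous/derivable1_diffP; case: (dg y).
have f'0 : f' 0 = 0.
  have d0 : is_derive (0 : R) 1 f 0.
    apply: (@derive1_at_min _ f (-1) 1 0); first by lra.
    - by move=> t _; case: (df t).
    - by rewrite in_itv/=; lra.
    - by move=> t _; exact: fmin.
  by rewrite -(derv_val (df 0)) (derv_val d0).
split => //; rewrite leNgt; apply/negP => f0.
have [d d0 Hd] : exists2 d, 0 < d & forall x, 0 - d <= x <= 0 + d -> 0 < - f'' x.
  by apply: continuous_pos_near; [exact: contN|rewrite oppr_gt0].
have f'neg r : 0 < r -> r <= d -> f' r < 0.
  move=> r0 rd; have [c] := MVT r0 (fun x _ => ddf x) (cont _ _ _ _ ddf).
  rewrite in_itv/= f'0 !subr0 => /andP[c0 cr] ->.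
  rewrite pmulr_llt0// -oppr_gt0; apply: Hd; lra.
have [c] := MVT d0 (fun x _ => df x) (cont _ _ _ _ df).
rewrite in_itv/= subr0 => /andP[c0 cd] E.
have : f' c * d < 0 by rewrite pmulr_llt0// f'neg// ltW.
by rewrite -E subr_lt0 ltNge fmin.
Qed.

Lemma continuous_eq_closure (f g : R -> R) (T t : R) : 0 < T -> continuous f -> continuous g ->
  (forall s, 0 < s < T -> f s = g s) -> 0 <= t <= T -> f t = g t.
Proof.
move=> T0 cf cg fg tT; apply/eqP; rewrite -subr_eq0 -normr_eq0 eq_le normr_ge0 andbT.
rewrite leNgt; apply/negP => h0.
have [d d0 Hd] := continuous_pos_near (cont_norm (contB cf cg)) h0.
pose e := Num.min (d / 2) (T / 4).
have e0 : 0 < e by rewrite lt_min !divr_gt0.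
have ed : e <= d / 2 by rewrite ge_min lexx.
have eT : e <= T / 4 by rewrite ge_min lexx orbT.
have [tT2|tT2] := leP t (T / 2).
  have : 0 < `|f (t + e) - g (t + e)| by apply: Hd; lra.
  by rewrite fg ?subrr ?normr0 ?ltxx//; lra.
have : 0 < `|f (t - e) - g (t - e)| by apply: Hd; lra.
by rewrite fg ?subrr ?normr0 ?ltxx//; lra.
Qed.

Lemma jcont_time (f : V -> R -> R) x : jcont f -> continuous (f x).
Proof. exact: (@cont_secr _ _ _ (fun p : V * R => f p.1 p.2) x). Qed.

Lemma jcont_space (f : V -> R -> R) t : jcont f -> continuous (f^~ t).
Proof. exact: (@cont_secl _ _ _ (fun p : V * R => f p.1 p.2) t). Qed.

End maximum_principle.

Arguments jcont_time {R f} x _ _ : rename.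
Arguments jcont_space {R f} t _ _ : rename.

Ltac cont_arith := lazymatch goal with
  | |- forall x, @continuous_at _ _ x ?f => lazymatch f with
    | fun _ => ?c => exact: cont_cst
    | fun x => \sum_(i < _) @?a x i => apply: cont_sum => ?; cont_arith
    | fun x => @?a x + @?b x => apply: contD; cont_arith
    | fun x => - @?a x => apply: contN; cont_arith
    | fun x => @?a x * @?b x => apply: contM; cont_arith
    | fun x => @?a x ^+ _ => apply: contX; cont_arith
    | fun x => `|@?a x| => apply: cont_norm; cont_arith
    | fun x => powR (@?a x) _ => apply: cont_powR; cont_arith
    | _ => idtac
    end
  | _ => idtac
  end.

(* Closes the leaves left by [cont_arith]: [l0], [l1], [l2] treat a function and
   its first and second spatial derivatives.  The dispatch is syntactic because
   a failing unification of two such goals is very slow. *)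
Ltac cont_leaf l0 l1 l2 := lazymatch goal with
  | |- forall x, @continuous_at _ _ x ?f => lazymatch f with
    | fun x => partial _ (@?g x) (@?y x) => lazymatch g with
      | fun x => partial _ (@?h x) => l2 tt
      | _ => l1 tt
      end
    | _ => l0 tt
    end
  end.

Section lower_bound.
Variables (R : realType) (nu kappa gamma T : R).
Notation V := (R * R * R)%type.
Variables (u : 'I_3 -> V -> R -> R) (th : V -> R -> R).
Variables (tu : 'I_3 -> V -> R -> R) (tth : V -> R -> R).
Hypothesis nu0 : 0 < nu.
Hypothesis kappa0 : 0 < kappa.
Hypothesis T0 : 0 < T.
Hypothesis S : solution nu kappa gamma T u th tu tth.

Let rhs x t := kappa * (th x t * \sum_(i < 3) partial i (partial i (th ^~ t)) x
        + 2 * \sum_(i < 3) partial i (th ^~ t) x ^+ 2)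
      + nu / 2 * \sum_(i < 3) \sum_(j < 3) partial i (u j ^~ t) x ^+ 2
      - \sum_(i < 3) u i x t * partial i (th ^~ t) x
      - th x t / 2 * \sum_(i < 3) partial i (u i ^~ t) x.

(** The minimum in the maximum principle may be attained at [t = T], so the equation is extended to
    the closed interval by continuity of both sides. *)
Let temperature_closed x t : 0 <= t <= T -> tth x t = rhs x t.
Proof.
move=> tT; apply: (@continuous_eq_closure _ (tth x) (rhs x) T t T0) => //.
- exact: jcont_time (sol_tth_cont S).
- have cth := jcont_time x (jC2_cont (sol_th S)).
  have cdth i := jcont_time x (jC2_dcont (sol_th S) i).
  have cddth i := jcont_time x (jC2_ddcont (sol_th S) i i).
  have cu j := jcont_time x (jC2_cont (sol_u S j)).
  have cdu i j := jcont_time x (jC2_dcont (sol_u S j) i).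
  rewrite /rhs; cont_arith;
    lazymatch goal with
    | |- context [u] => cont_leaf ltac:(fun _ => exact (cu _)) ltac:(fun _ => exact (cdu _ _)) ltac:(fun _ => idtac)
    | _ => cont_leaf ltac:(fun _ => exact cth) ltac:(fun _ => exact (cdth _)) ltac:(fun _ => exact (cddth _))
    end.
- by move=> s; exact: (sol_temperature S).
Qed.

Let sq_trace (a : 'I_3 -> 'I_3 -> R) :
  (\sum_(i < 3) a i i) ^+ 2 <= 3 * \sum_(i < 3) \sum_(j < 3) a i j ^+ 2.
Proof.
apply: (@le_trans _ _ (3 * \sum_(i < 3) a i i ^+ 2)); last first.
  rewrite ler_pM2l//; apply: ler_sum => i _; rewrite (bigD1 i)//= lerDl.
  by apply: sumr_ge0 => j _; exact: sqr_ge0.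
rewrite !big_ord_recl !big_ord0 /=.
move: (a _ _) (a _ _) (a _ _) => p q r.
have := sqr_ge0 (p - q); have := sqr_ge0 (q - r); have := sqr_ge0 (p - r).
by nra.
Qed.

(** Origin of the rate 3 / (8 nu): with d = div u, the heating is at least nu d^2 / 6, and - 3 x^2 /
    (8 nu) is the minimum over d of nu d^2 / 6 - x d / 2. *)
Let source_ge (x d g : R) : 0 < x -> d ^+ 2 <= 3 * g ->
  - (3 / (8 * nu) * x ^+ 2) <= nu / 2 * g - x / 2 * d.
Proof.
move=> x0 dg; have nu1 : nu != 0 by rewrite gt_eqF.
apply: (@le_trans _ _ (nu / 6 * d ^+ 2 - x / 2 * d)); last first.
  have : 0 <= nu / 6 * (3 * g - d ^+ 2) by rewrite mulr_ge0 ?subr_ge0// divr_ge0// ltW.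
  by lra.
rewrite -subr_ge0.
have -> : nu / 6 * d ^+ 2 - x / 2 * d - - (3 / (8 * nu) * x ^+ 2) =
  nu / 6 * (d - 3 * x / (2 * nu)) ^+ 2 by field.
by rewrite mulr_ge0 ?sqr_ge0// divr_ge0// ltW.
Qed.

(** The barrier 1 / (1 + c t) solves y' = - c y^2. If the minimum of g = theta (1 + c t) over the
    compact cylinder were below 1, it would lie at a time t0 > 0; there the gradient of theta
    vanishes and its second derivatives are nonnegative, so the time derivative of g is at least c
    theta (1 - g) > 0. Then g would be smaller just before t0. *)
Lemma temperature_lower_bound : (forall x, 1 <= th x 0) -> forall x t, 0 <= t <= T ->
  1 <= th x t * (1 + 3 / (8 * nu) * t).
Proof.
set c := 3 / (8 * nu); have c0 : 0 < c by rewrite divr_gt0// mulr_gt0.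
move=> th1; pose g (p : V * R) := th p.1 p.2 * (1 + c * p.2).
have cg : continuous g.
  apply: contM; first exact: (jC2_cont (sol_th S)).
  apply: contD; first exact: cont_cst.
  by apply: contM; [exact: cont_cst|exact: cont_snd].
have cK : compact (@cube R `*` `[0, T] : set (V * R)).
  by apply: compact_setX; [exact: compact_cube|exact: segment_compact].
have K0 : (@cube R `*` `[0, T] : set (V * R)) !=set0.
  exists (0, 0, 0, 0); rewrite /cube /= !in_itv /= !lexx ler01 (ltW T0).
  by do ! split.
have [[x0 t0] + gmin] := compact_EVT_min K0 cK (continuous_subspaceT cg).
rewrite inE => -[/= _ t0T]; rewrite in_itv/= in t0T.
have {}gmin x t : 0 <= t <= T -> g (x0, t0) <= g (x, t).
  move=> tT; have [y cy Hy] := periodic_cube x.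
  have -> : g (x, t) = g (y, t).
    have [[pth _ _ _] _] := jC2_C2p (sol_th S) t.
    by rewrite /g /= (Hy (th^~ t) pth).
  by apply: gmin; rewrite inE; split => //=; rewrite in_itv.
move=> x t tT; apply: le_trans (gmin x t tT); rewrite /g /= leNgt; apply/negP => g1.
have t00 : 0 < t0.
  rewrite lt_neqAle; case/andP: t0T => -> _; rewrite andbT; apply/eqP => t0E.
  by move: g1; rewrite -t0E mulr0 addr0 mulr1 ltNge th1.
have ct0 : 0 < 1 + c * t0 by rewrite ltr_wpDr// mulr_ge0// ltW.
have [[_ _ dth _] Cdth] := jC2_C2p (sol_th S) t0.
have crit i : partial i (th^~ t0) x0 = 0 /\ 0 <= partial i (partial i (th^~ t0)) x0.
  have [_ _ ddth cddth] := Cdth i.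
  have [||d1 d2] := @second_derivative_min R (fun h => th (tsl i h x0) t0)
    (fun h => partial i (th^~ t0) (tsl i h x0))
    (fun h => partial i (partial i (th^~ t0)) (tsl i h x0))
    (fun h : R => is_derive_tsl x0 h (fun y => dth y i))
    (fun h : R => is_derive_tsl x0 h (fun y => ddth y i)).
  - apply: (@cont_comp _ _ _ (fun h => tsl i h x0) (partial i (partial i (th^~ t0)))) => //.
    have H := @cont_secr _ _ _ (fun p : V * R => tsl i p.2 p.1) x0 (@cont_shift _ i); exact: H.
  - move=> h; rewrite tsl0; have := gmin (tsl i h x0) t0 t0T.
    by rewrite /g /= ler_pM2r.
  - by rewrite tsl0 in d1 d2.
pose gt s := tth x0 s * (1 + c * s) + th x0 s * c.
have dgt (s : R) : 0 < s < T -> is_derive s 1 (fun s => g (x0, s)) (gt s).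
  move=> sT; apply: dervM; first exact: (sol_dtth S).
  apply: (derv_eq (dervD (derv_cst s 1 1) (dervZ c (is_derive_id s 1)))) => //.
  by rewrite add0r mulr1.
have gt0 : 0 < gt t0.
  rewrite /gt temperature_closed// /rhs.
  have -> : \sum_(i < 3) partial i (th^~ t0) x0 ^+ 2 = 0.
    by apply: big1 => i _; rewrite (crit i).1 expr0n.
  have -> : \sum_(i < 3) u i x0 t0 * partial i (th^~ t0) x0 = 0.
    by apply: big1 => i _; rewrite (crit i).1 mulr0.
  have L0 : 0 <= \sum_(i < 3) partial i (partial i (th^~ t0)) x0.
    by apply: sumr_ge0 => i _; exact: (crit i).2.
  have th0 := sol_gt0 S x0 t0.
  have src := source_ge th0 (sq_trace (fun i j => partial i (u j ^~ t0) x0)).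
  move: src L0 g1 th0.
  move: (\sum_(i < 3) \sum_(j < 3) _) (\sum_(i < 3) partial i (u i ^~ t0) x0)
    (\sum_(i < 3) partial i (partial i (th^~ t0)) x0) (th x0 t0) => G D L y src L0 g1 y0.
  have kL : 0 <= kappa * (y * L) by rewrite mulr_ge0 ?mulr_ge0// ltW.
  have : 0 < c * y * (1 - y * (1 + c * t0)) by rewrite mulr_gt0 ?subr_gt0// mulr_gt0.
  have : 0 <= (kappa * (y * L) + (nu / 2 * G - y / 2 * D) + c * y ^+ 2) * (1 + c * t0).
    by apply: mulr_ge0; [rewrite /c; lra|exact: ltW].
  by lra.
have cgt : continuous gt.
  have c1 := jcont_time x0 (sol_tth_cont S); have c2 := jcont_time x0 (jC2_cont (sol_th S)).
  by rewrite /gt; cont_arith; [exact c1|exact: (contM (@cont_cst _ _ c) (@cont_id _))|exact c2].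
have [d d0 Hd] := continuous_pos_near cgt gt0.
(* A positive time before [t0] from which on [gt] is positive. The mean value theorem uses the
   derivative on the open interval only, so [t0 = T] is allowed. *)
pose s := Num.max (t0 - d) (t0 / 2).
have st : s < t0 by rewrite gt_max; lra.
have s1 : t0 - d <= s by rewrite le_max lexx.
have s2 : t0 / 2 <= s by rewrite le_max lexx orbT.
have [r||r] := @MVT R (fun s => g (x0, s)) gt s t0 st.
- by rewrite in_itv/= => ?; apply: dgt; lra.
- by apply: continuous_subspaceT; exact: (@cont_secr _ _ _ g x0).
rewrite in_itv/= => rst E.
have : 0 < gt r * (t0 - s) by rewrite mulr_gt0 ?subr_gt0//; apply: Hd; lra.
by rewrite -E subr_gt0 ltNge gmin//; lra.
Qed.

End lower_bound.

(** * Evolution of powers of the temperature and of the velocity *)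

Section torus_leibniz.
Variable R : realType.
Notation V := (R * R * R)%type.

Lemma I3_divergence (F : 'I_3 -> V -> R) : (forall i, C1p (F i)) ->
  I3 (fun x => \sum_(i < 3) partial i (F i) x) = 0.
Proof.
move=> CF; rewrite (mean_sum (I3_mean R)); last by move=> i; have [_ _ _] := CF i; exact.
by apply: big1 => i _; exact: I3_partial.
Qed.

Lemma is_derive_I3 (f g : V -> R -> R) (T t : R) : 0 < t < T -> jcont f -> jcont g ->
  (forall x (s : R), 0 < s < T -> is_derive s 1 (f x) (g x s)) ->
  is_derive t 1 (fun s => I3 (f^~ s)) (I3 (g^~ t)).
Proof.
move=> tT cf cg df.
have H := @is_derive_mean _ _ _ _ (I3_mean R) (fun p => f p.1 p.2) (fun p => g p.1 p.2)
  (fun=> 1) 0 T t cf cg (@cont_cst _ _ 1) tT df.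
apply: (derv_eq (dervD H (derv_cst t 1 (I3 (f^~ t))))) => [s|].
  rewrite -(meanD (I3_mean R)).
  - by congr I3; apply/funext => x /=; rewrite mulr1 subrK.
  - apply: contM; last exact: cont_cst.
    by apply: contB; exact: jcont_space.
  - exact: jcont_space.
by rewrite addr0; congr I3; apply/funext => x /=; rewrite mulr1.
Qed.

End torus_leibniz.

Section evolution.
Variables (R : realType) (nu kappa gamma T : R).
Notation V := (R * R * R)%type.
Variables (u : 'I_3 -> V -> R -> R) (th : V -> R -> R).
Variables (tu : 'I_3 -> V -> R -> R) (tth : V -> R -> R).
Hypothesis nu0 : 0 < nu.
Hypothesis S : solution nu kappa gamma T u th tu tth.

Definition gradu2 x t := \sum_(i < 3) \sum_(j < 3) partial i (u j ^~ t) x ^+ 2.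
Definition gradth2 x t := \sum_(i < 3) partial i (th ^~ t) x ^+ 2.
Definition divu x t := \sum_(i < 3) partial i (u i ^~ t) x.
Definition u2 x t := \sum_(j < 3) u j x t ^+ 2.

Let th_gt0 := sol_gt0 S.

Ltac sol_leaf := lazymatch goal with
  | |- forall x, @continuous_at _ _ x ?f => lazymatch f with
    | fun x => tth _ _ => exact (sol_tth_cont S)
    | fun x => tu _ _ _ => exact (sol_tu_cont S _)
    | context [u] => cont_leaf ltac:(fun _ => exact (jC2_cont (sol_u S _)))
        ltac:(fun _ => exact (jC2_dcont (sol_u S _) _))
        ltac:(fun _ => exact (jC2_ddcont (sol_u S _) _ _))
    | context [th] => cont_leaf ltac:(fun _ => exact (jC2_cont (sol_th S)))
        ltac:(fun _ => exact (jC2_dcont (sol_th S) _))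
        ltac:(fun _ => exact (jC2_ddcont (sol_th S) _ _))
    end
  | |- forall x, is_true (0 < _) => by move=> ?; exact: th_gt0
  end.

Lemma jcont_gradu2 : jcont gradu2.
Proof. by rewrite /jcont /gradu2; cont_arith; sol_leaf. Qed.

Lemma jcont_gradth2 : jcont gradth2.
Proof. by rewrite /jcont /gradth2; cont_arith; sol_leaf. Qed.

Lemma jcont_divu : jcont divu.
Proof. by rewrite /jcont /divu; cont_arith; sol_leaf. Qed.

Lemma jcont_u2 : jcont u2.
Proof. by rewrite /jcont /u2; cont_arith; sol_leaf. Qed.

Lemma jcont_th_powR p : jcont (fun x t => th x t `^ p).
Proof. by rewrite /jcont; cont_arith; sol_leaf. Qed.

Let power_alg (p k n q y g : R) (a b c e : 'I_3 -> R) :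
  p * q * (k * (y * \sum_(i < 3) e i + 2 * \sum_(i < 3) c i ^+ 2) + n / 2 * g
    - \sum_(i < 3) b i * c i - y / 2 * \sum_(i < 3) a i) =
  p * (2 - p) * k * (q * \sum_(i < 3) c i ^+ 2) + p * n / 2 * (q * g)
    + (2 - p) / 2 * (q * y * \sum_(i < 3) a i)
    + \sum_(i < 3) (p * k * (p * q * c i * c i + q * y * e i)
        - (p * q * c i * b i + q * y * a i)).
Proof. by rewrite !big_ord_recl !big_ord0; field. Qed.

(** Multiplying the equation by p theta^(p-1) leaves, besides these three integrands, the divergence
    of [F]. For [p = 2] the first and last coefficients vanish; for [p = 2 - a] the first is
    positive and yields the dissipation of theta. *)
Lemma theta_power_evolution (p t : R) : 0 < t < T ->
  is_derive t 1 (fun s => I3 (fun x => th x s `^ p))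
    (p * (2 - p) * kappa * I3 (fun x => th x t `^ (p - 1) * gradth2 x t)
     + p * nu / 2 * I3 (fun x => th x t `^ (p - 1) * gradu2 x t)
     + (2 - p) / 2 * I3 (fun x => th x t `^ p * divu x t)).
Proof.
move=> tT.
pose g x s := p * th x s `^ (p - 1) * tth x s.
have cg : jcont g by rewrite /jcont /g; cont_arith; sol_leaf.
have H := is_derive_I3 tT (@jcont_th_powR p) cg
  (fun x s sT => derv_powR p (th_gt0 x s) (sol_dtth S x sT)).
apply: (derv_eq H) => //.
have [C1th Cdth] := jC2_C2p (sol_th S) t.
have C1u i := (jC2_C2p (sol_u S i) t).1.
have C1p_th := C1p_powR p C1th (th_gt0^~ t).
pose F i x := p * kappa * (th x t `^ p * partial i (th^~ t) x) - th x t `^ p * u i x t.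
have CF i : C1p (F i).
  apply: C1pB; last exact: C1pM.
  by apply: C1pM; [exact: C1p_cst|exact: C1pM].
have PF i x : partial i (F i) x =
    p * kappa * (p * th x t `^ (p - 1) * partial i (th^~ t) x * partial i (th^~ t) x
      + th x t `^ (p - 1) * th x t * partial i (partial i (th^~ t)) x)
    - (p * th x t `^ (p - 1) * partial i (th^~ t) x * u i x t
      + th x t `^ (p - 1) * th x t * partial i (u i ^~ t) x).
  have -> : th x t `^ (p - 1) * th x t = th x t `^ p.
    by rewrite -[X in _ * X]powRr1 ?(ltW (th_gt0 x t))// -powRD ?subrK// (gt_eqF (th_gt0 x t)) implybT.
  have [_ _ dth _] := C1th; have [_ _ ddth _] := Cdth i; have [_ _ du _] := C1u i.
  have dp := derv_powR p (th_gt0 x t) (is_derive_partial (dth x i)).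
  apply: partialE; apply: dervB; last exact: dervM dp (is_derive_partial (du x i)).
  by apply: dervZ; exact: dervM dp (is_derive_partial (ddth x i)).
have cp q : continuous (fun x => th x t `^ q) := jcont_space t (@jcont_th_powR q).
have c1 := jcont_space t jcont_gradth2; have c2 := jcont_space t jcont_gradu2.
have c3 := jcont_space t jcont_divu.
have c4 : continuous (fun x => p * (2 - p) * kappa * (th x t `^ (p - 1) * gradth2 x t)).
  by apply: contM; [exact: cont_cst|exact: contM].
have c5 : continuous (fun x => p * nu / 2 * (th x t `^ (p - 1) * gradu2 x t)).
  by apply: contM; [exact: cont_cst|exact: contM].
have c6 : continuous (fun x => (2 - p) / 2 * (th x t `^ p * divu x t)).
  by apply: contM; [exact: cont_cst|exact: contM].
have cS : continuous (fun x => \sum_(i < 3) partial i (F i) x).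
  by apply: cont_sum => i; have [_ _ _] := CF i; exact.
have mD := meanD (I3_mean R); have mZ := meanZ (I3_mean R).
transitivity (I3 (fun x => p * (2 - p) * kappa * (th x t `^ (p - 1) * gradth2 x t)
   + p * nu / 2 * (th x t `^ (p - 1) * gradu2 x t)
   + (2 - p) / 2 * (th x t `^ p * divu x t) + \sum_(i < 3) partial i (F i) x)).
  congr I3; apply/funext => x; rewrite /g (sol_temperature S) //.
  rewrite (eq_bigr _ (fun i _ => PF i x)).
  have -> : th x t `^ p = th x t `^ (p - 1) * th x t.
    by rewrite -[X in _ * X]powRr1 ?(ltW (th_gt0 x t))// -powRD ?subrK// (gt_eqF (th_gt0 x t)) implybT.
  exact: power_alg.
rewrite (mD _ _ (contD (contD c4 c5) c6) cS) (I3_divergence CF) addr0.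
rewrite (mD _ _ (contD c4 c5) c6) (mD _ _ c4 c5).
by rewrite !mZ//; exact: contM.
Qed.

(* With [s = |u|^2 + delta], [delta > 0], arbitrary real powers of [s] are
   differentiable, also where [u] vanishes. *)
Section velocity.
Variable delta : R.
Hypothesis delta0 : 0 < delta.

Definition sreg x t := u2 x t + delta.

Lemma sreg_gt0 x t : 0 < sreg x t.
Proof. by rewrite ltr_wpDl// sumr_ge0// => j _; exact: sqr_ge0. Qed.

Lemma jcont_sreg : jcont sreg.
Proof. by apply: contD; [exact: jcont_u2|exact: cont_cst]. Qed.

Lemma jcont_sreg_powR p : jcont (fun x t => sreg x t `^ p).
Proof. by apply: cont_powR; [exact: jcont_sreg|move=> ?; exact: sreg_gt0]. Qed.

Lemma C1p_u2 t : C1p (u2^~ t).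
Proof.
apply: C1p_sum => j; have C := (jC2_C2p (sol_u S j) t).1.
by rewrite /=; under eq_fun do rewrite expr2; exact: C1pM.
Qed.

Lemma C1p_sreg t : C1p (sreg^~ t).
Proof. by apply: C1pD; [exact: C1p_u2|exact: C1p_cst]. Qed.

Lemma C1p_sreg_powR p t : C1p (fun x => sreg x t `^ p).
Proof. by apply: C1p_powR; [exact: C1p_sreg|move=> x; exact: sreg_gt0]. Qed.

Lemma is_derive_sreg x t i : is_derive x (e_ R i) (sreg^~ t)
  (2 * \sum_(j < 3) u j x t * partial i (u j ^~ t) x).
Proof.
have H : is_derive x (e_ R i) (u2^~ t) (2 * \sum_(j < 3) u j x t * partial i (u j ^~ t) x).
  rewrite mulr_sumr; apply: (@derv_sum _ _ 3 (fun j y => u j y t ^+ 2)) => j.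
  have [[_ _ du _] _] := jC2_C2p (sol_u S j) t.
  by have := dervX 2 (is_derive_partial (du x i)); rewrite expr1 mulrA.
by apply: (derv_eq (dervD H (derv_cst x (e_ R i) delta))) => //; rewrite addr0.
Qed.

Let velocity_alg (q W s n gi y r : R) (U : 'I_3 -> R) (A M : 'I_3 -> 'I_3 -> R) :
  s = \sum_(j < 3) U j ^+ 2 + delta ->
  q * W * (2 * \sum_(j < 3) U j * (- \sum_(i < 3) U i * A i j
      - gi * U j * \sum_(i < 3) A i i + n * \sum_(i < 3) M i j)) =
  (1 - 2 * q * gi) * (W * s * \sum_(i < 3) A i i)
  + 2 * q * delta * gi * (W * \sum_(i < 3) A i i)
  - 2 * n * q * (y * (W * \sum_(i < 3) \sum_(j < 3) A i j ^+ 2))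
  - n * q * (q - 1) * r * y * \sum_(i < 3) (2 * \sum_(j < 3) U j * A i j) ^+ 2
  + \sum_(i < 3) (2 * n * q * (\sum_(j < 3)
        (((q - 1) * r * (2 * \sum_(j < 3) U j * A i j) * U j + W * A i j) * (y * A i j)
          + W * U j * M i j))
      - (q * W * (2 * \sum_(j < 3) U j * A i j) * U i + W * s * A i i)).
Proof. by move=> ->; rewrite !big_ord_recl !big_ord0; ring. Qed.

(** An inequality, because the diffusion term with coefficient q (q - 1) and the square of grad s
    has a good sign for [q >= 1] and is dropped. The first coefficient vanishes for q = gamma / 2,
    which is what the factor 1 / gamma in the momentum equation is made for; the second term is the
    cost of the regularisation. *)
Lemma velocity_power_evolution (q t : R) : 1 <= q -> 0 < t < T ->
  exists2 d, is_derive t 1 (fun s => I3 (fun x => sreg x s `^ q)) d &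
    d <= (1 - 2 * q / gamma) * I3 (fun x => sreg x t `^ q * divu x t)
      + 2 * q * delta / gamma * I3 (fun x => sreg x t `^ (q - 1) * divu x t)
      - 2 * nu * q * I3 (fun x => th x t * (sreg x t `^ (q - 1) * gradu2 x t)).
Proof.
move=> q1 tT.
pose g x s := q * sreg x s `^ (q - 1) * (2 * \sum_(j < 3) u j x s * tu j x s).
have cg : jcont g.
  apply: contM; first by apply: contM; [exact: cont_cst|exact: jcont_sreg_powR].
  by cont_arith; sol_leaf.
have ds x (s : R) : 0 < s < T ->
    is_derive s 1 (sreg x) (2 * \sum_(j < 3) u j x s * tu j x s).
  move=> sT.
  have H : is_derive s 1 (u2 x) (2 * \sum_(j < 3) u j x s * tu j x s).
    rewrite mulr_sumr; apply: (@derv_sum _ _ 3 (fun j r => u j x r ^+ 2)) => j.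
    by have := dervX 2 (sol_dtu S j x sT); rewrite expr1 mulrA.
  by apply: (derv_eq (dervD H (derv_cst s 1 delta))) => //; rewrite addr0.
exists (I3 (g^~ t)).
  exact: (is_derive_I3 tT (@jcont_sreg_powR q) cg
    (fun x s sT => derv_powR q (sreg_gt0 x s) (ds x s sT))).
pose F i x := 2 * nu * q * (\sum_(j < 3) sreg x t `^ (q - 1) * u j x t *
    (th x t * partial i (u j ^~ t) x)) - sreg x t `^ q * u i x t.
have C1th := (jC2_C2p (sol_th S) t).1.
have C1u j := (jC2_C2p (sol_u S j) t).1.
have C1du i j := (jC2_C2p (sol_u S j) t).2 i.
have C1s p := @C1p_sreg_powR p t.
have CF i : C1p (F i).
  apply: C1pB; last exact: C1pM.
  apply: C1pM; first exact: C1p_cst.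
  by apply: C1p_sum => j; apply: C1pM; apply: C1pM.
pose sig i x := 2 * \sum_(j < 3) u j x t * partial i (u j ^~ t) x.
have sE x : sreg x t `^ q = sreg x t `^ (q - 1) * sreg x t.
  by rewrite -[X in _ * X]powRr1 ?(ltW (sreg_gt0 x t))// -powRD ?subrK//
    (gt_eqF (sreg_gt0 x t)) implybT.
have PF i x : partial i (F i) x =
    2 * nu * q * (\sum_(j < 3)
      (((q - 1) * sreg x t `^ (q - 1 - 1) * sig i x * u j x t
          + sreg x t `^ (q - 1) * partial i (u j ^~ t) x) * (th x t * partial i (u j ^~ t) x)
        + sreg x t `^ (q - 1) * u j x t *
          partial i (fun y => th y t * partial i (u j ^~ t) y) x))
    - (q * sreg x t `^ (q - 1) * sig i x * u i x t
      + sreg x t `^ (q - 1) * sreg x t * partial i (u i ^~ t) x).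
  have dsp p := @derv_powR R _ (sreg^~ t) x (e_ R i) p _ (sreg_gt0 x t) (@is_derive_sreg x t i).
  have du j : is_derive x (e_ R i) (u j ^~ t) (partial i (u j ^~ t) x).
    by have [_ _ d _] := C1u j; exact: is_derive_partial.
  have dM j : is_derive x (e_ R i) (fun y => th y t * partial i (u j ^~ t) y)
      (partial i (fun y => th y t * partial i (u j ^~ t) y) x).
    by have [_ _ d _] := C1pM C1th (C1du i j); exact: is_derive_partial.
  rewrite -sE; apply: partialE; apply: dervB; last exact: dervM (dsp q) (du i).
  apply: dervZ; apply: (@derv_sum _ _ 3 (fun j y => sreg y t `^ (q - 1) * u j y t *
    (th y t * partial i (u j ^~ t) y))) => j.
  exact: dervM (dervM (dsp (q - 1)) (du j)) (dM j).
have mD := meanD (I3_mean R); have mZ := meanZ (I3_mean R).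
have mB := meanB (I3_mean R).
have cp p : continuous (fun x => sreg x t `^ p) := jcont_space t (@jcont_sreg_powR p).
have c1 := jcont_space t (jC2_cont (sol_th S)); have c2 := jcont_space t jcont_gradu2.
have c3 := jcont_space t jcont_divu.
have b1 : continuous (fun x => sreg x t `^ q * divu x t) by exact: contM.
have b2 : continuous (fun x => sreg x t `^ (q - 1) * divu x t) by exact: contM.
have b3 : continuous (fun x => th x t * (sreg x t `^ (q - 1) * gradu2 x t)).
  by apply: contM => //; exact: contM.
have d1 := contM (@cont_cst R V (1 - 2 * q / gamma)) b1.
have d2 := contM (@cont_cst R V (2 * q * delta / gamma)) b2.
have d3 := contM (@cont_cst R V (2 * nu * q)) b3.
have cS : continuous (fun x => \sum_(i < 3) partial i (F i) x).
  by apply: cont_sum => i; have [_ _ _] := CF i; exact.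
apply: (@le_trans _ _ (I3 (fun x => (1 - 2 * q / gamma) * (sreg x t `^ q * divu x t)
      + 2 * q * delta / gamma * (sreg x t `^ (q - 1) * divu x t)
      - 2 * nu * q * (th x t * (sreg x t `^ (q - 1) * gradu2 x t))
      + \sum_(i < 3) partial i (F i) x))); last first.
  rewrite (mD _ _ (contB (contD d1 d2) d3) cS) (I3_divergence CF) addr0.
  by rewrite (mB _ _ (contD d1 d2) d3) (mD _ _ d1 d2) !mZ.
apply: (le_mean (I3_mean R)).
- exact: jcont_space.
- exact: contD (contB (contD d1 d2) d3) cS.
move=> x _; rewrite /g (eq_bigr _ (fun i _ => PF i x)).
have -> : \sum_(j < 3) u j x t * tu j x t = \sum_(j < 3) u j x t *
    (- \sum_(i < 3) u i x t * partial i (u j ^~ t) x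
      - gamma^-1 * u j x t * \sum_(i < 3) partial i (u i ^~ t) x
      + nu * \sum_(i < 3) partial i (fun y => th y t * partial i (u j ^~ t) y) x).
  by apply: eq_bigr => j _; rewrite (sol_momentum S j x tT).
rewrite (@velocity_alg q _ (sreg x t) nu gamma^-1 (th x t) (sreg x t `^ (q - 1 - 1))
  (fun j => u j x t) (fun i j => partial i (u j ^~ t) x)
  (fun i j => partial i (fun y => th y t * partial i (u j ^~ t) y) x)) //.
rewrite lerD2r sE lerBlDr lerDl !mulr_ge0 ?powR_ge0 ?(ltW (th_gt0 x t)) ?subr_ge0//.
- exact: ltW.
- exact: le_trans q1.
- by apply: sumr_ge0 => i _; exact: sqr_ge0.
Qed.

End velocity.
End evolution.

Arguments jcont_gradu2 {R nu kappa gamma T u th tu tth} S x : rename.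
Arguments jcont_gradth2 {R nu kappa gamma T u th tu tth} S x : rename.
Arguments jcont_divu {R nu kappa gamma T u th tu tth} S x : rename.
Arguments jcont_u2 {R nu kappa gamma T u th tu tth} S x : rename.
Arguments jcont_th_powR {R nu kappa gamma T u th tu tth} S p x : rename.
Arguments jcont_sreg {R nu kappa gamma T u th tu tth} S delta x : rename.
Arguments jcont_sreg_powR {R nu kappa gamma T u th tu tth} S {delta} delta0 p x : rename.

(** * Evolution of the weighted gradient *)

Ltac nonneg := repeat first
  [ assumption | exact: sqr_ge0 | exact: powR_ge0 | exact: ler0n | exact: ler01
  | exact: normr_ge0 | (apply: ltW; assumption)
  | apply: addr_ge0 | apply: divr_ge0 | apply: mulr_ge0 | apply: exprn_ge0 ].

Section gradient_algebra.
Variable R : realFieldType.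
Implicit Types (a q y nu kappa : R) (b U : 'I_3 -> R).

Lemma cauchy_schwarz3 (v w : 'I_3 -> R) :
  (\sum_(i < 3) v i * w i) ^+ 2 <= (\sum_(i < 3) v i ^+ 2) * (\sum_(i < 3) w i ^+ 2).
Proof.
rewrite !big_ord_recl !big_ord0 !addr0.
move: (v _) (v _) (v _) (w _) (w _) (w _) => v0 v1 v2 w0 w1 w2.
rewrite -subr_ge0 (_ : _ - _ = (v0 * w1 - v1 * w0) ^+ 2 + (v0 * w2 - v2 * w0) ^+ 2
   + (v1 * w2 - v2 * w1) ^+ 2); last by ring.
by rewrite !addr_ge0 ?sqr_ge0.
Qed.

Lemma trace_sq_le (H : 'I_3 -> 'I_3 -> R) :
  (\sum_(i < 3) H i i) ^+ 2 <= 3 * \sum_(k < 3) \sum_(i < 3) H k i ^+ 2.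
Proof.
apply: (@le_trans _ _ (3 * \sum_(i < 3) H i i ^+ 2)).
  have := cauchy_schwarz3 (fun=> 1) (fun i => H i i).
  under eq_bigr do rewrite mul1r.
  by rewrite sumr_const card_ord expr1n.
rewrite ler_pM2l//; apply: ler_sum => i _; rewrite (bigD1 i)//= lerDl.
by apply: sumr_ge0 => j _; exact: sqr_ge0.
Qed.

Lemma young_sq (c x y : R) : 0 < c -> 2 * x * y <= c * x ^+ 2 + c^-1 * y ^+ 2.
Proof.
move=> c0; rewrite -subr_ge0 (_ : _ - _ = c * (x - c^-1 * y) ^+ 2).
  by rewrite mulr_ge0 ?sqr_ge0// ltW.
by field; rewrite gt_eqF.
Qed.

(* The second and third summands on the left integrate to zero.  They turn the
   diffusion terms into [- |Hessian|^2] up to squares of first order terms; the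
   mixed terms [b * A * H] cancel precisely because [a * kappa = nu * (1 - a)],
   which is the choice [a = 1 / K]. *)
Lemma diffusion_identity a q y nu kappa (N : R) b (A : 'I_3 -> R) (H : 'I_3 -> 'I_3 -> R) :
  (forall i k, H i k = H k i) -> a * kappa = nu * (1 - a) ->
  - 2 * ((N + nu * \sum_(k < 3) (b k * A k + y * H k k)) *
      \sum_(i < 3) (- a * q * b i * A i + q * y * H i i))
  + 2 * nu * (\sum_(k < 3) \sum_(i < 3)
      ((b k * A k + y * H k k) * (- a * q * b i * A i + q * y * H i i)
       - (b i * A k + y * H i k) * (- a * q * b k * A i + q * y * H k i)))
  + a * kappa * \sum_(k < 3) (q * y * b k * (2 * \sum_(i < 3) A i * H k i))
  = q * (- 2 * N * (y * \sum_(i < 3) H i i - a * \sum_(i < 3) b i * A i)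
     + 2 * nu * a * (\sum_(i < 3) b i * A i) ^+ 2
     - 2 * nu * y ^+ 2 * \sum_(k < 3) \sum_(i < 3) H k i ^+ 2).
Proof.
move=> Hs ->; rewrite !big_ord_recl !big_ord0.
rewrite (Hs (lift ord0 ord0) ord0) (Hs (lift ord0 (lift ord0 ord0)) ord0).
rewrite (Hs (lift ord0 (lift ord0 ord0)) (lift ord0 ord0)).
by ring.
Qed.

(** Young's inequality with weights nu / 3 and kappa / 4; the trace of [H] is absorbed by the
    Hessian term because its square is at most 3 |H|^2. By [nu <= kappa] the coefficients of N^2 add
    up to 7 / nu, and 2 nu a grows to 2 kappa a, exactly the amount that the temperature equation
    gives back in [gradient_pointwise]. *)
Lemma transport_bound nu kappa a y b (A : 'I_3 -> R) (H : 'I_3 -> 'I_3 -> R) (N : R) :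
  0 < nu -> 0 < kappa -> nu <= kappa -> 0 < a ->
  - 2 * N * (y * \sum_(i < 3) H i i - a * \sum_(i < 3) b i * A i)
  + 2 * nu * a * (\sum_(i < 3) b i * A i) ^+ 2
  - 2 * nu * y ^+ 2 * \sum_(k < 3) \sum_(i < 3) H k i ^+ 2
  <= (2 * kappa * a + a ^+ 2 * kappa / 4) *
      ((\sum_(i < 3) b i ^+ 2) * \sum_(i < 3) A i ^+ 2) + 7 / nu * N ^+ 2.
Proof.
move=> nu0 kappa0 nk a0.
have trace := trace_sq_le H.
have CS := cauchy_schwarz3 b A.
have H0 : 0 <= \sum_(k < 3) \sum_(i < 3) H k i ^+ 2.
  by apply: sumr_ge0 => k _; apply: sumr_ge0 => i _; exact: sqr_ge0.
move: trace CS H0; set m := (\sum_(i < 3) b i ^+ 2) * \sum_(i < 3) A i ^+ 2.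
move: (\sum_(i < 3) H i i) (\sum_(k < 3) \sum_(i < 3) H k i ^+ 2)
  (\sum_(i < 3) b i * A i) m => tr h be m trh bem h0.
have c1 : 0 < nu / 3 by rewrite divr_gt0.
have c2 : 0 < kappa / 4 by rewrite divr_gt0.
have := young_sq (y * tr) (- N) c1; have := young_sq (a * be) N c2.
have -> : (kappa / 4)^-1 = 4 / kappa by field; rewrite gt_eqF.
have -> : (nu / 3)^-1 = 3 / nu by field; rewrite gt_eqF.
have k4 : 4 / kappa * N ^+ 2 <= 4 / nu * N ^+ 2.
  by rewrite ler_wpM2r ?sqr_ge0// ler_pM2l// lef_pV2.
have t1 : nu / 3 * (y * tr) ^+ 2 <= nu * y ^+ 2 * h.
  rewrite exprMn (_ : nu / 3 * _ = nu / 3 * y ^+ 2 * tr ^+ 2); last by ring.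
  rewrite (_ : nu * _ * h = nu / 3 * y ^+ 2 * (3 * h)); last by field.
  by rewrite ler_wpM2l// mulr_ge0 ?sqr_ge0// ltW.
have t2 : 0 <= nu * y ^+ 2 * h by nonneg.
have t3 : (2 * kappa * a + a ^+ 2 * kappa / 4) * be ^+ 2 <=
    (2 * kappa * a + a ^+ 2 * kappa / 4) * m.
  by apply: ler_wpM2l => //; nonneg.
have t4 : 2 * nu * a * be ^+ 2 <= 2 * kappa * a * be ^+ 2.
  by rewrite ler_wpM2r ?sqr_ge0// ler_pM2r// ler_pM2l.
have -> : 7 / nu * N ^+ 2 = 4 / nu * N ^+ 2 + 3 / nu * N ^+ 2 by field; rewrite gt_eqF.
move: t1 t2 t3 t4 k4; rewrite sqrrN.
move: (4 / kappa) (4 / nu) (3 / nu) => i1 i2 i3; lra.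
Qed.

(** The bound 1 / 2 on gi = 1 / gamma comes from gamma >= 2. The two parts contribute 2 and 3 / 2,
    rounded up to 4. *)
Lemma transport_sq (gi : R) U (A : 'I_3 -> 'I_3 -> R) : 0 <= gi <= 1 / 2 ->
  \sum_(j < 3) (- \sum_(i < 3) U i * A i j - gi * U j * \sum_(i < 3) A i i) ^+ 2
  <= 4 * ((\sum_(j < 3) U j ^+ 2) * \sum_(i < 3) \sum_(j < 3) A i j ^+ 2).
Proof.
move=> gi12; set G := \sum_(i < 3) \sum_(j < 3) _; set Q := \sum_(j < 3) U j ^+ 2.
set d := \sum_(i < 3) A i i.
have G0 : 0 <= G by apply: sumr_ge0 => i _; apply: sumr_ge0 => j _; exact: sqr_ge0.
have d3 : d ^+ 2 <= 3 * G by exact: trace_sq_le.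
have term j : (- \sum_(i < 3) U i * A i j - gi * U j * d) ^+ 2 <=
    2 * (Q * \sum_(i < 3) A i j ^+ 2) + 3 / 2 * G * U j ^+ 2.
  have := cauchy_schwarz3 U (A^~ j); rewrite -/Q.
  set m := Q * \sum_(i < 3) A i j ^+ 2.
  move: (\sum_(i < 3) U i * A i j) m => p m pm.
  have : 0 <= (p - gi * U j * d) ^+ 2 by exact: sqr_ge0.
  have : (gi * U j * d) ^+ 2 <= 3 / 4 * G * U j ^+ 2.
    have g4 : gi ^+ 2 <= 1 / 4 by have := sqr_ge0 (gi - 1 / 2); nra.
    rewrite !exprMn (_ : gi ^+ 2 * _ * _ = gi ^+ 2 * d ^+ 2 * U j ^+ 2); last by ring.
    rewrite ler_wpM2r ?sqr_ge0// (@le_trans _ _ (1 / 4 * (3 * G)))//; last by lra.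
    by rewrite ler_pM ?sqr_ge0.
  by lra.
apply: (le_trans (ler_sum _ (fun j _ => term j))).
rewrite big_split /= -!mulr_sumr exchange_big /= -/G -/Q.
have : 0 <= Q * G by rewrite mulr_ge0// sumr_ge0// => j _; exact: sqr_ge0.
by lra.
Qed.

(** Half of the available a nu / 2 G^2 is spent on Young's inequality: a nu / 8 for the terms with Q
    G, and twice a nu / 16 for the divergence term. The coefficient of Q G is 28 + 1 over nu, where
    28 = 7 * 4 comes from [transport_bound] and [transport_sq]; this gives 1682 = 2 * 29^2. Likewise
    36 = 4 * 3^2. *)
Lemma transport_scalar a y nu kappa (B G X d Q : R) :
  0 < nu -> 0 < kappa -> nu <= kappa -> 0 < a -> 0 <= G -> 0 <= B -> 0 <= Q ->
  a * X <= a ^+ 2 * kappa / 4 * B + Q / kappa -> d ^+ 2 <= 3 * G ->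
  - (3 / 4 * (a ^+ 2 * kappa) * (B * G)) - a * nu / 2 * G ^+ 2
     + a * X * G + a * (y / 2 * d) * G + 28 / nu * (Q * G)
  <= - (a * nu / 4) * G ^+ 2 + 36 * a / nu ^+ 3 * y ^+ 4 + 1682 / (a * nu ^+ 3) * Q ^+ 2.
Proof.
move=> nu0 kappa0 nk a0 G0 B0 Q0 aX dG.
have h1 : a * X * G <= a ^+ 2 * kappa / 4 * (B * G) + 1 / nu * (Q * G).
  apply: (@le_trans _ _ ((a ^+ 2 * kappa / 4 * B + Q / kappa) * G)).
    by rewrite ler_wpM2r.
  rewrite mulrDl -!mulrA lerD2l mul1r (mulrCA Q) ler_wpM2r ?mulr_ge0//.
  by rewrite lef_pV2.
have h2 : 29 / nu * (Q * G) <= a * nu / 8 * G ^+ 2 + 1682 / (a * nu ^+ 3) * Q ^+ 2.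
  have c0 : 0 < a * nu / 4 by rewrite divr_gt0// mulr_gt0.
  have := young_sq G (29 / nu * Q) c0.
  have -> : (a * nu / 4)^-1 * (29 / nu * Q) ^+ 2 = 2 * (1682 / (a * nu ^+ 3) * Q ^+ 2).
    by field; rewrite !gt_eqF.
  by move: (1682 / _ * _) (nu^-1) => ? ?; lra.
have n8 : 0 < nu / 8 by rewrite divr_gt0.
have h3 : y / 2 * d * G <= nu / 16 * G ^+ 2 + 3 / nu * y ^+ 2 * G.
  have := young_sq G (y / 2 * d) n8.
  have -> : (nu / 8)^-1 * (y / 2 * d) ^+ 2 = 2 / nu * y ^+ 2 * d ^+ 2.
    by field; rewrite !gt_eqF.
  have : 2 / nu * y ^+ 2 * d ^+ 2 <= 2 / nu * y ^+ 2 * (3 * G).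
    by apply: ler_wpM2l => //; nonneg.
  by move: (nu^-1) => ?; lra.
have h4 : 3 / nu * y ^+ 2 * G <= nu / 16 * G ^+ 2 + 36 / nu ^+ 3 * y ^+ 4.
  have := young_sq G (3 / nu * y ^+ 2) n8.
  have -> : (nu / 8)^-1 * (3 / nu * y ^+ 2) ^+ 2 = 2 * (36 / nu ^+ 3 * y ^+ 4).
    by field; rewrite !gt_eqF.
  by move: (36 / _ * _) => ?; lra.
have h5 : a * (y / 2 * d * G) <= a * (nu / 8 * G ^+ 2 + 36 / nu ^+ 3 * y ^+ 4).
  by rewrite ler_pM2l//; move: h3 h4; move: (3 / _ * _ * _) (36 / _ * _) => ? ?; lra.
have h6 : 0 <= a ^+ 2 * kappa * (B * G) by nonneg.
have -> : 36 * a / nu ^+ 3 * y ^+ 4 = a * (36 / nu ^+ 3 * y ^+ 4) by rewrite !mulrA (mulrC a).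
move: h1 h2 h5 h6; rewrite mulrDr; move: (36 / _ * _) (1682 / _ * _) (nu^-1) => ? ? ?; lra.
Qed.

(* [q = theta^(-a-1)], [y = theta], [b = grad theta], [e i = d_i d_i theta],
   [A i j = d_i u_j], [H k i j = d_k d_i u_j]. *)
Lemma gradient_pointwise a q y nu kappa gi b U (e : 'I_3 -> R)
    (A : 'I_3 -> 'I_3 -> R) (H : 'I_3 -> 'I_3 -> 'I_3 -> R) :
  0 < nu -> 0 < kappa -> nu <= kappa -> 0 < a -> a * kappa = nu * (1 - a) ->
  0 <= gi <= 1 / 2 -> 0 < q -> (forall i k j, H i k j = H k i j) ->
  let G := \sum_(i < 3) \sum_(j < 3) A i j ^+ 2 in
  let Q := \sum_(j < 3) U j ^+ 2 in
  let N j := - \sum_(i < 3) U i * A i j - gi * U j * \sum_(i < 3) A i i in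
  (- a * q * (kappa * (y * \sum_(i < 3) e i + 2 * \sum_(i < 3) b i ^+ 2) + nu / 2 * G
      - \sum_(i < 3) U i * b i - y / 2 * \sum_(i < 3) A i i) * G
  - 2 * \sum_(j < 3) ((N j + nu * \sum_(k < 3) (b k * A k j + y * H k k j)) *
      \sum_(i < 3) (- a * q * b i * A i j + q * y * H i i j))
  + a * kappa * \sum_(k < 3) ((- a * q * b k * G
      + q * y * \sum_(i < 3) \sum_(j < 3) 2 * A i j * H k i j) * b k + q * y * G * e k)
  + 2 * nu * \sum_(j < 3) \sum_(k < 3) \sum_(i < 3)
      ((b k * A k j + y * H k k j) * (- a * q * b i * A i j + q * y * H i i j)
       - (b i * A k j + y * H i k j) * (- a * q * b k * A i j + q * y * H k i j))
  <= q * (- (a * nu / 4) * G ^+ 2 + 36 * a / nu ^+ 3 * y ^+ 4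
      + 1682 / (a * nu ^+ 3) * Q ^+ 2) : Prop).
Proof.
move=> nu0 kappa0 nk a0 aK gi12 q0 Hs G Q N.
set B := \sum_(i < 3) b i ^+ 2; set E := \sum_(i < 3) e i.
set X := \sum_(i < 3) U i * b i; set d := \sum_(i < 3) A i i.
(* For each component of the velocity, the left side of [diffusion_identity]. *)
pose L j := - 2 * ((N j + nu * \sum_(k < 3) (b k * A k j + y * H k k j)) *
      \sum_(i < 3) (- a * q * b i * A i j + q * y * H i i j))
  + 2 * nu * (\sum_(k < 3) \sum_(i < 3)
      ((b k * A k j + y * H k k j) * (- a * q * b i * A i j + q * y * H i i j)
       - (b i * A k j + y * H i k j) * (- a * q * b k * A i j + q * y * H k i j)))
  + a * kappa * \sum_(k < 3) (q * y * b k * (2 * \sum_(i < 3) A i j * H k i j)).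
have sumL : \sum_(j < 3) L j <= q * ((2 * kappa * a + a ^+ 2 * kappa / 4) * (B * G)
    + 7 / nu * (4 * (Q * G))).
  apply: (@le_trans _ _ (\sum_(j < 3) q * ((2 * kappa * a + a ^+ 2 * kappa / 4) *
      (B * \sum_(i < 3) A i j ^+ 2) + 7 / nu * N j ^+ 2))).
    apply: ler_sum => j _; rewrite /L diffusion_identity//.
    by rewrite ler_pM2l//; exact: transport_bound.
  rewrite -mulr_sumr ler_pM2l// big_split /= -!mulr_sumr exchange_big /= -/G lerD2l.
  by rewrite ler_pM2l ?divr_gt0//; exact: transport_sq.
have -> : forall w z s v : R, w - 2 * z + s + 2 * nu * v = w + (- 2 * z + 2 * nu * v + s).
  by move=> *; ring.
set s := a * kappa * _.
have -> : s = a * kappa * q * (y * E * G - a * (B * G))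
    + \sum_(j < 3) a * kappa * \sum_(k < 3) (q * y * b k * (2 * \sum_(i < 3) A i j * H k i j)).
  pose Wk k := \sum_(i < 3) \sum_(j < 3) 2 * A i j * H k i j.
  have EW k : Wk k = \sum_(j < 3) 2 * \sum_(i < 3) A i j * H k i j.
    rewrite /Wk exchange_big /=; apply: eq_bigr => j _; rewrite mulr_sumr.
    by apply: eq_bigr => i _; rewrite mulrA.
  rewrite (_ : \sum_(j < 3) a * kappa * _ = a * kappa * \sum_(k < 3) q * y * b k * Wk k).
    rewrite /s -(mulrA (a * kappa)) -mulrDr; congr (a * kappa * _).
    have -> : y * E * G - a * (B * G) = \sum_(k < 3) (y * e k * G - a * (b k ^+ 2 * G)).
      by rewrite /E /B !big_ord_recl !big_ord0; ring.
    rewrite [q * \sum_(k < 3) _]mulr_sumr -big_split.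
    by apply: eq_bigr => k _ /=; rewrite /Wk; ring.
  rewrite -mulr_sumr exchange_big /=; congr (_ * _); apply: eq_bigr => k _.
  by rewrite -mulr_sumr EW.
(* The terms with [E] cancel, and of those with [B * G] there remains 2 kappa a + a^2 kappa / 4 - 2
   kappa a - a^2 kappa = - 3/4 a^2 kappa. *)
have main : q * ((2 * kappa * a + a ^+ 2 * kappa / 4) * (B * G) + 7 / nu * (4 * (Q * G)))
   + (- a * q * (kappa * (y * E + 2 * B) + nu / 2 * G - X - y / 2 * d) * G
   + a * kappa * q * (y * E * G - a * (B * G)))
   <= q * (- (a * nu / 4) * G ^+ 2 + 36 * a / nu ^+ 3 * y ^+ 4
      + 1682 / (a * nu ^+ 3) * Q ^+ 2).
  rewrite (_ : _ + _ = q * (- (3 / 4 * (a ^+ 2 * kappa) * (B * G)) - a * nu / 2 * G ^+ 2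
     + a * X * G + a * (y / 2 * d) * G + 28 / nu * (Q * G))); last first.
    by field; rewrite gt_eqF.
  rewrite ler_pM2l//; apply: transport_scalar => //.
  - by apply: sumr_ge0 => i _; apply: sumr_ge0 => j _; exact: sqr_ge0.
  - by apply: sumr_ge0 => i _; exact: sqr_ge0.
  - by apply: sumr_ge0 => i _; exact: sqr_ge0.
  - rewrite /X /B /Q !mulr_sumr mulr_suml -big_split; apply: ler_sum => i _ /=.
    have c0 : 0 < kappa / 2 by rewrite divr_gt0.
    have := young_sq (a * b i) (U i) c0.
    have -> : (kappa / 2)^-1 * U i ^+ 2 = 2 * (U i ^+ 2 / kappa) by field; rewrite gt_eqF.
    by move: (U i ^+ 2 / kappa) => ?; lra.
  exact: trace_sq_le.
apply: le_trans main.
rewrite -/G -/E -/B -/X -/d.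
apply: le_trans (lerD sumL (lexx _)); rewrite /L !big_split /= -!mulr_sumr.

by rewrite le_eqVlt; apply/orP; left; apply/eqP; ring.
Qed.
End gradient_algebra.

(** * Time derivative of the weighted gradient energy *)

Section gradient_evolution.
Variables (R : realType) (nu kappa gamma T a : R).
Notation V := (R * R * R)%type.
Variables (u : 'I_3 -> V -> R -> R) (th : V -> R -> R).
Variables (tu : 'I_3 -> V -> R -> R) (tth : V -> R -> R).
Hypothesis S : solution nu kappa gamma T u th tu tth.
Let th_gt0 := sol_gt0 S.
Notation G := (gradu2 u).

Ltac sol_leaf := lazymatch goal with
  | |- forall x, @continuous_at _ _ x ?f => lazymatch f with
    | fun x => tth _ _ => exact (sol_tth_cont S)
    | fun x => tu _ _ _ => exact (sol_tu_cont S _)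
    | context [u] => cont_leaf ltac:(fun _ => exact (jC2_cont (sol_u S _)))
        ltac:(fun _ => exact (jC2_dcont (sol_u S _) _))
        ltac:(fun _ => exact (jC2_ddcont (sol_u S _) _ _))
    | context [th] => cont_leaf ltac:(fun _ => exact (jC2_cont (sol_th S)))
        ltac:(fun _ => exact (jC2_dcont (sol_th S) _))
        ltac:(fun _ => exact (jC2_ddcont (sol_th S) _ _))
    end
  | |- forall x, is_true (0 < _) => by move=> ?; exact: th_gt0
  end.

Let w x t := th x t `^ (- a).
Let dw x t := - a * th x t `^ (- a - 1) * tth x t.
(* [\sum_i L i j x s] is the divergence of [w(t) (grad u_j(s) + grad u_j(t))]. *)
Let L t i j x s :=
  - a * th x t `^ (- a - 1) * partial i (th^~ t) x *
    (partial i (u j ^~ s) x + partial i (u j ^~ t) x)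
  + w x t * (partial i (partial i (u j ^~ s)) x + partial i (partial i (u j ^~ t)) x).

Let jcont_cst_time (f : V -> R) : continuous f -> jcont (fun x _ => f x).
Proof. by move=> cf; apply: (@cont_comp _ _ _ fst f); first exact: cont_fst. Qed.

Let cont_thp p t : continuous (fun x => th x t `^ p) :=
  jcont_space t (jcont_th_powR S p).

Let jcont_L t i j : jcont (L t i j).
Proof.
have cu := jC2_C2p (sol_u S j) t; have cth := jC2_C2p (sol_th S) t.
apply: contD; apply: contM.
- apply: (@jcont_cst_time (fun x => - a * th x t `^ (- a - 1) * partial i (th^~ t) x)).
  apply: contM; last by have [[_ _ _ c] _] := cth; exact: c.
  by apply: contM; [exact: cont_cst|exact: cont_thp].
- apply: contD; first exact: (jC2_dcont (sol_u S j) i).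
  by have [[_ _ _ c] _] := cu; exact: (@jcont_cst_time _ (c i)).
- exact: (@jcont_cst_time _ (@cont_thp (- a) t)).
- apply: contD; first exact: (jC2_ddcont (sol_u S j) i i).
  by have [_ c] := cu; have [_ _ _ c'] := c i; exact: (@jcont_cst_time _ (c' i)).
Qed.

Let C1w t : C1p (w^~ t).
Proof.
by apply: (@C1p_powR _ (th^~ t)) => [|x]; [exact: (jC2_C2p (sol_th S) t).1|exact: th_gt0].
Qed.

Let partial_w i x t : partial i (w^~ t) x = - a * th x t `^ (- a - 1) * partial i (th^~ t) x.
Proof.
have [[_ _ d _] _] := jC2_C2p (sol_th S) t.
by apply: partialE; exact: derv_powR (th_gt0 x t) (is_derive_partial (d x i)).
Qed.

Let split_alg (W0 W1 : R) (A B : 'I_3 -> 'I_3 -> R) :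
  W1 * \sum_(i < 3) \sum_(j < 3) A i j ^+ 2 =
  W0 * \sum_(i < 3) \sum_(j < 3) B i j ^+ 2
  + (W1 - W0) * \sum_(i < 3) \sum_(j < 3) A i j ^+ 2
  + \sum_(j < 3) \sum_(i < 3) W0 * (A i j + B i j) * (A i j - B i j).
Proof. by rewrite !big_ord_recl !big_ord0; ring. Qed.

(** The gradient of u need not be differentiable in time. Writing the difference of squares as a
    product of sum and difference and integrating by parts moves the space derivative off the
    increment of u, so that only u and theta are differenced in time. *)
Let energy_split t s : I3 (fun x => w x s * G x s) =
  I3 (fun x => w x t * G x t)
  + I3 (fun x => (w x s - w x t) * G x s)
  - \sum_(j < 3) I3 (fun x => (u j x s - u j x t) * \sum_(i < 3) L t i j x s).
Proof.
have C2u j r := jC2_C2p (sol_u S j) r.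
pose P i j x := w x t * (partial i (u j ^~ s) x + partial i (u j ^~ t) x).
pose v j x := u j x s - u j x t.
have CP i j : C1p (P i j).
  by apply: C1pM; [exact: C1w|apply: C1pD; [exact: (C2u j s).2|exact: (C2u j t).2]].
have Cv j : C1p (v j) by apply: C1pB; [exact: (C2u j s).1|exact: (C2u j t).1].
have pv i j x : partial i (v j) x = partial i (u j ^~ s) x - partial i (u j ^~ t) x.
  have [[_ _ ds _] _] := C2u j s; have [[_ _ dt _] _] := C2u j t.
  exact: (partialE (dervB (is_derive_partial (ds x i)) (is_derive_partial (dt x i)))).
have pP i j x : partial i (P i j) x = L t i j x s.
  have CD := C1pD ((C2u j s).2 i) ((C2u j t).2 i).
  have [_ _ ds _] := (C2u j s).2 i; have [_ _ dt _] := (C2u j t).2 i.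
  rewrite (partialM i x (C1w t) CD) partial_w.
  by rewrite (partialE (dervD (is_derive_partial (ds x i)) (is_derive_partial (dt x i)))).
have cG := jcont_gradu2 S; have cw : jcont w := jcont_th_powR S (- a).
have cs r (f : V -> R -> R) : jcont f -> continuous (f^~ r) by exact: jcont_space.
have c1 : continuous (fun x => w x t * G x t) := contM (cs t _ cw) (cs t _ cG).
have c2 : continuous (fun x => (w x s - w x t) * G x s).
  exact: contM (contB (cs s _ cw) (cs t _ cw)) (cs s _ cG).
have cPv i j : continuous (fun x => P i j x * partial i (v j) x).
  by have [_ cP _ _] := CP i j; have [_ _ _ cv] := Cv j; exact: contM.
have c3 : continuous (fun x => \sum_(j < 3) \sum_(i < 3) P i j x * partial i (v j) x).
  by apply: cont_sum => j; apply: cont_sum => i; exact: cPv.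
transitivity (I3 (fun x => w x t * G x t + (w x s - w x t) * G x s
    + \sum_(j < 3) \sum_(i < 3) P i j x * partial i (v j) x)).
  apply: (eq_mean (I3_mean R)); first exact: contM (cs s _ cw) (cs s _ cG).
    exact: contD (contD c1 c2) c3.
  move=> x _; rewrite /P (eq_bigr _ (fun j _ => eq_bigr _ (fun i _ => congr1 _ (pv i j x)))).
  exact: split_alg.
rewrite (meanD (I3_mean R) (contD c1 c2) c3) (meanD (I3_mean R) c1 c2); congr (_ + _).
rewrite (mean_sum (I3_mean R)); last by move=> j; apply: cont_sum => i; exact: cPv.
rewrite -sumrN; apply: eq_bigr => j _.
rewrite (mean_sum (I3_mean R)); last by move=> i; exact: cPv.
have cvL i : continuous (fun x => (u j x s - u j x t) * L t i j x s).
  by apply: contM; [have [_ c _ _] := Cv j; exact: c|exact: jcont_space s (@jcont_L t i j)].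
transitivity (\sum_(i < 3) - I3 (fun x => (u j x s - u j x t) * L t i j x s)).
  apply: eq_bigr => i _; rewrite I3_parts//; congr (- _).
  apply: (eq_mean (I3_mean R)) => [||x _].
  - have [_ _ _ cP] := CP i j; have [_ cv _ _] := Cv j; exact: contM.
  - exact: cvL.
  - by rewrite pP mulrC.
rewrite sumrN -(mean_sum (I3_mean R))//; congr (- _).
apply: (eq_mean (I3_mean R)) => [||x _].
- by apply: cont_sum => i; exact: cvL.
- apply: contM; first by have [_ c _ _] := Cv j; exact: c.
  by apply: cont_sum => i; exact: jcont_space s (@jcont_L t i j).
- by rewrite mulr_sumr.
Qed.

(** In [energy_split] every nonconstant term is an increment of a differentiable function times a
    factor merely continuous in time, which is the form covered by [is_derive_mean]. At [s = t] the
    two summands in [L] coincide and produce the usual factor 2. *)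
Lemma gradient_energy_derivative t : 0 < t < T ->
  is_derive t 1 (fun s => I3 (fun x => th x s `^ (- a) * G x s))
    (I3 (fun x => - a * th x t `^ (- a - 1) * tth x t * G x t)
     - \sum_(j < 3) I3 (fun x => tu j x t * \sum_(i < 3) L t i j x t)).
Proof.
move=> tT.
have cdw : jcont dw by rewrite /jcont /dw; cont_arith; sol_leaf.
have d1 := @is_derive_mean _ _ _ _ (I3_mean R) (fun p => w p.1 p.2) (fun p => dw p.1 p.2)
  (fun p => G p.1 p.2) 0 T t (jcont_th_powR S (- a)) cdw (jcont_gradu2 S) tT
  (fun x s sT => derv_powR (- a) (th_gt0 x s) (sol_dtth S x sT)).
have d2 j := @is_derive_mean _ _ _ _ (I3_mean R) (fun p => u j p.1 p.2)
  (fun p => tu j p.1 p.2) (fun p => \sum_(i < 3) L t i j p.1 p.2) 0 T t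
  (jC2_cont (sol_u S j)) (sol_tu_cont S j)
  (@cont_sum _ _ _ _ _ _ (fun i => @jcont_L t i j)) tT
  (fun x s sT => sol_dtu S j x sT).
have d3 := dervB (dervD (derv_cst t 1 (I3 (fun x => w x t * G x t))) d1) (derv_sum d2).
apply: (derv_eq d3) => [s|].
  by rewrite (energy_split t s).
by rewrite add0r.
Qed.

Lemma gradient_energy_evolution t : 0 < nu -> 0 < kappa -> nu <= kappa -> 0 < a ->
  a * kappa = nu * (1 - a) -> 2 <= gamma -> 0 < t < T ->
  exists2 d, is_derive t 1 (fun s => I3 (fun x => th x s `^ (- a) * G x s)) d &
    d <= I3 (fun x => th x t `^ (- a - 1) * (- (a * nu / 4) * G x t ^+ 2
      + 36 * a / nu ^+ 3 * th x t ^+ 4 + 1682 / (a * nu ^+ 3) * u2 u x t ^+ 2)).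
Proof.
move=> nu0 kappa0 nk a0 aK gamma2 tT.
eexists; first exact: gradient_energy_derivative tT.
have C2u j := jC2_C2p (sol_u S j) t; have C2th := jC2_C2p (sol_th S) t.
have CG : C1p (G^~ t).
  apply: C1p_sum => i; apply: C1p_sum => j /=; have C := (C2u j).2 i.
  by under eq_fun do rewrite expr2; exact: C1pM.
have Cw := C1w t.
have C1 j k : C1p (fun x => th x t * partial k (u j ^~ t) x).
  exact: (C1pM C2th.1 ((C2u j).2 k)).
have C2 j i : C1p (fun x => w x t * partial i (u j ^~ t) x).
  exact: (C1pM Cw ((C2u j).2 i)).
(* [Z1], the divergence of [F], and [Z2] have mean zero. Adding a kappa [Z1] + 2 nu [Z2] to the
   integrand reduces the claim to the pointwise inequality [gradient_pointwise]. *)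
pose F k x := w x t * G x t * partial k (th^~ t) x.
have CF k : C1p (F k) by apply: C1pM; [exact: C1pM|exact: C2th.2].
pose Z1 x := \sum_(k < 3) partial k (F k) x.
(* Exchanging the outer derivatives d_k and d_i converts a product of divergences into Hessian
   squares. The functions under these derivatives are only C^1, so [I3_partial_swap] is applied. *)
pose z j k i x := partial k (fun x => th x t * partial k (u j ^~ t) x) x *
    partial i (fun x => w x t * partial i (u j ^~ t) x) x
  - partial i (fun x => th x t * partial k (u j ^~ t) x) x *
    partial k (fun x => w x t * partial i (u j ^~ t) x) x.
pose Z2 x := \sum_(j < 3) \sum_(k < 3) \sum_(i < 3) z j k i x.
have dcont (f : V -> R) i : C1p f -> continuous (partial i f) by move=> [_ _ _ c]; exact: c.
have cz1 j k i : continuous (fun x => partial k (fun x => th x t * partial k (u j ^~ t) x) x *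
    partial i (fun x => w x t * partial i (u j ^~ t) x) x).
  exact (contM (dcont _ k (C1 j k)) (dcont _ i (C2 j i))).
have cz2 j k i : continuous (fun x => partial i (fun x => th x t * partial k (u j ^~ t) x) x *
    partial k (fun x => w x t * partial i (u j ^~ t) x) x).
  exact (contM (dcont _ i (C1 j k)) (dcont _ k (C2 j i))).
have cz j k i : continuous (z j k i) := contB (cz1 j k i) (cz2 j k i).
have cZ2 : continuous Z2.
  by apply: cont_sum => j; apply: cont_sum => k; apply: cont_sum => i; exact: cz.
have cZ1 : continuous Z1 by apply: cont_sum => k; exact: dcont.
have Z2_0 : I3 Z2 = 0.
  rewrite (mean_sum (I3_mean R)); last first.
    by move=> j; apply: cont_sum => k; apply: cont_sum => i; exact: cz.
  apply: big1 => j _; rewrite (mean_sum (I3_mean R)); last first.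
    by move=> k; apply: cont_sum => i; exact: cz.
  apply: big1 => k _; rewrite (mean_sum (I3_mean R)); last by move=> i; exact: cz.
  apply: big1 => i _; rewrite (meanB (I3_mean R) (cz1 j k i) (cz2 j k i)).
  apply/eqP; rewrite subr_eq0; apply/eqP.
  exact (I3_partial_swap i k (C1 j k) (C2 j i)).
have Z1_0 : I3 Z1 = 0 := I3_divergence CF.
pose E0 x := - a * th x t `^ (- a - 1) * tth x t * G x t.
pose E1 j x := tu j x t * \sum_(i < 3) L t i j x t.
have cE0 : continuous E0.
  have c1 := jcont_space t (jcont_th_powR S (- a - 1)).
  have c2 := jcont_space t (sol_tth_cont S); have c3 := jcont_space t (jcont_gradu2 S).
  by apply: contM => //; apply: contM => //; apply: contM => //; exact: cont_cst.
have cE1 j : continuous (E1 j).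
  have c1 := jcont_space t (sol_tu_cont S j).
  by apply: contM => //; apply: cont_sum => i; exact: jcont_space t (@jcont_L t i j).
have cE : continuous (fun x => \sum_(j < 3) E1 j x) by apply: cont_sum => j; exact: cE1.
have mD := meanD (I3_mean R); have mB := meanB (I3_mean R); have mZ := meanZ (I3_mean R).
have c1 := contM (@cont_cst R V (a * kappa)) cZ1.
have c2 := contM (@cont_cst R V (2 * nu)) cZ2.
have c3 := contB cE0 cE.
suff : I3 (fun x => E0 x - \sum_(j < 3) E1 j x + a * kappa * Z1 x + 2 * nu * Z2 x) <=
    I3 (fun x => th x t `^ (- a - 1) * (- (a * nu / 4) * G x t ^+ 2
      + 36 * a / nu ^+ 3 * th x t ^+ 4 + 1682 / (a * nu ^+ 3) * u2 u x t ^+ 2)).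
  rewrite (mD _ _ (contD c3 c1) c2) (mD _ _ c3 c1) (mB _ _ cE0 cE) (mZ _ _ cZ1) (mZ _ _ cZ2).
  by rewrite Z1_0 Z2_0 !mulr0 !addr0 (mean_sum (I3_mean R)).
apply: (le_mean (I3_mean R)).
- exact: contD (contD c3 c1) c2.
- have c4 := jcont_space t (jcont_th_powR S (- a - 1)).
  have c5 := jcont_space t (jcont_gradu2 S); have c6 := jcont_space t (jcont_u2 S).
  have c7 := jcont_space t (jC2_cont (sol_th S)).
  have cc := @cont_cst R V.
  by apply: contM => //; apply: contD; [apply: contD|]; apply: contM => //; exact: contX.
move=> x _.
have Hs i k j : partial i (partial k (u j ^~ t)) x = partial k (partial i (u j ^~ t)) x.
  have [[_ _ du _] C] := C2u j; apply: partialC => // l m.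
    by move=> y; have [_ _ d _] := C l; exact: d.
  by have [_ _ _ d] := C l; exact: d.
have q0 : 0 < th x t `^ (- a - 1) by exact: powR_gt0.
have gi12 : 0 <= gamma^-1 <= 1 / 2.
  by rewrite div1r lef_pV2 ?posrE ?gamma2 ?invr_ge0 ?andbT//; lra.
have := @gradient_pointwise R a (th x t `^ (- a - 1)) (th x t) nu kappa gamma^-1
  (fun i => partial i (th^~ t) x) (fun j => u j x t)
  (fun i => partial i (partial i (th^~ t)) x)
  (fun i j => partial i (u j ^~ t) x) (fun k i j => partial k (partial i (u j ^~ t)) x)
  nu0 kappa0 nk a0 aK gi12 q0 Hs.
apply: le_trans.
have wE : w x t = th x t `^ (- a - 1) * th x t.
  by rewrite -[X in _ * X]powRr1 ?(ltW (th_gt0 x t))// -powRD ?subrK//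
    (gt_eqF (th_gt0 x t)) implybT.
have dthE j i k : partial i (fun x => th x t * partial k (u j ^~ t) x) x =
    partial i (th^~ t) x * partial k (u j ^~ t) x
    + th x t * partial i (partial k (u j ^~ t)) x.
  exact: partialM C2th.1 ((C2u j).2 k).
have dwE j i k : partial i (fun x => w x t * partial k (u j ^~ t) x) x =
    - a * th x t `^ (- a - 1) * partial i (th^~ t) x * partial k (u j ^~ t) x
    + th x t `^ (- a - 1) * th x t * partial i (partial k (u j ^~ t)) x.
  by rewrite (partialM i x Cw ((C2u j).2 k)) partial_w wE.
have dG k : partial k (G^~ t) x = \sum_(i < 3) \sum_(j < 3)
    2 * partial i (u j ^~ t) x * partial k (partial i (u j ^~ t)) x.
  apply: partialE.
  apply: (@derv_sum _ _ 3 (fun i y => \sum_(j < 3) partial i (u j ^~ t) y ^+ 2)) => i.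
  apply: (@derv_sum _ _ 3 (fun j y => partial i (u j ^~ t) y ^+ 2)) => j.
  have [_ _ d _] := (C2u j).2 i.
  by have := dervX 2 (is_derive_partial (d x k)); rewrite expr1.
rewrite (_ : Z2 x = \sum_(j < 3) \sum_(k < 3) \sum_(i < 3)
    ((partial k (th^~ t) x * partial k (u j ^~ t) x
        + th x t * partial k (partial k (u j ^~ t)) x) *
      (- a * th x t `^ (- a - 1) * partial i (th^~ t) x * partial i (u j ^~ t) x
        + th x t `^ (- a - 1) * th x t * partial i (partial i (u j ^~ t)) x)
    - (partial i (th^~ t) x * partial k (u j ^~ t) x
        + th x t * partial i (partial k (u j ^~ t)) x) *
      (- a * th x t `^ (- a - 1) * partial k (th^~ t) x * partial i (u j ^~ t) x
        + th x t `^ (- a - 1) * th x t * partial k (partial i (u j ^~ t)) x))); last first.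
  apply: eq_bigr => j _; apply: eq_bigr => k _; apply: eq_bigr => i _.
  by rewrite /z !dthE !dwE.
rewrite lerD2r (_ : Z1 x = \sum_(k < 3)
    ((- a * th x t `^ (- a - 1) * partial k (th^~ t) x * G x t
      + th x t `^ (- a - 1) * th x t * \sum_(i < 3) \sum_(j < 3)
         2 * partial i (u j ^~ t) x * partial k (partial i (u j ^~ t)) x) *
      partial k (th^~ t) x
      + th x t `^ (- a - 1) * th x t * G x t * partial k (partial k (th^~ t)) x)); last first.
  apply: eq_bigr => k _; rewrite (partialM k x (C1pM Cw CG) (C2th.2 k)).
  by rewrite (partialM k x Cw CG) partial_w dG wE.
rewrite lerD2r /E0 (sol_temperature S x tT) lerD2l lerN2 mulr_sumr; apply: ler_sum => j _.
rewrite /E1 (sol_momentum S j x tT).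
rewrite (eq_bigr _ (fun i _ => dthE j i i)).
rewrite (_ : \sum_(i < 3) L t i j x t = 2 * \sum_(i < 3)
  (- a * th x t `^ (- a - 1) * partial i (th^~ t) x * partial i (u j ^~ t) x
   + th x t `^ (- a - 1) * th x t * partial i (partial i (u j ^~ t)) x)).
  by rewrite [leRHS]mulrCA.
rewrite mulr_sumr; apply: eq_bigr => i _; rewrite /L wE.
move: (th x t `^ (- a - 1)) (th x t) (partial i _ x) (partial i _ x) => *; ring.
Qed.

End gradient_evolution.

(** * Interpolation *)

Section powers.
Variable R : realType.

Lemma powR_le1D (x p q : R) : 0 < x -> 0 <= p <= q -> x `^ p <= 1 + x `^ q.
Proof.
move=> x0 /andP[p0 pq]; have [x1|x1] := leP x 1.
  rewrite (@le_trans _ _ 1)//; last by rewrite lerDl powR_ge0.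
  by rewrite -[leRHS](@powRr0 _ x) ger_powR// x0.
by rewrite (@le_trans _ _ (x `^ q)) ?lerDr//; exact: ler_powR (ltW x1) _ _ pq.
Qed.

Lemma sqrt_powR (x p : R) : 0 <= x -> Num.sqrt (x `^ p) = x `^ (p / 2).
Proof. by move=> x0; rewrite -powR12_sqrt ?powR_ge0// -powRrM. Qed.

Lemma powR_exprn (x p : R) n : (x `^ p) ^+ n = x `^ (p * n%:R).
Proof. by rewrite powRrM powR_mulrn// powR_ge0. Qed.

Lemma young34 (x y eta : R) : 0 <= x -> 0 <= y -> 0 < eta ->
  x * y ^+ 3 <= eta * y ^+ 4 + eta ^- 3 * x ^+ 4.
Proof.
move=> x0 y0 eta0; have [xy|/ltW yx] := leP x (eta * y).
  apply: ler_wpDr; first by rewrite mulr_ge0 ?exprn_ge0// invr_ge0 exprn_ge0// ltW.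
  by rewrite (exprS y 3) mulrA ler_wpM2r ?exprn_ge0.
apply: ler_wpDl; first by rewrite mulr_ge0 ?exprn_ge0// ltW.
have -> : eta ^- 3 * x ^+ 4 = x * (x / eta) ^+ 3 by field; rewrite gt_eqF.
apply: ler_wpM2l => //; apply: lerXn2r; rewrite ?nnegrE ?divr_ge0//; first exact: ltW.
by rewrite ler_pdivlMr// mulrC.
Qed.

End powers.

Section interpolation.
Variable R : realType.
Notation V := (R * R * R)%type.
Implicit Types (s G p z : V -> R).

Lemma I3_CS_sqrt (f g : V -> R) : continuous f -> continuous g ->
  (forall x, 0 <= f x) -> (forall x, 0 <= g x) ->
  I3 (fun x => Num.sqrt (f x) * Num.sqrt (g x)) <= Num.sqrt (I3 f) * Num.sqrt (I3 g).
Proof.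
move=> cf cg f0 g0.
have := mean_CS (I3_mean R) (cont_sqrt cf) (cont_sqrt cg).
have -> : (fun x => Num.sqrt (f x) ^+ 2) = f by apply/funext => x; rewrite sqr_sqrtr.
by have -> : (fun x => Num.sqrt (g x) ^+ 2) = g by apply/funext => x; rewrite sqr_sqrtr.
Qed.

Lemma I3_hoelder_powR s (a b c p A B : R) : continuous s -> (forall x, 0 < s x) ->
  0 < p < 1 -> c = a * p + b * (1 - p) -> 0 < A -> 0 < B ->
  I3 (fun x => s x `^ a) <= A -> I3 (fun x => s x `^ b) <= B ->
  I3 (fun x => s x `^ c) <= A `^ p * B `^ (1 - p).
Proof.
move=> cs s0 p01 -> A0 B0 hA hB; have cp q := @cont_powR _ _ s q cs s0.
have E x : s x `^ a `^ p * s x `^ b `^ (1 - p) = s x `^ (a * p + b * (1 - p)).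
  by rewrite -!powRrM powRD// (gt_eqF (s0 x)) implybT.
have <- : (fun x => s x `^ a `^ p * s x `^ b `^ (1 - p)) =
    (fun x => s x `^ (a * p + b * (1 - p))) by exact/funext.
apply: (mean_hoelder (I3_mean R)) => // [|x|x]; try exact: powR_ge0.
exact: (eq_ind_r (fun f : V -> R => continuous f) (cp _) (funext E)).
Qed.

(** [gagliardo_cube] for s^r, with [N] bounding all directions at once. *)
Lemma gagliardo_powR s (r M N : R) : C1p s -> (forall x, 0 < s x) -> 0 <= r ->
  I3 (fun x => s x `^ (2 * r)) <= M ->
  (forall i, I3 (fun x => 2 * r * (s x `^ (2 * r - 1) * `|partial i s x|)) <= N) ->
  I3 (fun x => s x `^ (3 * r)) ^+ 2 <= (M + N) ^+ 3.
Proof.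
move=> Cs s0 r0 hM hN; have [_ cs ds cds] := Cs.
have cp q := @cont_powR _ _ s q cs s0.
have := gagliardo_cube (C1p_powR r Cs s0) (fun x => powR_ge0 _ _).
have -> : (fun x => (s x `^ r) ^+ 3) = (fun x => s x `^ (3 * r)).
  by apply/funext => x; rewrite powR_exprn mulrC.
move/le_trans; apply.
have -> : (M + N) ^+ 3 = \prod_(i < 3) (M + N) by rewrite prodr_const card_ord.
apply: ler_prod => i _.
have E x : (s x `^ r) ^+ 2 + `|2 * s x `^ r * partial i (fun y => s y `^ r) x| =
    s x `^ (2 * r) + 2 * r * (s x `^ (2 * r - 1) * `|partial i s x|).
  rewrite powR_exprn (mulrC r); congr (_ + _).
  rewrite (partialE (derv_powR r (s0 x) (is_derive_partial (ds x i)))).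
  rewrite (_ : 2 * _ * _ = 2 * r * (s x `^ r * s x `^ (r - 1) * partial i s x)); last by ring.
  rewrite -powRD ?(gt_eqF (s0 x)) ?implybT// (_ : r + (r - 1) = 2 * r - 1); last by ring.
  by rewrite normrM (@ger0_norm _ (2 * r)) ?mulr_ge0// normrM (@ger0_norm _ (_ `^ _)) ?powR_ge0.
have -> : (fun x => (s x `^ r) ^+ 2 + `|2 * s x `^ r * partial i (fun y => s y `^ r) x|) =
    (fun x => s x `^ (2 * r) + 2 * r * (s x `^ (2 * r - 1) * `|partial i s x|)) by exact/funext.
have c2 : continuous (fun x => 2 * r * (s x `^ (2 * r - 1) * `|partial i s x|)).
  by apply: contM; [exact: cont_cst|apply: contM => //; exact: cont_norm].
rewrite (meanD (I3_mean R) (cp _) c2) lerD// andbT addr_ge0//.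
  by apply: (mean_ge0 (I3_mean R)) => // x _; exact: powR_ge0.
by apply: (mean_ge0 (I3_mean R)) => // x _; rewrite !mulr_ge0 ?powR_ge0.
Qed.

Lemma powR_interpolation_le (A B p : R) : 1 <= A -> 0 < B -> p <= 1 ->
  A `^ p * B `^ (1 - p) <= A * B `^ (1 - p).
Proof.
move=> A1 B0 p1; rewrite ler_wpM2r ?powR_ge0//.
by rewrite -[leRHS]powRr1 ?(le_trans ler01)// ler_powR.
Qed.

Lemma sqrt_gradient_bound (x g d : R) : 0 <= x -> 0 <= g -> d ^+ 2 <= 4 * x * g ->
  `|d| <= 2 * (x `^ (1 / 2) * Num.sqrt g).
Proof.
move=> x0 g0 dxg; rewrite div1r powR12_sqrt// -sqrtrM//.
have -> : 2 = Num.sqrt (2 ^+ 2 : R) by rewrite sqrtr_sqr ger0_norm.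
by rewrite -sqrtrM ?sqr_ge0// -sqrtr_sqr ler_wsqrtr// (le_trans dxg)// mulrA; lra.
Qed.

(* Here [h = |u|^2 + 1], [p = theta^(-a-1)] and [z = 1 + theta^2]. *)
Lemma I3_sq_bound h G p z (E eta : R) : C1p h -> (forall x, 1 <= h x) ->
  continuous G -> (forall x, 0 <= G x) ->
  (forall i x, partial i h x ^+ 2 <= 4 * h x * G x) ->
  continuous p -> continuous z -> (forall x, 0 <= p x) -> (forall x, 0 <= z x) ->
  (forall x, 1 <= p x * z x) -> 0 < eta -> 1 <= E -> I3 h <= E -> I3 z <= E ->
  I3 (fun x => h x `^ 2) <= eta * I3 (fun x => p x * G x ^+ 2)
    + (4 + 108 ^+ 4 * eta ^- 3) * E ^+ 12.
Proof.
move=> Ch h1 cG G0 dh cp cz p0 z0 pz eta0 E1 hE zE.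
have [_ ch _ cdh] := Ch.
have h0 x : 0 < h x by exact: lt_le_trans (h1 x).
have chp q := @cont_powR _ _ h q ch h0.
have E0 : 0 < E by exact: lt_le_trans E1.
set X := I3 (fun x => h x `^ 2); set P := I3 (fun x => p x * G x ^+ 2).
have P0 : 0 <= P.
  apply: (mean_ge0 (I3_mean R)) => [|x _]; first by apply: contM => //; exact: contX.
  by rewrite mulr_ge0 ?sqr_ge0.
have X1 : 1 <= X.
  rewrite -(mean_cst (I3_mean R) 1); apply: (le_mean (I3_mean R)) => // [|x _].
    exact: cont_cst.
  by rewrite powR_mulrn ?(ltW (h0 x))// exprn_ege1.
have X0 : 0 < X by exact: lt_le_trans X1.
(* Interpolating h^(4/3) and h^(5/3) between h and h^2 costs v and v^2. Gagliardo's inequality then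
   reads v^6 <= (v r)^3 with r = E (1 + 3 rho), so v cancels down to v <= r. *)
pose v := X `^ (1 / 3).
have v1 : 1 <= v by rewrite -(powRr0 X) ler_powR.
have v0 : 0 < v by exact: lt_le_trans v1.
have v3 : v ^+ 3 = X by rewrite powR_exprn mul1r mulVf// powRr1// ltW.
have v2 : X `^ (2 / 3) = v ^+ 2 by rewrite powR_exprn; congr (_ `^ _); lra.
have h1E : I3 (fun x => h x `^ 1) <= E.
  by rewrite (_ : (fun x => _) = h)//; apply/funext => x; rewrite powRr1// ltW.
have M1 : I3 (fun x => h x `^ (4 / 3)) <= E * v.
  apply: (le_trans (@I3_hoelder_powR h 1 2 (4 / 3) (2 / 3) E X ch h0 _ _ _ _ h1E (lexx _))) => //; try lra.
  apply: (le_trans (powR_interpolation_le _ _ _)) => //; try lra.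
  by rewrite /v (_ : 1 - 2 / 3 = 1 / 3)//; lra.
have M2 : I3 (fun x => h x `^ (5 / 3)) <= E * v ^+ 2.
  apply: (le_trans (@I3_hoelder_powR h 1 2 (5 / 3) (1 / 3) E X ch h0 _ _ _ _ h1E (lexx _))) => //; try lra.
  apply: (le_trans (powR_interpolation_le _ _ _)) => //; try lra.
  by rewrite -v2 (_ : 1 - 1 / 3 = 2 / 3)//; lra.
pose rho := Num.sqrt (Num.sqrt P).
have rho0 : 0 <= rho by exact: sqrtr_ge0.
have rho4 : rho ^+ 4 = P by rewrite (exprM rho 2 2) !sqr_sqrtr ?sqrtr_ge0.
have cpG : continuous (fun x => p x * G x ^+ 2) by apply: contM => //; exact: contX.
have cs1 := contM (cont_sqrt cpG) (cont_sqrt cz).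
have N1 i : I3 (fun x => 2 * (2 / 3) * (h x `^ (2 * (2 / 3) - 1) * `|partial i h x|))
    <= 3 * rho * (E * v).
  (* The weight enters here: p z >= 1 gives G <= sqrt (p G^2) sqrt z. Two applications of
     Cauchy-Schwarz produce P^(1/4), which is [rho]. *)
  have N2 : I3 (fun x => Num.sqrt (Num.sqrt (p x * G x ^+ 2) * Num.sqrt (z x)) *
      Num.sqrt (h x `^ (5 / 3))) <= rho * (E * v).
    have nn x : 0 <= Num.sqrt (p x * G x ^+ 2) * Num.sqrt (z x).
      by rewrite mulr_ge0 ?sqrtr_ge0.
    apply: le_trans (I3_CS_sqrt cs1 (chp _) nn (fun x => powR_ge0 _ _)) _.
    have := I3_CS_sqrt cpG cz _ z0 => /(_ (fun x => mulr_ge0 (p0 x) (sqr_ge0 _))) CS.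
    apply: (@le_trans _ _ (Num.sqrt (Num.sqrt P * Num.sqrt E) * Num.sqrt (E * v ^+ 2))).
      rewrite ler_pM ?sqrtr_ge0// ler_wsqrtr//.
      by apply: (le_trans CS); rewrite ler_wpM2l ?sqrtr_ge0// ler_wsqrtr.
    rewrite (@sqrtrM _ (Num.sqrt P)) ?sqrtr_ge0// (@sqrtrM _ E) ?(ltW E0)// -/rho sqrtr_sqr (ger0_norm (ltW v0)).
    rewrite -mulrA ler_wpM2l// mulrA ler_wpM2r ?(ltW v0)//.
    have e1 : 1 <= Num.sqrt E by rewrite -sqrtr1 ler_wsqrtr.
    have e2 : Num.sqrt (Num.sqrt E) <= Num.sqrt E.
      rewrite -[leRHS]ger0_norm ?sqrtr_ge0// -sqrtr_sqr ler_wsqrtr// expr2.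
      by rewrite ler_peMr// sqrtr_ge0.
    apply: (@le_trans _ _ (Num.sqrt E * Num.sqrt E)); first by rewrite ler_wpM2r ?sqrtr_ge0.
    by rewrite -expr2 sqr_sqrtr// ltW.
  rewrite -mulrA; apply: le_trans (_ : _ <= 3 * I3 (fun x => Num.sqrt (Num.sqrt (p x * G x ^+ 2) *
    Num.sqrt (z x)) * Num.sqrt (h x `^ (5 / 3)))) _; last by rewrite ler_pM2l.
  have cs2 := contM (cont_sqrt cs1) (cont_sqrt (chp (5 / 3))).
  rewrite -(meanZ (I3_mean R))//; apply: (le_mean (I3_mean R)).
  - by apply: contM; [exact: cont_cst|apply: contM => //; exact: cont_norm].
  - by apply: contM => //; exact: cont_cst.
  move=> x _; have hx := h0 x.
  have d := sqrt_gradient_bound (ltW hx) (G0 x) (dh i x).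
  apply: (@le_trans _ _ (2 * (2 / 3) * (h x `^ (2 * (2 / 3) - 1) *
     (2 * (h x `^ (1 / 2) * Num.sqrt (G x)))))).
    by rewrite ler_wpM2l ?ler_wpM2l ?powR_ge0//; lra.
  rewrite (_ : _ * _ = 8 / 3 * ((h x `^ (2 * (2 / 3) - 1) * h x `^ (1 / 2)) * Num.sqrt (G x)));
    last by field.
  rewrite -powRD ?(gt_eqF hx) ?implybT// sqrt_powR ?(ltW hx)//.
  rewrite (_ : 2 * (2 / 3) - 1 + 1 / 2 = 5 / 3 / 2); last by field.
  rewrite ler_pM ?mulr_ge0 ?powR_ge0 ?sqrtr_ge0//; first by rewrite ler_pdivrMr//; clear; lra.
  rewrite mulrC ler_wpM2r ?powR_ge0// ler_wsqrtr//.
  rewrite sqrtrM ?p0// sqrtr_sqr (ger0_norm (G0 x)) mulrAC -sqrtrM ?p0//.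
  by rewrite ler_peMl ?G0// -sqrtr1 ler_wsqrtr.
have r0 : (0 : R) <= 2 / 3 by rewrite divr_ge0.
have M3 : I3 (fun x => h x `^ (2 * (2 / 3))) <= E * v.
  by rewrite (_ : 2 * (2 / 3) = 4 / 3)//; field.
have := gagliardo_powR Ch h0 r0 M3 N1; rewrite (_ : 3 * (2 / 3) = 2); last by field.
rewrite -/X.
rewrite (_ : E * v + _ = v * (E * (1 + 3 * rho))); last by ring.
set r := E * (1 + 3 * rho) => H.
have r_ge0 : 0 <= r by rewrite mulr_ge0 ?(ltW E0)// addr_ge0// mulr_ge0.
have {}H : v <= r.
  rewrite -(@ler_pXn2r _ 3) ?nnegrE ?(ltW v0)//.
  by rewrite -(@ler_pM2l _ (v ^+ 3)) ?exprn_gt0// -[leLHS]expr2 -exprMn v3.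
have X_le : X <= r ^+ 3 by rewrite -v3 lerXn2r ?nnegrE ?(ltW v0).
apply: (le_trans X_le); rewrite exprMn.
(* Convexity, (x + y)^3 <= 4 (x^3 + y^3), with 108 = 4 * 27. [young34] for (108 E^3) rho^3 then
   yields 108^4 and E^12. *)
have cube : (1 + 3 * rho) ^+ 3 <= 4 + 108 * rho ^+ 3.
  rewrite -subr_ge0 (_ : _ - _ = 3 * (1 - 3 * rho) ^+ 2 * (1 + 3 * rho)); last by ring.
  apply: mulr_ge0; first by apply: mulr_ge0 => //; exact: sqr_ge0.
  by apply: addr_ge0 => //; exact: mulr_ge0.
apply: (@le_trans _ _ (E ^+ 3 * (4 + 108 * rho ^+ 3))).
  by rewrite ler_wpM2l// exprn_ge0// ltW.
have E12 : E ^+ 3 <= E ^+ 12 by rewrite ler_weXn2l.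
have := @young34 _ (108 * E ^+ 3) rho eta _ rho0 eta0; rewrite rho4 exprMn -exprM.
move=> /(_ (mulr_ge0 (ler0n _ _) (exprn_ge0 _ (ltW E0)))) Y.
clear -Y E12; move: Y E12; move: (108 ^+ 4) (eta ^- 3) (E ^+ 3) (E ^+ 12) (rho ^+ 3).
by move=> b1 b2 b3 b4 b5; lra.
Qed.

(** The exponent 5 gamma / 6 is the one that makes the bound linear in the integral of s^(gamma/2 -
    1) G. Gagliardo's inequality for s^(5 gamma / 18) leaves a gradient term whose Cauchy-Schwarz
    cofactor s^(11 gamma / 18) interpolates with weights 2/3 and 1/3 between s^(gamma/2) and s^(5
    gamma / 6). Linearity is required for absorption into the dissipation of s^(gamma/2). *)
Lemma I3_powR_bound s G (gamma B : R) : C1p s -> (forall x, 0 < s x) ->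
  continuous G -> (forall x, 0 <= G x) ->
  (forall i x, partial i s x ^+ 2 <= 4 * s x * G x) -> 0 <= gamma -> 1 <= B ->
  I3 (fun x => s x `^ (gamma / 2)) <= B ->
  I3 (fun x => s x `^ (5 * gamma / 6)) <=
  8 * B ^+ 2 * (1 + 4 * gamma ^+ 2 * I3 (fun x => s x `^ (gamma / 2 - 1) * G x)).
Proof.
move=> Cs s0 cG G0 ds gamma0 B1 sB; have [_ cs _ cds] := Cs.
have csp q := @cont_powR _ _ s q cs s0.
have B0 : 0 < B by exact: lt_le_trans B1.
set X := I3 (fun x => s x `^ (5 * gamma / 6)).
set g := I3 (fun x => s x `^ (gamma / 2 - 1) * G x).
have g0 : 0 <= g.
  by apply: (mean_ge0 (I3_mean R)) => [|x _]; [exact: contM|rewrite mulr_ge0 ?powR_ge0].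
have X0 : 0 <= X by apply: (mean_ge0 (I3_mean R)) => // x _; exact: powR_ge0.
have X1 : 0 < X + 1 by rewrite ltr_wpDl.
pose v := (X + 1) `^ (1 / 6).
have v1 : 1 <= v by rewrite -(powRr0 (X + 1)) ler_powR ?lerDr.
have v0 : 0 < v by exact: lt_le_trans v1.
have v6 : v ^+ 6 = X + 1 by rewrite powR_exprn mul1r mulVf// powRr1// ltW.
have v2 : (X + 1) `^ (1 / 3) = v ^+ 2 by rewrite powR_exprn; congr (_ `^ _); field.
have XX1 : X <= X + 1 by rewrite lerDl.
have M1 : I3 (fun x => s x `^ (2 * (5 * gamma / 18))) <= B * v.
  apply: (le_trans (@I3_hoelder_powR s (gamma / 2) (5 * gamma / 6) _ (5 / 6) B (X + 1) cs s0
    _ _ _ _ sB XX1)) => //; [by clear; lra|by field|].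
  apply: (le_trans (powR_interpolation_le _ _ _)) => //; first by clear; lra.
  by rewrite /v (_ : 1 - 5 / 6 = 1 / 6)//; field.
have M2 : I3 (fun x => s x `^ (11 * gamma / 18)) <= B * v ^+ 2.
  apply: (le_trans (@I3_hoelder_powR s (gamma / 2) (5 * gamma / 6) _ (2 / 3) B (X + 1) cs s0
    _ _ _ _ sB XX1)) => //; [by clear; lra|by field|].
  apply: (le_trans (powR_interpolation_le _ _ _)) => //; first by clear; lra.
  by rewrite -v2 (_ : 1 - 2 / 3 = 1 / 3)//; field.
have csG : continuous (fun x => s x `^ (gamma / 2 - 1) * G x) by exact: contM.
have N1 i : I3 (fun x => 2 * (5 * gamma / 18) *
    (s x `^ (2 * (5 * gamma / 18) - 1) * `|partial i s x|)) <=
    2 * gamma * Num.sqrt g * (B * v).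
  have N2 : I3 (fun x => Num.sqrt (s x `^ (gamma / 2 - 1) * G x) *
      Num.sqrt (s x `^ (11 * gamma / 18))) <= Num.sqrt g * (B * v).
    apply: le_trans (I3_CS_sqrt csG (csp _) (fun x => mulr_ge0 (powR_ge0 _ _) (G0 x))
      (fun x => powR_ge0 _ _)) _.
    rewrite ler_wpM2l ?sqrtr_ge0//.
    rewrite -[leRHS]ger0_norm ?mulr_ge0 ?(ltW B0) ?(ltW v0)// -sqrtr_sqr ler_wsqrtr//.
    by apply: (le_trans M2); rewrite exprMn ler_wpM2r ?sqr_ge0// expr2 ler_peMl// ltW.
  rewrite -(mulrA (2 * gamma)); apply: le_trans (_ : _ <= 2 * gamma *
    I3 (fun x => Num.sqrt (s x `^ (gamma / 2 - 1) * G x) * Num.sqrt (s x `^ (11 * gamma / 18)))) _;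
    last by rewrite ler_wpM2l// mulr_ge0.
  have cc := contM (cont_sqrt csG) (cont_sqrt (csp (11 * gamma / 18))).
  rewrite -(meanZ (I3_mean R))//; apply: (le_mean (I3_mean R)).
  - by apply: contM; [exact: cont_cst|apply: contM => //; exact: cont_norm].
  - by apply: contM => //; exact: cont_cst.
  move=> x _; have hx := s0 x.
  have d := sqrt_gradient_bound (ltW hx) (G0 x) (ds i x).
  apply: (@le_trans _ _ (2 * (5 * gamma / 18) * (s x `^ (2 * (5 * gamma / 18) - 1) *
     (2 * (s x `^ (1 / 2) * Num.sqrt (G x)))))).
    by rewrite ler_wpM2l ?ler_wpM2l ?powR_ge0// mulr_ge0// divr_ge0// mulr_ge0.
  rewrite (_ : _ * _ = 10 * gamma / 9 * ((s x `^ (2 * (5 * gamma / 18) - 1) *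
    s x `^ (1 / 2)) * Num.sqrt (G x))); last by field.
  rewrite sqrtrM ?powR_ge0// !sqrt_powR ?(ltW hx)// (mulrAC _ (Num.sqrt _)).
  rewrite -!powRD ?(gt_eqF hx) ?implybT//.
  rewrite (_ : (gamma / 2 - 1) / 2 + _ = 2 * (5 * gamma / 18) - 1 + 1 / 2); last by field.
  rewrite ler_wpM2r ?mulr_ge0 ?powR_ge0 ?sqrtr_ge0//.
  by move: gamma0; clear; lra.
have r0 : 0 <= 5 * gamma / 18 by rewrite divr_ge0// mulr_ge0.
have := gagliardo_powR Cs s0 r0 M1 N1.
rewrite (_ : 3 * (5 * gamma / 18) = 5 * gamma / 6); last by field.
rewrite -/X (_ : B * v + _ = v * (B * (1 + 2 * gamma * Num.sqrt g))); last by ring.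
set r := B * _ => H.
have r1 : 1 <= r.
  by rewrite -[leLHS]mulr1 ler_pM// lerDl !mulr_ge0 ?sqrtr_ge0.
have r_ge0 : 0 <= r by exact: le_trans r1.
suff Xr : X <= 4 * r ^+ 2.
  apply: (le_trans Xr); rewrite /r exprMn mulrCA (mulrC 8) -(mulrA (B ^+ 2)) ler_wpM2l ?sqr_ge0//.
  have := sqr_ge0 (1 - 2 * gamma * Num.sqrt g).
  have -> : (1 - 2 * gamma * Num.sqrt g) ^+ 2 = 1 - 4 * gamma * Num.sqrt g + 4 * gamma ^+ 2 * g.
    by rewrite -[X in 4 * gamma ^+ 2 * X](sqr_sqrtr g0); ring.
  have -> : (1 + 2 * gamma * Num.sqrt g) ^+ 2 = 1 + 4 * gamma * Num.sqrt g + 4 * gamma ^+ 2 * g.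
    by rewrite -[X in 4 * gamma ^+ 2 * X](sqr_sqrtr g0); ring.
  by clear; lra.
(* The summand 1 in [v] keeps it positive. For X > 1 one has v^6 <= 2 X, hence v^12 <= 8 (v r)^3 by
   Gagliardo's inequality, and v cancels down to v^3 <= 2 r. *)
have [X_le1|X_gt1] := leP X 1.
  by apply: (le_trans X_le1); rewrite -[leLHS]mulr1 ler_pM ?exprn_ege1//; clear; lra.
have r2 : 0 <= 2 * r by exact: mulr_ge0.
have v9 : v ^+ 3 <= 2 * r.
  rewrite -(@ler_pXn2r _ 3) ?nnegrE ?r2 ?exprn_ge0 ?(ltW v0)//.
  rewrite -(@ler_pM2l _ (v ^+ 3)) ?exprn_gt0//.
  rewrite (_ : v ^+ 3 * _ = (v ^+ 6) ^+ 2); last by ring.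
  rewrite v6 (_ : v ^+ 3 * _ = 8 * (v * r) ^+ 3); last by ring.
  apply: (@le_trans _ _ (8 * X ^+ 2)); last by rewrite ler_pM2l.
  apply: (@le_trans _ _ ((2 * X) ^+ 2)).
    by rewrite lerXn2r ?nnegrE ?mulr_ge0 ?(ltW X1)//; move: X_gt1; clear; lra.
  by have := sqr_ge0 X; rewrite exprMn; move: (X ^+ 2) => ?; clear; lra.
apply: (le_trans XX1); rewrite -v6 (exprM v 3 2) (_ : 4 * _ = (2 * r) ^+ 2); last by ring.
by rewrite lerXn2r ?nnegrE ?r2 ?exprn_ge0 ?(ltW v0).
Qed.

(** Gagliardo's inequality for s^(1 - a/3): the gradient term has the weight s^((1 - a)/2) |d_i s|
    times s^((1 - a/3)/2), so Cauchy-Schwarz yields the square root of the theta dissipation times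
    that of a power of s between 0 and 2. *)
Lemma I3_theta_bound s (a E eta : R) : C1p s -> (forall x, 0 < s x) -> 0 < a <= 1 ->
  0 < eta -> 1 + I3 (fun x => s x `^ 2) <= E ->
  I3 (fun x => s x `^ (3 - a)) <=
  eta * (2 * E + 8 * I3 (fun x => s x `^ (1 - a) * \sum_(i < 3) partial i s x ^+ 2))
    + eta ^- 3 * E ^+ 3.
Proof.
move=> Cs s0 /andP[a0 a1] eta0 sE; have [_ cs _ cds] := Cs.
have csp q := @cont_powR _ _ s q cs s0.
have cG : continuous (fun x => \sum_(i < 3) partial i s x ^+ 2).
  by apply: cont_sum => i; exact: contX.
set Q := I3 (fun x => s x `^ (1 - a) * _).
have cQ : continuous (fun x => s x `^ (1 - a) * \sum_(i < 3) partial i s x ^+ 2) by exact: contM.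
have Q0 : 0 <= Q.
  apply: (mean_ge0 (I3_mean R)) => // x _; rewrite mulr_ge0 ?powR_ge0// sumr_ge0// => i _.
  exact: sqr_ge0.
have E1 : 1 <= E.
  apply: le_trans sE; rewrite lerDl; apply: (mean_ge0 (I3_mean R)) => // x _; exact: powR_ge0.
have le1D q : 0 <= q <= 2 -> I3 (fun x => s x `^ q) <= E.
  move=> q2; apply: le_trans sE.
  rewrite (_ : 1 + _ = I3 (fun x => 1 + s x `^ 2)); last first.
    by rewrite (meanD (I3_mean R) (@cont_cst _ _ 1) (csp 2)) (mean_cst (I3_mean R)).
  apply: (le_mean (I3_mean R)) => // [|x _]; last exact: powR_le1D.
  by apply: contD => //; exact: cont_cst.
set e := Num.sqrt E; set h := Num.sqrt Q.
have e0 : 0 <= e by exact: sqrtr_ge0.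
have h0 : 0 <= h by exact: sqrtr_ge0.
have e2 : e ^+ 2 = E by rewrite sqr_sqrtr// (le_trans ler01).
have h2 : h ^+ 2 = Q by rewrite sqr_sqrtr.
have N1 i : I3 (fun x => 2 * (1 - a / 3) *
    (s x `^ (2 * (1 - a / 3) - 1) * `|partial i s x|)) <= 2 * (h * e).
  have cf : continuous (fun x => s x `^ (1 - a) * partial i s x ^+ 2).
    by apply: contM => //; exact: contX.
  have f0 x : 0 <= s x `^ (1 - a) * partial i s x ^+ 2 by rewrite mulr_ge0 ?powR_ge0 ?sqr_ge0.
  have N2 : I3 (fun x => Num.sqrt (s x `^ (1 - a) * partial i s x ^+ 2) *
      Num.sqrt (s x `^ (1 - a / 3))) <= h * e.
    apply: le_trans (I3_CS_sqrt cf (csp _) f0 (fun x => powR_ge0 _ _)) _.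
    rewrite ler_pM ?sqrtr_ge0// ler_wsqrtr//; last by apply: le1D; move: a0 a1; clear; lra.
    apply: (le_mean (I3_mean R)) => // x _; rewrite ler_wpM2l ?powR_ge0//.
    rewrite (bigD1 i)//= lerDl sumr_ge0// => j _; exact: sqr_ge0.
  apply: le_trans (_ : _ <= 2 * I3 (fun x => Num.sqrt (s x `^ (1 - a) * partial i s x ^+ 2) *
      Num.sqrt (s x `^ (1 - a / 3)))) _; last by rewrite ler_pM2l.
  have cc := contM (cont_sqrt cf) (cont_sqrt (csp (1 - a / 3))).
  rewrite -(meanZ (I3_mean R))//; apply: (le_mean (I3_mean R)).
  - by apply: contM; [exact: cont_cst|apply: contM => //; exact: cont_norm].
  - by apply: contM => //; exact: cont_cst.
  move=> x _; have hx := s0 x.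
  rewrite sqrtrM ?powR_ge0// sqrtr_sqr !sqrt_powR ?(ltW hx)// (mulrAC _ `|_|).
  rewrite -powRD ?(gt_eqF hx) ?implybT//.
  rewrite (_ : (1 - a) / 2 + _ = 2 * (1 - a / 3) - 1); last by field.
  by rewrite ler_wpM2r ?mulr_ge0 ?powR_ge0//; move: a0; clear; lra.
have r0 : 0 <= 1 - a / 3 by move: a1; clear; lra.
have M1 : I3 (fun x => s x `^ (2 * (1 - a / 3))) <= E by apply: le1D; move: a0 a1; clear; lra.
have := gagliardo_powR Cs s0 r0 M1 N1.
rewrite (_ : 3 * (1 - a / 3) = 3 - a); last by field.
set X := I3 _; rewrite -e2 (_ : _ + _ = e * (e + 2 * h)); last by ring.
set r := e + 2 * h => H.
have r_ge0 : 0 <= r by rewrite addr_ge0// mulr_ge0.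
have X0 : 0 <= X by apply: (mean_ge0 (I3_mean R)) => // x _; exact: powR_ge0.
apply: (@le_trans _ _ (eta * r ^+ 2 + eta ^- 3 * e ^+ 6)); last first.
  rewrite -exprM lerD2r ler_pM2l// -h2 -subr_ge0 (_ : _ - _ = (e - 2 * h) ^+ 2); last by rewrite /r; ring.
  exact: sqr_ge0.
(* The square of Gagliardo's bound is X^4 <= (e r)^6 = A^3 B <= (A + B)^4; [eta] cancels in A^3
   B. *)
set A := eta * r ^+ 2; set B := eta ^- 3 * e ^+ 6.
have A0 : 0 <= A by rewrite mulr_ge0 ?sqr_ge0// ltW.
have B0 : 0 <= B by rewrite mulr_ge0 ?exprn_ge0// invr_ge0 exprn_ge0// ltW.
rewrite -(@ler_pXn2r _ 2) ?nnegrE ?addr_ge0//; apply: (le_trans H).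
have AB0 : 0 <= A + B by exact: addr_ge0.
rewrite -(@ler_pXn2r _ 2) ?nnegrE ?exprn_ge0 ?(mulr_ge0 e0 r_ge0)//.
rewrite (_ : _ ^+ 2 = A ^+ 3 * B); last by rewrite /A /B; field; rewrite gt_eqF.
by rewrite -exprM (exprSr _ 3) ler_pM ?exprn_ge0 ?lerDr// lerXn2r ?nnegrE ?AB0// lerDl.
Qed.

End interpolation.

(** * The Lyapunov function *)

Section comparison.
Variable R : realType.
Notation V := (R * R * R)%type.

Lemma cont_I3 (f : V -> R -> R) : jcont f -> continuous (fun t => I3 (f^~ t)).
Proof. exact: (@continuous_mean _ _ _ _ (I3_mean R) _ (fun p => f p.1 p.2)). Qed.

Lemma le_derive_comparison (f g g' : R -> R) (T t : R) : continuous f -> continuous g ->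
  (forall s : R, 0 < s < T -> is_derive s 1 g (g' s)) ->
  (forall s : R, 0 < s < T -> exists2 d : R, is_derive s 1 f d & d <= g' s) ->
  0 <= t <= T -> f t - f 0 <= g t - g 0.
Proof.
move=> cf cg dg df /andP[t0 tT]; rewrite -subr_ge0.
move: t0; rewrite le_eqVlt => /predU1P[<-|t0]; first by rewrite !subrr.
pose h s := g s - f s; have ch : continuous h by exact: contB.
have dh s : 0 < s < T -> is_derive s 1 h ('D_1 h s) /\ 0 <= 'D_1 h s.
  move=> sT; have [d fd dg'] := df s sT; have hd := dervB (dg s sT) fd.
  by rewrite (derv_val hd) subr_ge0.
have sub s : s \in `]0, t[ -> 0 < s < T by rewrite in_itv/= => /andP[-> /lt_le_trans]; apply.
have [s st] := @MVT _ h (fun s => 'D_1 h s) 0 t t0 (fun s st => (dh s (sub s st)).1)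
  (continuous_subspaceT ch).
rewrite /h subr0 => E; rewrite (_ : _ - _ = g t - f t - (g 0 - f 0)); last by ring.
by rewrite E mulr_ge0 ?(ltW t0)//; exact: (dh s (sub s st)).2.
Qed.

Lemma derive_poly_le (f : R -> R) (T t C : R) n : continuous f -> 0 <= C ->
  (forall s : R, 0 < s < T -> exists2 d : R, is_derive s 1 f d & d <= C * (1 + s) ^+ n) ->
  0 <= t <= T -> f t <= f 0 + C * (1 + t) ^+ n.+1.
Proof.
move=> cf C0 df tT.
have c1 : continuous (fun s : R => 1 + s) by apply: contD; [exact: cont_cst|exact: cont_id].
pose g s := C * (1 + s) ^+ n.+1; pose g' s := C * (n.+1%:R * (1 + s) ^+ n * 1).
have cg : continuous g by apply: contM; [exact: cont_cst|exact: contX].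
have dg (s : R) : 0 < s < T -> is_derive s 1 g (g' s).
  move=> sT; have d1 : is_derive s 1 (fun s : R => 1 + s) 1.
    by apply: (derv_eq (dervD (derv_cst s 1 1) (is_derive_id s 1))) => //; exact: add0r.
  exact: dervZ (dervX n.+1 d1).
have df' (s : R) : 0 < s < T -> exists2 d : R, is_derive s 1 f d & d <= g' s.
  move=> sT; have [d fd dC] := df s sT; exists d => //; apply: (le_trans dC).
  rewrite ler_wpM2l// mulr1 ler_peMl ?ler1n// exprn_ge0//.
  by move: sT => /andP[/ltW s0 _]; exact: addr_ge0.
have := le_derive_comparison cf cg dg df' tT.
rewrite lerBlDl => /le_trans; apply; rewrite lerD2l gerBl.
by rewrite mulr_ge0// exprn_ge0// addr0.
Qed.

(** Near a zero of [f] one has f^p <= f. This covers |u|^gamma, whose base may vanish, unlike the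
    regularised one. *)
Lemma cont_powR_ge1 (X : topologicalType) (f : X -> R) p : continuous f ->
  (forall x, 0 <= f x) -> 1 <= p -> continuous (fun x => f x `^ p).
Proof.
move=> cf f0 p1 x; have p_neq0 : p != 0 by rewrite gt_eqF// (lt_le_trans ltr01).
have [fx|fx] := eqVneq (f x) 0; last first.
  apply: (@continuous_comp _ _ _ f (fun y => y `^ p) x (cf x)).
  apply: differentiable_continuous; apply/derivable1_diffP/derivable_powR.
  by rewrite in_itv/= andbT lt0r fx f0.
apply/cvgrPdist_lt => e e0; rewrite fx powR0//.
have e1 : 0 < Num.min e 1 by rewrite lt_min e0 ltr01.
have /cvgrPdist_lt /(_ _ e1) := cf x; apply: filterS => y /=.
rewrite fx !sub0r !normrN !ger0_norm ?powR_ge0// lt_min => /andP[ye y1].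
apply: le_lt_trans ye; have [->|fy] := eqVneq (f y) 0; first by rewrite powR0.
rewrite -[leRHS]powRr1// ger_powR//; first by rewrite (ltW y1) lt0r fy f0.
Qed.

Lemma powR_1D_le (x p : R) : 0 <= x -> 0 <= p -> (x + 1) `^ p <= 2 `^ p * (1 + x `^ p).
Proof.
move=> x0 p0; have [x1|/ltW x1] := leP x 1.
  apply: (@le_trans _ _ (2 `^ p)); last by rewrite ler_peMr ?powR_ge0// lerDl powR_ge0.
  by apply: ge0_ler_powR => //; rewrite ?nnegrE ?addr_ge0//; move: x1; clear; lra.
apply: (@le_trans _ _ ((2 * x) `^ p)).
  by apply: ge0_ler_powR => //; rewrite ?nnegrE ?addr_ge0 ?mulr_ge0//; move: x1; clear; lra.
by rewrite powRM// ler_wpM2l ?powR_ge0// lerDr.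
Qed.

Lemma powRN_le (x m p : R) : 0 < x -> 1 <= m -> 1 <= x * m -> 0 <= p <= 2 ->
  x `^ (- p) <= m ^+ 2.
Proof.
move=> x0 m1 xm /andP[p0 p2]; have m0 : 0 < m by exact: lt_le_trans m1.
apply: (@le_trans _ _ (m `^ p)); last by rewrite -powR_mulrn ?(ltW m0)// ler_powR.
rewrite powRN -[leLHS]mul1r ler_pdivrMr ?powR_gt0// -powRM ?(ltW m0) ?(ltW x0)// mulrC.
apply: (@le_trans _ _ (1 `^ p)); first by rewrite powR1.
by rewrite ge0_ler_powR ?nnegrE ?mulr_ge0 ?(ltW m0) ?(ltW x0).
Qed.

End comparison.

Section constants.
Variables (R : realType) (nu kappa gamma a b e : R).

(* With [tau = 1 + t]: [1 / theta <= mu * tau]; [Bu] bounds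
   [int (|u|^2 + delta)^(gamma / 2)]; [Lam * tau] is its weight in the energy,
   whose derivative is at most [KW * tau], and [W0] bounds the initial energy;
   [KE * tau ^+ 2] bounds [1 + energy]; [c_theta] and [c_velocity] are the
   constants of [gradient_energy_evolution], [K1] comes from [I3_sq_bound] and
   [KPhi] from the final Lyapunov function.  Only [b] and [e], bounds for
   [int |u0|^gamma] and [int theta0^2], involve the initial data. *)
Definition mu := 1 + 3 / (8 * nu).
Definition Bu := 2 `^ (gamma / 2) * (1 + b) + 1.
Definition Lam := (3 + 32 * Bu ^+ 2 * gamma ^+ 2) * mu / (nu * gamma).
Definition Ku := 1 + 8 * Bu ^+ 2 + 3 / (2 * nu) * mu * (1 + Bu).
Definition KW := Ku + Lam * (1 + Bu).
Definition W0 := e + 4 + 2 * b + Lam * Bu.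
Definition KE := W0 + KW + 2.
Definition c_theta := 36 * a / nu ^+ 3.
Definition c_velocity := 1682 / (a * nu ^+ 3).
Definition K1 := c_velocity * mu ^+ 2 * (4 + 108 ^+ 4 * (4 * c_velocity * mu ^+ 2 / (a * nu)) ^+ 3) * KE ^+ 12.
(** The total coefficient of the integral of theta^(3-a): [c_theta] from the weighted gradient
    energy and a / 4 from the power theta^(2-a). *)
Definition cV := c_theta + a / 4.
Definition KPhi := a * kappa / 4 * KE + cV * (8 * cV / (a * kappa)) ^+ 3 * KE ^+ 3
  + K1 + a / 4 + (1 + a / nu) * KW.
Definition growth_constant := (1 + a / nu) * W0 + 1 + KPhi.

End constants.

(** * Bounds for powers of the velocity *)

Section velocity_bound.
Variables (R : realType) (nu kappa gamma T b : R).
Notation V := (R * R * R)%type.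
Variables (u : 'I_3 -> V -> R -> R) (th : V -> R -> R).
Variables (tu : 'I_3 -> V -> R -> R) (tth : V -> R -> R).
Hypotheses (nu0 : 0 < nu) (kappa0 : 0 < kappa) (gamma2 : 2 <= gamma) (T0 : 0 < T).
Hypothesis S : solution nu kappa gamma T u th tu tth.
Hypothesis th1 : forall x, 1 <= th x 0.
Hypothesis u0b : I3 (fun x => u2 u x 0 `^ (gamma / 2)) <= b.
Let th_gt0 := sol_gt0 S.
Notation G := (gradu2 u).

Lemma mu_gt1 : 1 <= mu nu.
Proof. by rewrite lerDl divr_ge0// mulr_ge0// ltW. Qed.

Lemma theta_lower_linear x t : 0 <= t <= T -> 1 <= th x t * (mu nu * (1 + t)).
Proof.
move=> tT; apply: le_trans (temperature_lower_bound nu0 kappa0 T0 S th1 x tT) _.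
rewrite ler_wpM2l ?(ltW (th_gt0 x t))//; move: tT => /andP[t0 _].
have c0 : 0 <= 3 / (8 * nu) by rewrite divr_ge0// mulr_ge0// ltW.
by rewrite /mu; move: (3 / _) c0 => c c0; rewrite mulrDl mul1r mulrDr mulr1; move: c0 t0; lra.
Qed.

Lemma gradu2_ge0 x t : 0 <= G x t.
Proof. by apply: sumr_ge0 => i _; apply: sumr_ge0 => j _; exact: sqr_ge0. Qed.

Lemma divu_sq x t : divu u x t ^+ 2 <= 3 * G x t.
Proof. exact: trace_sq_le (fun i j => partial i (u j ^~ t) x). Qed.

Lemma u2_ge0 x t : 0 <= u2 u x t.
Proof. by apply: sumr_ge0 => j _; exact: sqr_ge0. Qed.

Lemma partial_sreg_sq (delta : R) i x t : 0 < delta ->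
  partial i (sreg u delta ^~ t) x ^+ 2 <= 4 * sreg u delta x t * G x t.
Proof.
move=> d0; rewrite (partialE (is_derive_sreg S delta x t i)) exprMn.
rewrite (_ : 2 ^+ 2 = 4); last by ring.
rewrite -mulrA ler_pM2l//; apply: (le_trans (cauchy_schwarz3 _ _)).
apply: ler_pM.
- exact: u2_ge0.
- by apply: sumr_ge0 => j _; exact: sqr_ge0.
- by rewrite lerDl ltW.
rewrite /gradu2 [leRHS](bigD1 i)//= lerDl.
by apply: sumr_ge0 => k _; apply: sumr_ge0 => j _; exact: sqr_ge0.
Qed.

(** For delta <= 1 the integrand is dominated by the one for delta = 1, since gamma / 2 - 1 >= 0,
    and the latter has bounded mean on the compact time interval. This [delta] depends on the
    solution and on [T]; later constants do not, because only positivity, delta <= 1 and this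
    inequality are passed on. *)
Lemma regularization_parameter : exists2 delta, 0 < delta <= 1 & forall t, 0 <= t <= T ->
  (1 + T) * (delta * I3 (fun x => sreg u delta x t `^ (gamma / 2 - 1) * divu u x t)) <= 1.
Proof.
pose f x t := sreg u 1 x t `^ (gamma / 2 - 1) * `|divu u x t|.
have cf : jcont f by apply: contM; [exact (jcont_sreg_powR S (@ltr01 R) (gamma / 2 - 1))|exact (cont_norm (jcont_divu S))].
have [M fM] := cont_bounded_compact (@segment_compact R 0 T) (cont_I3 cf).
have M0 : 0 < 1 + `|M| by rewrite ltr_wpDr.
have T1 : 0 < 1 + T by rewrite addr_gt0.
pose delta := ((1 + T) * (1 + `|M|))^-1.
have d0 : 0 < delta by rewrite invr_gt0 mulr_gt0.
exists delta => [|t tT].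
  rewrite d0 invf_le1 ?mulr_gt0// -[leLHS]mulr1 ler_pM//; first by rewrite lerDl ltW.
  by rewrite lerDl.
have d1 : delta <= 1.
  rewrite invf_le1 ?mulr_gt0// -[leLHS]mulr1 ler_pM//; first by rewrite lerDl ltW.
  by rewrite lerDl.
rewrite mulrA (_ : (1 + T) * delta = (1 + `|M|)^-1); last first.
  by rewrite /delta; field; rewrite !gt_eqF.
rewrite ler_pdivrMl// mulr1; apply: (@le_trans _ _ `|M|); last by rewrite lerDr.
apply: (@le_trans _ _ M); last exact: ler_norm.
apply: (@le_trans _ _ (I3 (f^~ t))); last first.
  apply: le_trans (ler_norm _) _; apply: fM.
  by rewrite /= in_itv.
apply: (le_mean (I3_mean R)).
- by apply: contM; [exact (jcont_space t (jcont_sreg_powR S d0 (gamma / 2 - 1)))|exact (jcont_space t (jcont_divu S))].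
- exact: jcont_space t cf.
move=> x _; apply: (@le_trans _ _ (sreg u delta x t `^ (gamma / 2 - 1) * `|divu u x t|)).
  by rewrite ler_wpM2l ?powR_ge0// ler_norm.
rewrite ler_wpM2r// ge0_ler_powR ?nnegrE ?(ltW (sreg_gt0 _ _ _ _))//.
- by move: gamma2; lra.
- by rewrite lerD2l.
Qed.

Section regularized.
Variable delta : R.
Hypotheses (d0 : 0 < delta) (d1 : delta <= 1).
Hypothesis dT : forall t, 0 <= t <= T ->
  (1 + T) * (delta * I3 (fun x => sreg u delta x t `^ (gamma / 2 - 1) * divu u x t)) <= 1.
Notation s := (sreg u delta).
Let s_gt0 := sreg_gt0 u d0.
Let cs p t : continuous (fun x => s x t `^ p) := jcont_space t (jcont_sreg_powR S d0 p).
Let cG t : continuous (G^~ t) := jcont_space t (jcont_gradu2 S).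
Let cd t : continuous (divu u ^~ t) := jcont_space t (jcont_divu S).
Let cth t : continuous (th^~ t) := jcont_space t (jC2_cont (sol_th S)).
Let B := Bu gamma b.

Definition dissipation t := I3 (fun x => th x t * G x t).
Definition weighted_dissipation t :=
  I3 (fun x => th x t * (s x t `^ (gamma / 2 - 1) * G x t)).
Definition velocity_power t := I3 (fun x => s x t `^ (gamma / 2)).

Let csG t : continuous (fun x => s x t `^ (gamma / 2 - 1) * G x t) := contM (@cs _ t) (@cG t).

Lemma dissipation_ge0 t : 0 <= dissipation t.
Proof.
apply: (mean_ge0 (I3_mean R)) => [|x _]; first exact (contM (@cth t) (@cG t)).
by rewrite mulr_ge0 ?gradu2_ge0// ltW// th_gt0.
Qed.

Lemma weighted_dissipation_ge0 t : 0 <= weighted_dissipation t.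
Proof.
apply: (mean_ge0 (I3_mean R)) => [|x _]; first exact (contM (@cth t) (@csG t)).
by rewrite !mulr_ge0 ?powR_ge0 ?gradu2_ge0// ltW// th_gt0.
Qed.

Lemma Bu_ge1 : 0 <= b -> 1 <= B.
Proof. by move=> b0; rewrite lerDr mulr_ge0 ?powR_ge0// addr_ge0. Qed.

Lemma velocity_power_evolution_gamma t : 0 < t < T ->
  exists2 d, is_derive t 1 velocity_power d &
    d <= delta * I3 (fun x => s x t `^ (gamma / 2 - 1) * divu u x t)
      - nu * gamma * weighted_dissipation t.
Proof.
move=> tT; have g1 : 1 <= gamma / 2 by rewrite ler_pdivlMr// mul1r.
have [d dd dle] := velocity_power_evolution nu0 S d0 g1 tT.
exists d => //; apply: (le_trans dle).
have g0 : gamma != 0 by rewrite gt_eqF// (lt_le_trans _ gamma2).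
have -> : 1 - 2 * (gamma / 2) / gamma = 0 by field.
have -> : 2 * (gamma / 2) * delta / gamma = delta by field.
have -> : 2 * nu * (gamma / 2) = nu * gamma by field.
by rewrite mul0r add0r.
Qed.

Lemma velocity_power0 : velocity_power 0 <= B - 1.
Proof.
have c0 : continuous (fun x => u2 u x 0 `^ (gamma / 2)).
  apply: cont_powR_ge1; [exact (jcont_space 0 (jcont_u2 S))|by move=> x; exact: u2_ge0|].
  by rewrite ler_pdivlMr// mul1r.
have g0 : 0 <= gamma / 2 by rewrite divr_ge0// (le_trans _ gamma2).
apply: (@le_trans _ _ (I3 (fun x => 2 `^ (gamma / 2) * (1 + u2 u x 0 `^ (gamma / 2))))).
  apply: (le_mean (I3_mean R)); first exact: cs.
    by apply: contM; [exact: cont_cst|apply: contD => //; exact: cont_cst].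
  move=> x _; apply: le_trans (powR_1D_le (u2_ge0 x 0) g0).
  by rewrite ge0_ler_powR ?nnegrE ?addr_ge0 ?u2_ge0 ?(ltW d0)// lerD2l.
rewrite (meanZ (I3_mean R)); last by apply: contD => //; exact: cont_cst.
rewrite (meanD (I3_mean R) (@cont_cst _ _ 1) c0) (mean_cst (I3_mean R)).
by rewrite /B /Bu addrK ler_wpM2l ?powR_ge0// lerD2l.
Qed.

Lemma cont_velocity_power : continuous velocity_power.
Proof. exact (cont_I3 (jcont_sreg_powR S d0 (gamma / 2))). Qed.

(** The regularisation error contributes at most t / (1 + T) <= 1, which is the gap left in
    [velocity_power0]. *)
Lemma velocity_power_le t : 0 <= t <= T -> velocity_power t <= B.
Proof.
move=> tT; have T1 : 0 < 1 + T by rewrite addr_gt0.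
have dg (r : R) : 0 < r < T -> is_derive r 1 (fun r => (1 + T)^-1 * r) (1 + T)^-1.
  move=> _; apply: (derv_eq (dervZ (1 + T)^-1 (is_derive_id r 1))) => //; exact: mulr1.
have cg : continuous (fun r => (1 + T)^-1 * r).
  by apply: contM; [exact: cont_cst|exact: cont_id].
have dY (r : R) : 0 < r < T ->
    exists2 d : R, is_derive r 1 velocity_power d & d <= (1 + T)^-1.
  move=> rT; have [d dd dle] := velocity_power_evolution_gamma rT.
  exists d => //; apply: (le_trans dle).
  have rT' : 0 <= r <= T by move: rT => /andP[/ltW-> /ltW].
  apply: (@le_trans _ _ (delta * I3 (fun x => s x r `^ (gamma / 2 - 1) * divu u x r))).
    rewrite gerBl mulr_ge0 ?weighted_dissipation_ge0// mulr_ge0 ?(ltW nu0)//.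
    exact: le_trans gamma2.
  by rewrite -[leRHS]mulr1 ler_pdivlMl//; exact: dT.
have := le_derive_comparison cont_velocity_power cg dg dY tT.
have := velocity_power0; rewrite mulr0 subr0.
have : (1 + T)^-1 * t <= 1.
  by rewrite ler_pdivrMl// mulr1; move: tT => /andP[_ /le_trans->]//; rewrite lerDr.
by move: (_ * t) (velocity_power t) (velocity_power 0) B => ? ? ? ?; lra.
Qed.

Let Fbound t : 0 <= t <= T ->
  I3 (fun x => s x t `^ (gamma / 2 - 1) * G x t) <= mu nu * (1 + t) * weighted_dissipation t.
Proof.
move=> tT; rewrite -(meanZ (I3_mean R)); last exact (contM (@cth t) (@csG t)).
apply: (le_mean (I3_mean R)); first exact: csG.
  by apply: contM; [exact: cont_cst|exact (contM (@cth t) (@csG t))].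
move=> x _; rewrite mulrA (mulrC _ (th x t)) ler_peMl ?theta_lower_linear//.
by rewrite mulr_ge0 ?powR_ge0 ?gradu2_ge0.
Qed.

Lemma Lam_ge0 : 0 <= Lam nu gamma b.
Proof.
have m0 : 0 <= mu nu by exact: le_trans mu_gt1.
rewrite /Lam divr_ge0 ?mulr_ge0 ?(ltW nu0) ?(le_trans _ gamma2)//.
by apply: addr_ge0 => //; apply: mulr_ge0; [apply: mulr_ge0 => //|]; exact: sqr_ge0.
Qed.

(** Three regimes. For gamma = 2 the left side vanishes. For gamma >= 4, Young's inequality against
    theta |grad u|^2 leaves s^2 / theta, and s^2 <= 1 + s^(gamma/2). In between, s div u is split
    against s^(gamma/2 - 1) |grad u|^2; the remainder is treated by [I3_powR_bound] and the result
    absorbed by the weighted dissipation, for which [Lam] is large enough by definition. *)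
Lemma momentum_bound t : 0 <= b -> gamma = 2 \/ 9 / 4 <= gamma -> 0 <= t <= T ->
  2 * (1 - 2 / gamma) * I3 (fun x => s x t * divu u x t) <=
  2 * nu * dissipation t + nu * gamma * (Lam nu gamma b * (1 + t)) * weighted_dissipation t
    + Ku nu gamma b * (1 + t).
Proof.
move=> b0 gam tT; have [t0 _] := andP tT.
have B1 := Bu_ge1 b0; have B0 : 0 <= B by exact: le_trans B1.
have t1 : 1 <= 1 + t by rewrite lerDl.
have m1 := mu_gt1; have m0 : 0 <= mu nu by exact: le_trans m1.
have tau0 : 0 <= 1 + t by exact: le_trans t1.
have g0 : 0 < gamma by exact: lt_le_trans gamma2.
have F0 := dissipation_ge0 t; have Gq0 := weighted_dissipation_ge0 t.
have YB := velocity_power_le tT.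
have Lam0 : 0 <= nu * gamma * (Lam nu gamma b * (1 + t)) * weighted_dissipation t.
  apply: mulr_ge0 => //; apply: mulr_ge0; first by rewrite mulr_ge0 ?(ltW nu0) ?(ltW g0).
  exact: mulr_ge0 Lam_ge0 _.
have c1 : continuous (fun x => s x t * divu u x t).
  exact (contM (jcont_space t (jcont_sreg S delta)) (@cd t)).
have c2 : continuous (fun x => s x t * `|divu u x t|).
  exact (contM (jcont_space t (jcont_sreg S delta)) (cont_norm (@cd t))).
set Kt := Ku nu gamma b * (1 + t).
have i0 : 0 <= 3 / (2 * nu) by rewrite divr_ge0// mulr_ge0 ?(ltW nu0).
have p1 : 0 <= 1 + 8 * B ^+ 2 by apply: addr_ge0 => //; apply: mulr_ge0 => //; exact: sqr_ge0.
have p2 : 0 <= 3 / (2 * nu) * mu nu * (1 + B).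
  by apply: mulr_ge0; [exact: mulr_ge0|exact: addr_ge0].
have Ku1 : 1 + 8 * B ^+ 2 <= Kt.
  rewrite -[leLHS]mulr1; by apply: ler_pM => //; rewrite /Ku lerDl.
have Ku2 : 3 / (2 * nu) * (mu nu * (1 + t)) * (1 + B) <= Kt.
  rewrite (_ : _ * (1 + B) = 3 / (2 * nu) * mu nu * (1 + B) * (1 + t)); last by ring.
  by apply: ler_wpM2r => //; rewrite /Ku lerDr.
have Kt0 : 0 <= Kt by exact: le_trans Ku1.
have [gam2|gam2] := eqVneq gamma 2.
  rewrite [X in 2 / X]gam2 (_ : 2 * (1 - 2 / 2) = 0) ?mul0r; last by field.
  by do 2?apply: addr_ge0 => //; apply: mulr_ge0 => //; rewrite mulr_ge0 ?(ltW nu0).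
have gam94 : 9 / 4 <= gamma by case: gam => // E; rewrite E eqxx in gam2.
have cF : continuous (fun x => th x t * G x t) := contM (@cth t) (@cG t).
apply: (@le_trans _ _ (I3 (fun x => 2 * (s x t * `|divu u x t|)))).
  rewrite (meanZ (I3_mean R))// -mulrA ler_pM2l//.
  have k01 : 0 <= 1 - 2 / gamma <= 1.
    by rewrite subr_ge0 ler_pdivrMr// mul1r gamma2 gerBl divr_ge0// ltW.
  have J0 : 0 <= I3 (fun x => s x t * `|divu u x t|).
    by apply: (mean_ge0 (I3_mean R)) => // x _; rewrite mulr_ge0// ltW.
  have IJ : I3 (fun x => s x t * divu u x t) <= I3 (fun x => s x t * `|divu u x t|).
    by apply: (le_mean (I3_mean R)) => // x _; rewrite ler_wpM2l ?(ltW (s_gt0 _ _))// ler_norm.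
  case/andP: k01 => k0 k1; apply: (le_trans (ler_wpM2l k0 IJ)).
  by rewrite ler_piMl.
have c3 : continuous (fun x => 2 * (s x t * `|divu u x t|)).
  by apply: contM => //; exact: cont_cst.
have cc := @cont_cst R V.
have [gam4|gam4] := leP 4 gamma.
  apply: (@le_trans _ _ (I3 (fun x => 2 * nu * (th x t * G x t)
      + 3 / (2 * nu) * (mu nu * (1 + t)) * (1 + s x t `^ (gamma / 2))))).
    apply: (le_mean (I3_mean R)) => //.
      by apply: contD; apply: contM => //; apply: contD.
    move=> x _; have th0 := th_gt0 x t.
    have cpos : 0 < 2 * nu * th x t / 3 by rewrite divr_gt0// mulr_gt0// mulr_gt0.
    have := young_sq `|divu u x t| (s x t) cpos.
    rewrite real_normK ?num_real// -mulrA (mulrC `|_|) => /le_trans; apply.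
    apply: lerD.
      rewrite (_ : 2 * nu * (_ * _) = 2 * nu * th x t / 3 * (3 * G x t)); last by field.
      by rewrite ler_pM2l//; exact: divu_sq.
    apply: ler_pM; rewrite ?sqr_ge0 ?invr_ge0 ?(ltW cpos)//.
      rewrite (_ : (2 * nu * th x t / 3)^-1 = 3 / (2 * nu) * (th x t)^-1); last by field; rewrite !gt_eqF.
      rewrite ler_wpM2l// -[leLHS]mul1r ler_pdivrMr// mulrC.
      exact: theta_lower_linear.
    rewrite -powR_mulrn ?(ltW (s_gt0 _ _))//; apply: powR_le1D => //.
    by rewrite ler0n ler_pdivlMr//; move: gam4; lra.
  have cc1 : continuous (fun x => 1 + s x t `^ (gamma / 2)) by apply: contD.
  rewrite (meanD (I3_mean R)); [|exact (contM (cc _) cF)|exact (contM (cc _) cc1)].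
  rewrite !(meanZ (I3_mean R))// (meanD (I3_mean R) (cc 1) (@cs _ t)) (mean_cst (I3_mean R)).
  rewrite -addrA lerD2l (le_trans _ (_ : Kt <= _)) ?lerDr//.
  apply: le_trans Ku2; apply: ler_wpM2l; last by rewrite lerD2l.
  by apply: mulr_ge0 => //; exact: mulr_ge0.
set g := I3 (fun x => s x t `^ (gamma / 2 - 1) * G x t).
apply: (@le_trans _ _ (I3 (fun x => 3 * (s x t `^ (gamma / 2 - 1) * G x t)
    + (1 + s x t `^ (5 * gamma / 6))))).
  apply: (le_mean (I3_mean R)) => //.
    by apply: contD; [apply: contM|apply: contD].
  move=> x _; have s0 := s_gt0 x t.
  have cpos : 0 < s x t `^ (gamma / 2 - 1) by exact: powR_gt0.
  have := young_sq `|divu u x t| (s x t) cpos.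
  rewrite real_normK ?num_real// -mulrA (mulrC `|_|) => /le_trans; apply.
  apply: lerD.
    by rewrite (mulrCA 3) ler_pM2l//; exact: divu_sq.
  (* Young's inequality leaves s^(3 - gamma/2), and 3 - gamma/2 <= 5 gamma / 6 means gamma >=
     9/4. *)
  rewrite -powRN -powR_mulrn ?(ltW s0)// -powRD ?(gt_eqF s0) ?implybT//.
  apply: powR_le1D => //; move: gam94 gam4; lra.
rewrite (meanD (I3_mean R)); [|exact (contM (cc _) (@csG t))|exact (contD (cc _) (@cs _ t))].
rewrite (meanZ (I3_mean R))// (meanD (I3_mean R) (cc 1) (@cs _ t)) (mean_cst (I3_mean R)) -/g.
have VB := @I3_powR_bound R (s^~ t) (G^~ t) gamma B (C1p_sreg S delta t) (s_gt0^~ t) (@cG t)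
  (fun x => gradu2_ge0 x t) (fun i x => partial_sreg_sq i x t d0) (ltW g0) B1 YB.
have gF := Fbound tT.
have H : (3 + 32 * B ^+ 2 * gamma ^+ 2) * g <=
    nu * gamma * (Lam nu gamma b * (1 + t)) * weighted_dissipation t.
  rewrite (_ : nu * gamma * (_ * _) * _ = (3 + 32 * B ^+ 2 * gamma ^+ 2) *
    (mu nu * (1 + t) * weighted_dissipation t)); last first.
    by rewrite /Lam -/B; field; rewrite !gt_eqF.
  apply: ler_wpM2l => //; apply: addr_ge0 => //.
  by apply: mulr_ge0; [apply: mulr_ge0 => //|]; exact: sqr_ge0.
have F2 : 0 <= 2 * nu * dissipation t by rewrite mulr_ge0// mulr_ge0// ltW.
apply: (@le_trans _ _ (3 * g + (1 + 8 * B ^+ 2 * (1 + 4 * gamma ^+ 2 * g)))).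
  by rewrite lerD2l lerD2l.
rewrite (_ : _ + _ = (3 + 32 * B ^+ 2 * gamma ^+ 2) * g + (1 + 8 * B ^+ 2)); last by ring.
apply: lerD => //; by apply: (le_trans H); rewrite lerDr.
Qed.

End regularized.
End velocity_bound.

(** * Growth of the energy and of the weighted gradient *)

Section energy.
Variables (R : realType) (nu kappa gamma T a b e : R).
Notation V := (R * R * R)%type.
Variables (u : 'I_3 -> V -> R -> R) (th : V -> R -> R).
Variables (tu : 'I_3 -> V -> R -> R) (tth : V -> R -> R).
Hypotheses (nu0 : 0 < nu) (kappa0 : 0 < kappa) (gamma2 : 2 <= gamma) (T0 : 0 < T).
Hypothesis gam : gamma = 2 \/ 9 / 4 <= gamma.
Hypotheses (nk : nu <= kappa) (a0 : 0 < a) (a1 : a <= 1) (aK : a * kappa = nu * (1 - a)).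
Hypothesis S : solution nu kappa gamma T u th tu tth.
Hypothesis th1 : forall x, 1 <= th x 0.
Hypotheses (b0 : 0 <= b) (u0b : I3 (fun x => u2 u x 0 `^ (gamma / 2)) <= b).
Hypotheses (e0 : 0 <= e) (th0e : I3 (fun x => th x 0 `^ 2) <= e).
Variable delta : R.
Hypotheses (d0 : 0 < delta) (d1 : delta <= 1).
Hypothesis dT : forall t, 0 <= t <= T ->
  (1 + T) * (delta * I3 (fun x => sreg u delta x t `^ (gamma / 2 - 1) * divu u x t)) <= 1.
Let th_gt0 := sol_gt0 S.
Notation G := (gradu2 u).
Notation s := (sreg u delta).
Notation F := (dissipation u th).
Notation Y := (velocity_power gamma u delta).
Let s_gt0 := sreg_gt0 u d0.
Let B := Bu gamma b.
Let L := Lam nu gamma b.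
Let L0 : 0 <= L := Lam_ge0 b nu0 gamma2.
Let YB t := @velocity_power_le _ _ _ _ _ _ _ _ _ _ nu0 gamma2 T0 S u0b _ d0 d1 dT t.
Let cs t : continuous (s^~ t) := jcont_space t (jcont_sreg S delta).
Let cG t : continuous (G^~ t) := jcont_space t (jcont_gradu2 S).
Let cd t : continuous (divu u ^~ t) := jcont_space t (jcont_divu S).
Let cth t : continuous (th^~ t) := jcont_space t (jC2_cont (sol_th S)).
Let cthp p t : continuous (fun x => th x t `^ p) := jcont_space t (jcont_th_powR S p).

(* [int theta^2 + 2 int s] is dissipated up to the transport term
   [int s div u], which for [gamma < 4] is not controlled by
   [int theta |grad u|^2] and calls for the last summand. *)
Definition energy t :=
  I3 (fun x => th x t `^ 2) + 2 * I3 (s^~ t) + L * (1 + t) * Y t.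

(** Balance of the dissipation F: heating of theta^2 produces nu F, twice the velocity energy loses
    4 nu F, and [momentum_bound] takes back 2 nu F, so - nu F remains. For q = 1 the regularisation
    term is the mean of div u, hence zero; the growth of the weight of [Y] costs at most [L * B]. *)
Lemma energy_evolution t : 0 < t < T -> exists2 d, is_derive t 1 energy d &
  d <= - nu * F t + KW nu gamma b * (1 + t).
Proof.
move=> tT; have tT' : 0 <= t <= T by move: tT => /andP[/ltW-> /ltW].
have [t0 tleT] := andP tT'.
have dth := theta_power_evolution S 2 tT.
have [d2 ds d2le] := velocity_power_evolution nu0 S d0 (lexx 1) tT.
have [d3 dY d3le] := velocity_power_evolution_gamma nu0 gamma2 S d0 tT.
have {}ds : is_derive t 1 (fun r => I3 (s^~ r)) d2.
  apply: (derv_eq ds) => // r; rewrite (_ : (fun x => s x r `^ 1) = s^~ r)//.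
  by apply/funext => x; rewrite powRr1// ltW.
have dlam : is_derive t 1 (fun r : R => L * (1 + r)) L.
  apply: (derv_eq (dervZ L (dervD (derv_cst t 1 (1 : R)) (is_derive_id t 1)))) => //.
  by rewrite add0r mulr1.
eexists; first exact: dervD (dervD dth (dervZ 2 ds)) (dervM dlam dY).
rewrite (_ : 2 - 2 = 0) ?subrr// mulr0 !mul0r add0r addr0.
have -> : (fun x => th x t `^ (2 - 1) * G x t) = (fun x => th x t * G x t).
  apply/funext => x; rewrite (_ : 2 - 1 = 1); last by ring.
  by rewrite powRr1// ltW.
rewrite -/(F t) (_ : 2 * nu / 2 = nu); last by field.
have divE : I3 (fun x => s x t `^ (1 - 1) * divu u x t) = 0.
  rewrite subrr (_ : (fun x => _) = fun x => \sum_(i < 3) partial i (u i ^~ t) x).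
    by apply: I3_divergence => i; exact: (jC2_C2p (sol_u S i) t).1.
  by apply/funext => x; rewrite powRr0 mul1r.
have s1E : (fun x => s x t `^ 1 * divu u x t) = (fun x => s x t * divu u x t).
  by apply/funext => x; rewrite powRr1// ltW.
have GE : (fun x => th x t * (s x t `^ (1 - 1) * G x t)) = (fun x => th x t * G x t).
  by apply/funext => x; rewrite subrr powRr0 mul1r.
move: d2le; rewrite divE s1E GE mulr0 addr0 -/(F t) => d2le.
have := momentum_bound nu0 kappa0 gamma2 T0 S th1 u0b d0 d1 dT b0 gam tT'.
rewrite -/L.
have Y_le : L * Y t <= L * B by apply: ler_wpM2l => //; exact: YB.
have B0 : 0 <= B by exact: le_trans (Bu_ge1 _ b0).
have LB : 0 <= L * (1 + B) * t by apply: mulr_ge0 => //; apply: mulr_ge0 => //; exact: addr_ge0.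
have dI : (1 + t) * (delta * I3 (fun x => s x t `^ (gamma / 2 - 1) * divu u x t)) <= 1.
  have [dI0|/ltW dI0] := leP (delta * I3 (fun x => s x t `^ (gamma / 2 - 1) * divu u x t)) 0.
    by apply: le_trans ler01; rewrite mulr_ge0_le0// addr_ge0.
  by apply: le_trans (dT tT'); rewrite ler_wpM2r// lerD2l.
have t1 : 0 <= L * (1 + t) by rewrite mulr_ge0// addr_ge0.
have := ler_wpM2l t1 d3le; have := ler_wpM2l L0 dI.
move: d2le; rewrite mulr1 /KW -/L -/B.
move: (I3 _) (I3 _) (weighted_dissipation _ _ _ _ _) (F t) (Y t) Y_le (2 / gamma) LB.
move=> I J Gq f y Ly g LBt H1 H2 H3 H4; move: Ly LBt H1 H2 H3 H4.
lra.
Qed.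

Let W_0 := W0 nu gamma b e.
Let K_W := KW nu gamma b.
Let K_E := KE nu gamma b e.

Let B0 : 0 <= B. Proof. exact: le_trans (Bu_ge1 _ b0). Qed.

Lemma KW_ge0 : 0 <= K_W.
Proof.
have m0 : 0 <= mu nu by exact: le_trans (mu_gt1 nu0).
apply: addr_ge0; last by rewrite mulr_ge0// addr_ge0.
apply: addr_ge0.
  by apply: addr_ge0 => //; apply: mulr_ge0 => //; exact: sqr_ge0.
apply: mulr_ge0; last exact: addr_ge0.
by apply: mulr_ge0 => //; rewrite divr_ge0// mulr_ge0// ltW.
Qed.

Lemma W0_ge0 : 0 <= W_0.
Proof.
have := mulr_ge0 L0 B0; rewrite /W_0 /W0 -/L -/B.
by move: (L * B) e0 b0 => *; lra.
Qed.

Lemma KE_ge1 : 1 <= K_E.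
Proof. by have := W0_ge0; have := KW_ge0; rewrite /K_E /KE -/W_0 -/K_W; lra. Qed.

Lemma energy_init : energy 0 <= W_0.
Proof.
have cu2 : continuous (u2 u ^~ 0) := jcont_space 0 (jcont_u2 S).
have g1 : 1 <= gamma / 2 by rewrite ler_pdivlMr// mul1r.
have c1 : continuous (fun x => u2 u x 0 `^ (gamma / 2)).
  by apply: cont_powR_ge1 => // x; exact: u2_ge0.
have cc := @cont_cst R V.
have Es : I3 (s^~ 0) <= 2 + b.
  apply: (@le_trans _ _ (I3 (fun x => 2 + u2 u x 0 `^ (gamma / 2)))); last first.
    by rewrite (meanD (I3_mean R) (cc 2) c1) (mean_cst (I3_mean R)) lerD2l.
  apply: (le_mean (I3_mean R)) => // [|x _]; first by apply: contD.
  rewrite (_ : 2 + _ = 1 + u2 u x 0 `^ (gamma / 2) + 1); last by ring.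
  apply: lerD => //; have := u2_ge0 u x 0; rewrite le_eqVlt => /predU1P[<-|u0].
    by rewrite addr_ge0// powR_ge0.
  by rewrite -[leLHS]powRr1 ?(ltW u0)//; apply: powR_le1D => //; rewrite ler01.
have := YB (t := 0); rewrite lexx (ltW T0) => /(_ isT) Y0.
have := ler_wpM2l L0 Y0.
rewrite /energy /W_0 /W0 -/L -/B addr0 mulr1.
by move: Es th0e; move: (I3 _) (I3 _) (Y 0) => *; lra.
Qed.

Lemma cont_energy : continuous energy.
Proof.
have c1 := cont_I3 (jcont_th_powR S 2); have c2 := cont_I3 (jcont_sreg S delta).
have c3 := cont_velocity_power S d0.
have cc := @cont_cst R R.
have c4 : continuous (fun t : R => L * (1 + t)) by apply: contM => //; apply: contD => //; exact: cont_id.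
exact (contD (contD c1 (contM (cc 2) c2)) (contM c4 c3)).
Qed.

Lemma energy_le t : 0 <= t <= T -> energy t <= (W_0 + K_W) * (1 + t) ^+ 2.
Proof.
move=> tT; have [t0 _] := andP tT.
have dW (r : R) : 0 < r < T ->
    exists2 d : R, is_derive r 1 energy d & d <= K_W * (1 + r) ^+ 1.
  move=> rT; have [d dd dle] := energy_evolution rT; exists d => //.
  apply: (le_trans dle); rewrite expr1 gerDr mulNr oppr_le0 mulr_ge0 ?(ltW nu0)//.
  exact: (dissipation_ge0 S).
apply: (le_trans (derive_poly_le cont_energy KW_ge0 dW tT)).
rewrite [leRHS]mulrDl lerD2r; apply: (le_trans energy_init).
by rewrite ler_peMr ?W0_ge0// exprn_ege1// lerDl.
Qed.

Lemma energy_components t : 0 <= t ->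
  [/\ 0 <= I3 (fun x => th x t `^ 2), I3 (fun x => th x t `^ 2) <= energy t,
    0 <= energy t & I3 (s^~ t) <= energy t].
Proof.
move=> t0.
have E0 : 0 <= I3 (fun x => th x t `^ 2).
  by apply: (mean_ge0 (I3_mean R)) => // x _; exact: powR_ge0.
have s0 : 0 <= I3 (s^~ t) by apply: (mean_ge0 (I3_mean R)) => // x _; exact: ltW.
have Y0 : 0 <= L * (1 + t) * Y t.
  apply: mulr_ge0; first by rewrite mulr_ge0// addr_ge0.
  apply: (mean_ge0 (I3_mean R)) => [|x _]; last exact: powR_ge0.
  exact (jcont_space t (jcont_sreg_powR S d0 (gamma / 2))).
rewrite /energy; move: E0 s0 Y0; move: (I3 _) (I3 _) (_ * Y t) => x y z *.
by split; lra.
Qed.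

Let E t := K_E * (1 + t) ^+ 2.

Lemma energy_E t : 0 <= t <= T -> 1 + energy t <= E t.
Proof.
move=> tT; have [t0 _] := andP tT; have t1 : 1 <= (1 + t) ^+ 2 by rewrite exprn_ege1// lerDl.
have := energy_le tT; rewrite /E /K_E /KE -/W_0 -/K_W.
by move: (energy t) ((1 + t) ^+ 2) t1 => *; lra.
Qed.

Definition theta_dissipation t := I3 (fun x => th x t `^ (1 - a) * gradth2 th x t).
Definition theta_power t := I3 (fun x => th x t `^ (3 - a)).

(** [theta_power_evolution] for p = 2 - a. The heating term only helps in - d, and (2 - a) a kappa
    >= a kappa by a <= 1. The divergence term is split by Young's inequality with weight theta,
    using theta^(3 - 2a) <= 1 + theta^(3 - a). *)
Lemma theta_power_evolution_le t : 0 < t < T -> exists2 d,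
  is_derive t 1 (fun r => I3 (fun x => th x r `^ (2 - a))) d &
  - d <= - (a * kappa * theta_dissipation t) + a / 4 * (3 * F t + 1 + theta_power t).
Proof.
move=> tT; eexists; first exact (theta_power_evolution S (2 - a) tT).
rewrite (_ : 2 - a - 1 = 1 - a); last by ring.
rewrite (_ : 2 - (2 - a) = a) -/(theta_dissipation t); last by ring.
have cc := @cont_cst R V.
have cg2 : continuous (gradth2 th ^~ t) := jcont_space t (jcont_gradth2 S).
have Q0 : 0 <= theta_dissipation t.
  apply: (mean_ge0 (I3_mean R)) => [|x _]; first exact (contM (@cthp (1 - a) t) cg2).
  by apply: mulr_ge0; [exact: powR_ge0|apply: sumr_ge0 => i _; exact: sqr_ge0].
have H0 : 0 <= I3 (fun x => th x t `^ (1 - a) * G x t).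
  apply: (mean_ge0 (I3_mean R)) => [|x _]; first exact (contM (@cthp (1 - a) t) (@cG t)).
  by apply: mulr_ge0; [exact: powR_ge0|exact: gradu2_ge0].
have c1 := contM (@cth t) (@cG t).
have cdv : continuous (fun x => th x t `^ (2 - a) * divu u x t).
  exact (contM (@cthp (2 - a) t) (@cd t)).
have J : - I3 (fun x => th x t `^ (2 - a) * divu u x t) <=
    1 / 2 * (3 * F t + 1 + theta_power t).
  rewrite -(meanN (I3_mean R))//.
  have cr : continuous (fun x => 3 * (th x t * G x t) + 1 + th x t `^ (3 - a)).
    by apply: contD => //; apply: contD => //; apply: contM.
  have -> : 3 * F t + 1 + theta_power t =
      I3 (fun x => 3 * (th x t * G x t) + 1 + th x t `^ (3 - a)).
    rewrite (meanD (I3_mean R)) //; last by apply: contD => //; apply: contM.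
    rewrite (meanD (I3_mean R)) //; last exact: contM.
    by rewrite (meanZ (I3_mean R) 3 c1) (mean_cst (I3_mean R)).
  rewrite -(meanZ (I3_mean R))//; apply: (le_mean (I3_mean R)).
  - exact: contN.
  - exact: contM.
  move=> x _; have th0 := th_gt0 x t.
  have := young_sq (- divu u x t) (th x t `^ (2 - a)) th0.
  rewrite sqrrN powR_exprn -(powR_inv1 (ltW th0)) -powRD ?(gt_eqF th0) ?implybT//.
  have := ler_wpM2l (ltW th0) (divu_sq u x t).
  have : th x t `^ (- 1 + (2 - a) * 2) <= 1 + th x t `^ (3 - a).
    by apply: powR_le1D => //; move: a0 a1; lra.
  move: (th x t `^ (- 1 + _)) (th x t `^ (3 - a)) (th x t `^ (2 - a)) => p1 p2 p3.
  by move: (divu u x t ^+ 2) (divu u x t) => d2 d; lra.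
have k0 := mulr_ge0 (mulr_ge0 (ltW a0) (ltW kappa0)) Q0.
have k1 : 0 <= (2 - a) * nu / 2 * I3 (fun x => th x t `^ (1 - a) * G x t).
  by apply: mulr_ge0 => //; apply: divr_ge0 => //; apply: mulr_ge0; [move: a1; lra|exact: ltW].
have k2 : a * kappa * theta_dissipation t <= (2 - a) * a * kappa * theta_dissipation t.
  rewrite -(mulrA (2 - a)) -[leRHS]mulrA ler_peMl//.
  by move: a1; lra.
have := ler_wpM2l (ltW a0) J.
move: k1 k2; move: (I3 _) (I3 _) (theta_dissipation t) (theta_power t) (F t) => i1 i2 q v f.
by move=> *; lra.
Qed.

Let c_1 := c_theta nu a.
Let c_2 := c_velocity nu a.
Let K_1 := K1 nu gamma a b e.

Let c1_ge0 : 0 <= c_1.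
Proof.
rewrite /c_1 /c_theta; apply: divr_ge0; last by rewrite exprn_ge0// ltW.
by apply: mulr_ge0; [exact: ler0n|exact: ltW].
Qed.

Let c2_gt0 : 0 < c_2.
Proof.
rewrite /c_2 /c_velocity; apply: divr_gt0; first by rewrite ltr0n.
by apply: mulr_gt0 => //; exact: exprn_gt0.
Qed.

Let gradient_evolution t : 0 < t < T -> exists2 d,
  is_derive t 1 (fun r => I3 (fun x => th x r `^ (- a) * G x r)) d &
  d <= I3 (fun x => th x t `^ (- a - 1) * (- (a * nu / 4) * G x t ^+ 2
    + c_1 * th x t ^+ 4 + c_2 * u2 u x t ^+ 2)).
Proof. exact (gradient_energy_evolution S nu0 kappa0 nk a0 aK gamma2). Qed.

#[local] Opaque c_theta c_velocity.

(** Origin of the exponent 32, with t standing for 1 + time: t^2 from the bound of theta^(-a-1), t^6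
    from the inverse cube of the Young parameter, t^24 from the twelfth power of the energy
    bound. *)
Let poly_alg (c m2 t k N E0 : R) : 0 <= c -> 0 <= m2 -> 1 <= t -> 0 <= k -> 0 <= N -> 0 <= E0 ->
  c * (m2 * t ^+ 2) * (4 + N * (k * t ^+ 2) ^+ 3) * (E0 * t ^+ 2) ^+ 12 <=
  c * m2 * (4 + N * k ^+ 3) * E0 ^+ 12 * t ^+ 32.
Proof.
move=> c0 m0 t1 k0 N0 E1; have t0 : 0 <= t by exact: le_trans t1.
have t6 : 1 <= t ^+ 6 by rewrite exprn_ege1.
have Nk : 0 <= N * k ^+ 3 by rewrite mulr_ge0// exprn_ge0.
rewrite [leLHS](_ : _ = c * m2 * E0 ^+ 12 * t ^+ 26 *
  (4 + N * k ^+ 3 * t ^+ 6)); last by ring.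
rewrite [leRHS](_ : _ = c * m2 * E0 ^+ 12 * t ^+ 26 *
  ((4 + N * k ^+ 3) * t ^+ 6)); last by ring.
apply: ler_wpM2l; first by rewrite !mulr_ge0 ?exprn_ge0.
by rewrite mulrDl lerD2r ler_peMr.
Qed.

Lemma gradient_energy_le t : 0 < t < T -> exists2 d,
  is_derive t 1 (fun r => I3 (fun x => th x r `^ (- a) * G x r)) d &
  d <= c_1 * theta_power t + K_1 * (1 + t) ^+ 32.
Proof.
move=> tT; have tT' : 0 <= t <= T by move: tT => /andP[/ltW-> /ltW].
have [t0 _] := andP tT'; have t1 : 1 <= 1 + t by rewrite lerDl.
have [d dd dle] := gradient_evolution tT.
exists d => //; apply: (le_trans dle).
set q := fun x => th x t `^ (- a - 1); set h := sreg u 1 ^~ t.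
have h1 x : 1 <= h x by rewrite lerDr u2_ge0.
have h0 x : 0 < h x by exact: lt_le_trans (h1 x).
have ch : continuous h := jcont_space t (jcont_sreg S 1).
have chp p : continuous (fun x => h x `^ p) := jcont_space t (jcont_sreg_powR S ltr01 p).
have cq : continuous q by exact: cthp.
have cc := @cont_cst R V; have cth3 := @cthp (3 - a) t.
set P := I3 (fun x => q x * G x t ^+ 2); set X := I3 (fun x => h x `^ 2).
have cP : continuous (fun x => q x * G x t ^+ 2) by apply: contM => //; exact: contX.
have m1 : 1 <= mu nu * (1 + t) by rewrite -[leLHS]mulr1 ler_pM// mu_gt1.
set m2 := (mu nu * (1 + t)) ^+ 2.
have m2_gt0 : 0 < m2 by rewrite exprn_gt0// (lt_le_trans ltr01).
have cr : continuous (fun x => - (a * nu / 4) * (q x * G x t ^+ 2)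
    + c_1 * th x t `^ (3 - a) + c_2 * m2 * h x `^ 2).
  by apply: contD; [apply: contD|]; apply: contM.
apply: (@le_trans _ _ (I3 (fun x => - (a * nu / 4) * (q x * G x t ^+ 2)
    + c_1 * th x t `^ (3 - a) + c_2 * m2 * h x `^ 2))).
  apply: (le_mean (I3_mean R)) => //.
    apply: contM => //; apply: contD; [apply: contD|]; apply: contM => //; apply: contX => //.
    exact: (jcont_space t (jcont_u2 S)).
  move=> x _; have hx := th_gt0 x t.
  have u2h : u2 u x t ^+ 2 <= h x `^ 2.
    by rewrite powR_mulrn ?(ltW (h0 x))// lerXn2r ?nnegrE ?u2_ge0 ?(ltW (h0 x))// lerDl.
  have qm : q x <= m2.
    rewrite /q -opprD; apply: powRN_le => //; last by move: a0 a1; lra.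
    exact (theta_lower_linear nu0 kappa0 T0 S th1 x tT').
  have q4 : q x * th x t ^+ 4 = th x t `^ (3 - a).
    rewrite /q -powR_mulrn ?(ltW hx)// -powRD ?(gt_eqF hx) ?implybT//.
    by congr (_ `^ _); ring.
  have H : q x * u2 u x t ^+ 2 <= m2 * h x `^ 2 by rewrite ler_pM ?powR_ge0 ?sqr_ge0.
  rewrite -/(q x) -q4.
  have := ler_wpM2l (ltW c2_gt0) H.
  by move: (q x) (G x t ^+ 2) (th x t ^+ 4) (u2 u x t ^+ 2) (h x `^ 2) => *; lra.
rewrite (meanD (I3_mean R)); [|by apply: contD; apply: contM|exact: contM].
rewrite (meanD (I3_mean R)); [|exact: contM|exact: contM].
rewrite !(meanZ (I3_mean R))//.
rewrite -/P -/X -/(theta_power t) addrAC addrC lerD2l.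
(* Chosen so that c_2 m2 eta = a nu / 4, the coefficient of the negative term with [P], which is
   used up entirely. *)
pose eta := a * nu / (4 * (c_2 * m2)).
have cm0 : 0 < c_2 * m2 by rewrite mulr_gt0.
have eta0 : 0 < eta := divr_gt0 (mulr_gt0 a0 nu0) (mulr_gt0 (ltr0Sn R 3) cm0).
have [Eth0 EthW W_ge0 EsW] := energy_components t0.
have EE := energy_E tT'.
have E1 : 1 <= E t by apply: le_trans EE; rewrite lerDl.
have hE : I3 h <= E t.
  apply: le_trans EE; rewrite addrC; apply: (@le_trans _ _ (I3 (fun x => s x t + 1))).
    apply: (le_mean (I3_mean R)) => // [|x _]; first by apply: contD.
    by rewrite lerD2r lerDl ltW.
  by rewrite (meanD (I3_mean R) (@cs t) (cc 1)) (mean_cst (I3_mean R)) lerD2r.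
have cz : continuous (fun x => 1 + th x t `^ 2) by apply: contD.
have zE : I3 (fun x => 1 + th x t `^ 2) <= E t.
  rewrite (meanD (I3_mean R) (cc 1) (@cthp 2 t)) (mean_cst (I3_mean R)).
  by apply: le_trans EE; rewrite lerD2l.
(* The weight 1 + theta^2 dominates theta^(a+1) as a + 1 <= 2, and its mean is bounded by the
   energy. *)
have pz x : 1 <= q x * (1 + th x t `^ 2).
  have hx := th_gt0 x t.
  rewrite /q -opprD powRN ler_pdivlMl ?powR_gt0// mulr1.
  by apply: powR_le1D => //; move: a0 a1; lra.
have := @I3_sq_bound R h (G^~ t) q (fun x => 1 + th x t `^ 2) (E t) eta
  (C1p_sreg S 1 t) h1 (@cG t) (fun x => gradu2_ge0 u x t)
  (fun i x => partial_sreg_sq S i x t ltr01) cq cz (fun x => powR_ge0 _ _)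
  (fun x => addr_ge0 ler01 (powR_ge0 _ _)) pz eta0 E1 hE zE.
rewrite -/X -/P => /(ler_wpM2l (ltW cm0)) XP.
have e1 : c_2 * m2 * eta = a * nu / 4.
  by rewrite /eta; field; rewrite !gt_eqF.
have e2 : eta ^- 3 = (4 * c_2 * mu nu ^+ 2 / (a * nu) * (1 + t) ^+ 2) ^+ 3.
  have mu0 : 0 < mu nu by exact: lt_le_trans (mu_gt1 nu0).
  have tau0 : 0 < 1 + t by exact: lt_le_trans t1.
  rewrite -exprVn; congr (_ ^+ 3); rewrite /eta /m2; field.
  by rewrite !gt_eqF.
have K0 : 0 <= 4 * c_2 * mu nu ^+ 2 / (a * nu).
  apply: divr_ge0; last by rewrite mulr_ge0 ?(ltW nu0) ?(ltW a0).
  by apply: mulr_ge0; [rewrite mulr_ge0 ?(ltW c2_gt0)|exact: sqr_ge0].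
have N0 : 0 <= 108 ^+ 4 :> R by exact: exprn_ge0.
have := poly_alg (ltW c2_gt0) (sqr_ge0 (mu nu)) t1 K0 N0 (le_trans ler01 KE_ge1).
rewrite -exprMn -e2 -/m2 -/(E t) -/K_1.
have {}XP : c_2 * m2 * X <= a * nu / 4 * P + c_2 * m2 * (4 + 108 ^+ 4 * eta ^- 3) * E t ^+ 12.
  rewrite -e1; apply: (le_trans XP); move: (108 ^+ 4) (eta ^- 3) (E t ^+ 12) => p1 p2 p3.
  by rewrite le_eqVlt; apply/orP; left; apply/eqP; ring.
move: XP; move: (c_2 * m2 * _ * _) (c_2 * m2 * X) => p1 p2.
rewrite /K_1 /K1 -/c_2 -/K_E; move: (c_2 * _ * _ * _) (_ ^+ 32) => k1 k2.
by lra.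
Qed.

Let c_V := cV nu a.
Let cV_gt0 : 0 < c_V.
Proof. by apply: (lt_le_trans (_ : 0 < a / 4)); [exact: divr_gt0|rewrite lerDr c1_ge0]. Qed.

Let c_VE : c_V = c_1 + a / 4. Proof. by []. Qed.

Let K_Phi := KPhi nu kappa gamma a b e.
Let K_PhiE : K_Phi = a * kappa / 4 * K_E + c_V * (8 * c_V / (a * kappa)) ^+ 3 * K_E ^+ 3
  + K_1 + a / 4 + (1 + a / nu) * K_W.
Proof. by []. Qed.

Let K1_ge0 : 0 <= K_1.
Proof.
have K0 : 0 <= 4 * c_2 * mu nu ^+ 2 / (a * nu).
  apply: divr_ge0; last by rewrite mulr_ge0 ?(ltW nu0) ?(ltW a0).
  by apply: mulr_ge0; [rewrite mulr_ge0 ?(ltW c2_gt0)|exact: sqr_ge0].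
apply: mulr_ge0; last exact: exprn_ge0 (le_trans ler01 KE_ge1).
apply: mulr_ge0; first by apply: mulr_ge0; [exact: ltW|exact: sqr_ge0].
by apply: addr_ge0 => //; apply: mulr_ge0; [exact: exprn_ge0|exact: exprn_ge0 K0].
Qed.

#[local] Opaque cV K1 KPhi KW KE W0.

Let D r := I3 (fun x => th x r `^ (- a) * G x r).
Let Z r := I3 (fun x => th x r `^ (2 - a)).
(* [- Z] supplies [- a kappa int theta^(1-a) |grad theta|^2], which absorbs
   [int theta^(3-a)]; the multiple of the energy absorbs [int theta |grad u|^2]. *)
Let Phi r := D r - Z r + (1 + a / nu) * energy r.

(** In the multiplier 1 + a / nu of the energy, a / nu yields - a f, which absorbs the 3 a f / 4
    coming from - Z. The summand 1 lets the energy dominate Z when D is recovered from [Phi] in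
    [growth_alg]. *)
Let Phi_alg (dD dZ dW q f v E0 E3 t t32 k1 kw i : R) :
  0 <= f -> 1 <= t -> t <= t32 -> 0 <= kw -> 0 <= k1 ->
  dD <= c_1 * v + k1 * t32 ->
  - dZ <= - (a * kappa * q) + a / 4 * (3 * f + 1 + v) ->
  dW <= - nu * f + kw * t ->
  c_V * v <= a * kappa / 4 * E0 + a * kappa * q + i * E3 ->
  dD - dZ + (1 + a / nu) * dW <= a * kappa / 4 * E0 + i * E3 + k1 * t32 + a / 4 * t32
    + (1 + a / nu) * kw * t32.
Proof.
move=> f0 t1 t32_ge kw0 k10 hD hZ hW; rewrite c_VE => hv.
have A0 : 0 <= 1 + a / nu by rewrite addr_ge0// divr_ge0// ltW.
have := ler_wpM2l A0 hW.
have -> : (1 + a / nu) * (- nu * f + kw * t) = - (nu + a) * f + (1 + a / nu) * kw * t.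
  by field; rewrite gt_eqF.
have : (1 + a / nu) * kw * t <= (1 + a / nu) * kw * t32 by rewrite ler_wpM2l// mulr_ge0.
have : a / 4 * 1 <= a / 4 * t32.
  by rewrite ler_wpM2l ?(le_trans t1)// divr_ge0// ltW.
have : 0 <= a * f by rewrite mulr_ge0// ltW.
have : 0 <= nu * f by rewrite mulr_ge0// ltW.
by move: ((1 + a / nu) * dW) (_ * kw * t) (_ * kw * t32) => *; lra.
Qed.

Let Phi_evolution r : 0 < r < T -> exists2 d, is_derive r 1 Phi d & d <= K_Phi * (1 + r) ^+ 32.
Proof.
move=> rT; have rT' : 0 <= r <= T by move: rT => /andP[/ltW-> /ltW].
have [r0 _] := andP rT'; have t1 : 1 <= 1 + r by rewrite lerDl.
have [dD hD dDle] := gradient_energy_le rT.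
have [dZ hZ dZle] := theta_power_evolution_le rT.
have [dW hW dWle] := energy_evolution rT.
exists (dD - dZ + (1 + a / nu) * dW); first exact: dervD (dervB hD hZ) (dervZ _ hW).
have [Eth0 EthW W_ge0 EsW] := energy_components r0.
have EE := energy_E rT'.
(* With the factor 8 of [I3_theta_bound], c_V * 8 eta = a kappa: the theta dissipation supplied by -
   Z is used up exactly. *)
pose eta := a * kappa / (8 * c_V).
have eta0 : 0 < eta := divr_gt0 (mulr_gt0 a0 kappa0) (mulr_gt0 (ltr0Sn R 7) cV_gt0).
have thE : 1 + I3 (fun x => th x r `^ 2) <= E r by apply: le_trans EE; rewrite lerD2l.
have a01 : 0 < a <= 1 by rewrite a0 a1.
have := I3_theta_bound (jC2_C2p (sol_th S) r).1 (th_gt0^~ r) a01 eta0 thE.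
rewrite -/(theta_power r) -/(theta_dissipation r) => /(ler_wpM2l (ltW cV_gt0)) vle.
have e1 : c_V * eta = a * kappa / 8 by rewrite /eta; field; rewrite gt_eqF.
have e2 : eta ^- 3 = (8 * c_V / (a * kappa)) ^+ 3.
  by rewrite -exprVn; congr (_ ^+ 3); rewrite /eta; field; rewrite !gt_eqF.
have {}vle : c_V * theta_power r <= a * kappa / 4 * E r + a * kappa * theta_dissipation r
    + c_V * eta ^- 3 * E r ^+ 3.
  apply: (le_trans vle); move: (eta ^- 3) (E r ^+ 3) => w E3.
  rewrite [leLHS](_ : _ = c_V * eta * (2 * E r + 8 * theta_dissipation r) + c_V * w * E3).
    by rewrite e1 le_eqVlt; apply/orP; left; apply/eqP; field.
  by ring.
have t32 : 1 + r <= (1 + r) ^+ 32 by rewrite -[leLHS]expr1 ler_weXn2l.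
apply: (le_trans (Phi_alg (dissipation_ge0 S r) t1 t32 KW_ge0 K1_ge0 dDle dZle dWle vle)).
rewrite K_PhiE -e2; move: (eta ^- 3) (invr_ge0 (eta ^+ 3)) => w.
rewrite exprn_ge0 ?(ltW eta0)// => w0.
rewrite [leRHS](_ : _ = a * kappa / 4 * K_E * (1 + r) ^+ 32 + c_V * w * K_E ^+ 3 * (1 + r) ^+ 32
  + K_1 * (1 + r) ^+ 32 + a / 4 * (1 + r) ^+ 32 + (1 + a / nu) * K_W * (1 + r) ^+ 32); last by ring.
do 3?apply: lerD => //; apply: lerD.
  rewrite -[leRHS]mulrA ler_wpM2l ?divr_ge0 ?mulr_ge0 ?(ltW a0) ?(ltW kappa0)//.
  by rewrite /E ler_wpM2l ?(le_trans ler01 KE_ge1)// ler_weXn2l.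
rewrite -[leRHS]mulrA; apply: ler_wpM2l; first exact: mulr_ge0 (ltW cV_gt0) w0.
rewrite /E exprMn -exprM ler_wpM2l ?exprn_ge0 ?(le_trans ler01 KE_ge1)//.
by rewrite ler_weXn2l.
Qed.

Let K_Phi_ge0 : 0 <= K_Phi.
Proof.
rewrite K_PhiE; have KE0 := le_trans ler01 KE_ge1.
have A0 : 0 <= 1 + a / nu by rewrite addr_ge0// divr_ge0// ltW.
apply: addr_ge0; last by rewrite mulr_ge0// KW_ge0.
apply: addr_ge0; last by rewrite divr_ge0// ltW.
apply: addr_ge0 => //; apply: addr_ge0.
  by rewrite mulr_ge0// divr_ge0// mulr_ge0// ltW.
apply: mulr_ge0; last exact: exprn_ge0.
apply: mulr_ge0; first exact: ltW.
apply: exprn_ge0; apply: divr_ge0; last by rewrite mulr_ge0// ltW.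
by rewrite mulr_ge0// ltW.
Qed.

Let growth_alg (A w k t33 Dt D0 Zt Z0 et en : R) :
  Dt - Zt + A * et <= D0 - Z0 + A * en + k * t33 -> 0 <= Z0 -> Zt <= 1 + et ->
  A * en <= A * w -> et <= A * et -> (A * w + 1) * 1 <= (A * w + 1) * t33 ->
  Dt <= D0 + (A * w + 1 + k) * t33.
Proof. by move: (A * en) (A * et) (A * w) => *; lra. Qed.

Lemma gradient_growth t : 0 <= t <= T ->
  I3 (fun x => th x t `^ (- a) * G x t) <= I3 (fun x => th x 0 `^ (- a) * G x 0)
    + ((1 + a / nu) * W_0 + 1 + K_Phi) * (1 + t) ^+ 33.
Proof.
move=> tT; have [t0 _] := andP tT; have a2 : 0 <= 2 - a <= 2 by move: a0 a1; lra.
rewrite -/(D t) -/(D 0).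
have cc := @cont_cst R R.
have A1 : 1 <= 1 + a / nu by rewrite lerDl divr_ge0// ltW.
have cPhi : continuous Phi.
  have c1 := @cont_I3 R (fun x r => th x r `^ (- a) * G x r)
    (contM (jcont_th_powR S (- a)) (jcont_gradu2 S)).
  have c2 := cont_I3 (jcont_th_powR S (2 - a)).
  exact (contD (contB c1 c2) (contM (cc (1 + a / nu)) cont_energy)).
have PhiT := derive_poly_le cPhi K_Phi_ge0 Phi_evolution tT.
have Z0 : 0 <= Z 0 by apply: (mean_ge0 (I3_mean R)) => // x _; exact: powR_ge0.
have Zt : Z t <= 1 + energy t.
  have [_ EthW _ _] := energy_components t0.
  apply: (@le_trans _ _ (1 + I3 (fun x => th x t `^ 2))); last by rewrite lerD2l.
  rewrite (_ : 1 + _ = I3 (fun x => 1 + th x t `^ 2)); last first.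
    rewrite (meanD (I3_mean R)) ?(mean_cst (I3_mean R))//; exact: cont_cst.
  apply: (le_mean (I3_mean R)) => // [|x _]; first by apply: contD => //; exact: cont_cst.
  exact: powR_le1D (th_gt0 x t) a2.
have [_ _ Wt _] := energy_components t0.
have AW := ler_wpM2l (le_trans ler01 A1) energy_init.
have AWt : energy t <= (1 + a / nu) * energy t by rewrite ler_peMl.
have t33 : 1 <= (1 + t) ^+ 33 by rewrite exprn_ege1// lerDl.
have W33 : ((1 + a / nu) * W_0 + 1) * 1 <= ((1 + a / nu) * W_0 + 1) * (1 + t) ^+ 33.
  by rewrite ler_wpM2l// addr_ge0// mulr_ge0 ?W0_ge0// (le_trans ler01).
exact: (growth_alg PhiT Z0 Zt AW AWt W33).
Qed.

End energy.

(** * Conclusion *)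

Section conclusion.
Variable R : realType.
Notation V := (R * R * R)%type.

(** [Lp_norm] takes [fine] of an extended real, so finiteness has to be shown: an infinite norm
    would make the integral of the continuous function |f|^p infinite. *)
Lemma Lp_norm_powR (p : R) (f : V -> R) : 0 < p ->
  continuous (fun x => `|f x| `^ p) -> Lp_norm p f `^ p = I3 (fun x => `|f x| `^ p).
Proof.
move=> p0 cf; apply: EFin_inj; rewrite -EFin_I3// -(poweR_EFin (Lp_norm p f)).
have pN : (p != 0)%R by rewrite gt_eqF.
have N := poweR_Lnorm (torus R) (EFin \o f) pN.
have IE : (\int[torus R]_x (`|(EFin \o f) x| `^ p) = \int[torus R]_x (`|f x| `^ p)%:E)%E.
  by apply: eq_integral => x _; exact: (poweR_EFin `|f x|).
rewrite -IE -N; congr (_ `^ _)%E; rewrite /Lp_norm fineK//.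
rewrite ge0_fin_numE ?Lnorm_ge0//; rewrite ltey; apply/eqP => NE.
by move: N; rewrite NE poweRyr// IE EFin_I3.
Qed.

Lemma integrable_in_time (T : R) (g : V -> R -> R) (h : R -> \bar R) : jcont g ->
  (forall t, 0 <= t <= T -> h t = (I3 (g^~ t))%:E) ->
  (@lebesgue_measure R).-integrable `[0, T] h.
Proof.
move=> cg hE; have E : {in `[0, T]%classic, (fun t => (I3 (g^~ t))%:E) =1 h}.
  by move=> t /set_mem; rewrite /= in_itv/= => /hE ->.
have mD : measurable (`[0, T]%classic : set (measurableTypeR R)) by exact: measurable_itv.
refine (eq_integrable mD _ _ E _).
apply: (@continuous_compact_integrable R (fun t => I3 (g^~ t))); first exact: segment_compact.
exact: continuous_subspaceT (cont_I3 cg).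
Qed.

End conclusion.

Theorem theorem1p2 (R : realType) :
  exists (C : R -> R -> R -> R -> R -> R) (M : R -> R -> R),
  forall (nu kappa gamma K T : R)
    (u : R * R * R -> R -> 'rV[R]_3) (theta : R * R * R -> R -> R)
    (u0 : R * R * R -> 'rV[R]_3) (theta0 : R * R * R -> R),
  0 < nu -> 0 < kappa -> nu <= kappa -> K = kappa / nu + 1 ->
  2 <= gamma -> gamma = 2 \/ 9 / 4 <= gamma ->
  0 < T ->
  classical_solution nu kappa gamma T u theta ->
  (forall x, u x 0 = u0 x) -> (forall x, theta x 0 = theta0 x) ->
  (forall j : 'I_3, in_H1 (vcomp u0 j)) ->
  in_L2 theta0 -> (forall x, 1 <= theta0 x) ->
  let C0 := C nu gamma K (Lp_norm gamma (fun x => enorm (u0 x)))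
              (Lp_norm 2 theta0) in
  let M0 := M K gamma in
  [/\ 0 < C0, 0 < M0,
      forall t, t \in `[0, T] ->
        (\int[torus R]_x (theta x t `^ (- K^-1) * vgrad_sq (u^~ t) x)%:E
         <= \int[torus R]_x (theta0 x `^ (- K^-1) * vgrad_sq u0 x)%:E
            + (C0 * (t `^ M0 + 1))%:E)%E
    & [/\ (@lebesgue_measure R).-integrable `[0, T] (fun t =>
            \int[torus R]_x
              (theta x t `^ ((K - 1) / K) * vhess_sq (u^~ t) x)%:E)%E,
          (@lebesgue_measure R).-integrable `[0, T] (fun t =>
            \int[torus R]_x
              (theta x t `^ (- ((K + 1) / K))
               * vgrad_sq (u^~ t) x ^+ 2)%:E)%E
        & (@lebesgue_measure R).-integrable `[0, T] (fun t =>
            \int[torus R]_x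
              (theta x t `^ (- ((K + 1) / K))
               * vgrad_sq (u^~ t) x * grad_sq (theta^~ t) x)%:E)%E]].

Proof.
(* [C] does not receive kappa, which is recovered as nu (K - 1). The norms are raised to the powers
   gamma and 2 to become the integrals [b] and [e]; the absolute value and the summand 1 ensure
   positivity, and 2^33 comes from (1 + t)^33 <= 2^33 (1 + t^33). *)
exists (fun nu gamma K A E => 1 + `|growth_constant nu (nu * (K - 1)) gamma K^-1
  (A `^ gamma) (E `^ 2)| * 2 `^ 33), (fun _ _ => 33).
move=> nu kappa gamma K T u theta u0 theta0 nu0 kappa0 nk KE gamma2 gam T0 sol u0E th0E _ _ th1.
have KP : nu * (K - 1) = kappa by rewrite KE; field; rewrite gt_eqF.
have K0 : 0 < K by rewrite KE addr_gt0// divr_gt0.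
set a := K^-1.
have a0 : 0 < a by rewrite invr_gt0.
have a1 : a <= 1 by rewrite invf_le1// KE lerDr divr_ge0// ltW.
have aK : a * kappa = nu * (1 - a) by rewrite /a -KP; field; rewrite gt_eqF.
have S := classical_solution_clamp T0 sol.
set uc := (fun j x t => u x (clamp T t) 0 j) in S.
set thc := (fun x t => theta x (clamp T t)) in S.
have c0 : clamp T 0 = 0 by rewrite clampE// lexx ltW.
have thc1 x : 1 <= thc x 0 by rewrite /thc c0 th0E.
have [delta /andP[d0 d1] dT] := regularization_parameter gamma2 T0 S.
have g0 : 0 < gamma by exact: lt_le_trans gamma2.
have u2E x : `|enorm (u0 x)| `^ gamma = u2 uc x 0 `^ (gamma / 2).
  rewrite ger0_norm ?sqrtr_ge0// /enorm -powR12_sqrt; last first.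
    by apply: sumr_ge0 => j _; exact: sqr_ge0.
  by rewrite -powRrM (mulrC 2^-1) /u2 /uc c0; under eq_bigr do rewrite -u0E.
have b_E : Lp_norm gamma (fun x => enorm (u0 x)) `^ gamma = I3 (fun x => u2 uc x 0 `^ (gamma / 2)).
  rewrite -(funext u2E); apply: Lp_norm_powR => //; rewrite (funext u2E).
  apply: cont_powR_ge1; [exact (jcont_space 0 (jcont_u2 S))|by move=> x; exact: u2_ge0|].
  by rewrite ler_pdivlMr// mul1r.
have thE x : `|theta0 x| `^ 2 = thc x 0 `^ 2.
  by rewrite /thc c0 th0E ger0_norm// (le_trans ler01).
have e_E : Lp_norm 2 theta0 `^ 2 = I3 (fun x => thc x 0 `^ 2).
  rewrite -(funext thE); apply: Lp_norm_powR => //; rewrite (funext thE).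
  exact (jcont_space 0 (jcont_th_powR S 2)).
rewrite /= b_E e_E KP.
set b := I3 (fun x => u2 uc x 0 `^ (gamma / 2)); set e := I3 (fun x => thc x 0 `^ 2).
have b0 : 0 <= b by rewrite /b -b_E powR_ge0.
have e0 : 0 <= e by rewrite /e -e_E powR_ge0.
set g := growth_constant _ _ _ _ _ _.
have growth t : 0 <= t <= T -> I3 (fun x => thc x t `^ (- a) * gradu2 uc x t) <=
    I3 (fun x => thc x 0 `^ (- a) * gradu2 uc x 0) + g * (1 + t) ^+ 33.
  exact: (gradient_growth nu0 kappa0 gamma2 T0 gam nk a0 a1 aK S thc1 b0 (lexx _) e0 (lexx _) d0 d1 dT).
have cD : jcont (fun x t => thc x t `^ (- a) * gradu2 uc x t).
  exact (contM (jcont_th_powR S (- a)) (jcont_gradu2 S)).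
have DE t : 0 <= t <= T -> (\int[torus R]_x (theta x t `^ (- a) * vgrad_sq (u^~ t) x)%:E)%E =
    (I3 (fun x => thc x t `^ (- a) * gradu2 uc x t))%:E.
  move=> tT; rewrite -EFin_I3; last exact (jcont_space t cD).
  by rewrite /thc /gradu2 /uc clampE.
have C0 : 0 < 1 + `|g| * 2 `^ 33 by rewrite ltr_wpDr// mulr_ge0 ?powR_ge0.
split => //.
- move=> t; rewrite in_itv/= => tT; have [t0 _] := andP tT.
  have u00 : u0 = u^~ 0 by apply/funext.
  have th00 : theta0 = theta^~ 0 by apply/funext.
  rewrite u00 th00 !DE ?lexx ?(ltW T0)// -EFinD lee_fin (le_trans (growth t tT))// lerD2l.
  have P : (1 + t) ^+ 33 <= 2 `^ 33 * (t `^ 33 + 1).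
    by rewrite -powR_mulrn ?addr_ge0// addrC (addrC (t `^ _)); exact: powR_1D_le.
  apply: (@le_trans _ _ (`|g| * (2 `^ 33 * (t `^ 33 + 1)))).
    apply: (@le_trans _ _ (`|g| * (1 + t) ^+ 33)); last by rewrite ler_wpM2l.
    by rewrite ler_wpM2r ?ler_norm// exprn_ge0// addr_ge0.
  by rewrite mulrA ler_wpM2r ?addr_ge0 ?powR_ge0// lerDr.
have [t_in cth cu] : [/\ forall t, 0 <= t <= T -> clamp T t = t,
    forall p, jcont (fun x t => thc x t `^ p) & jcont (gradu2 uc)].
  by split; [move=> t; exact: clampE|move=> p; exact (jcont_th_powR S p)|exact (jcont_gradu2 S)].
split.
- pose hess2 x t := \sum_(i < 3) \sum_(j < 3) \sum_(k < 3)
    partial i (partial k (uc j ^~ t)) x ^+ 2.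
  have ch : jcont hess2.
    rewrite /jcont /hess2; cont_arith; exact (jC2_ddcont (sol_u S _) _ _).
  apply: (@integrable_in_time R T (fun x t => thc x t `^ ((K - 1) / K) * hess2 x t)).
    exact (contM (cth _) ch).
  move=> t tT; rewrite -EFin_I3; last exact (contM (jcont_space t (cth _)) (jcont_space t ch)).
  by rewrite /thc /hess2 /uc t_in.
- apply: (@integrable_in_time R T
    (fun x t => thc x t `^ (- ((K + 1) / K)) * gradu2 uc x t ^+ 2)).
    exact (contM (cth _) (contX (n := 2) cu)).
  move=> t tT; rewrite -EFin_I3; last exact (contM (jcont_space t (cth _)) (contX (n := 2) (jcont_space t cu))).
  by rewrite /thc /gradu2 /uc t_in.
- have cg := jcont_gradth2 S.
  apply: (@integrable_in_time R T
    (fun x t => thc x t `^ (- ((K + 1) / K)) * gradu2 uc x t * gradth2 thc x t)).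
    exact (contM (contM (cth _) cu) cg).
  move=> t tT; rewrite -EFin_I3; last first.
    exact (contM (contM (jcont_space t (cth _)) (jcont_space t cu)) (jcont_space t cg)).
  by rewrite /thc /gradu2 /gradth2 /uc t_in.
Qed.
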